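(* Let $f,g,h,U_1,U_2$ satisfy the standing hypotheses (a)–(e) listed in the context. Then the upper and lower value functions $V^{\pm}$ (defined in the context) are continuous on $[0,T]\times\mathbb{R}^n$. Moreover, there exist a constant $C>0$ and a nondecreasing continuous function $N:[0,\infty)\to[0,\infty)$ such that $$|V^{\pm}(t,x)-V^{\pm}(t,\bar x)|\le C\big(\langle x\rangle\vee\langle\bar x\rangle\big)^{\mu-1}|x-\bar x|,\qquad t\in[0,T],\ x,\bar x\in\mathbb{R}^n,$$ and $$|V^{\pm}(t,x)-V^{\pm}(\bar t,x)|\le N(|x|)\,|t-\bar t|^{\frac{\rho_1-\sigma_1}{\rho_1}\wedge\frac{\rho_2-\sigma_2}{\rho_2}},\qquad\forall t,\bar t\in[0,T],\ x\in\mathbb{R}^n.$$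
   Context: Notation: $\langle x\rangle=\sqrt{1+|x|^2}$; $\langle\cdot,\cdot\rangle$ with two arguments is the Euclidean inner product; $a\vee b=\max\{a,b\}$, $a\wedge b=\min\{a,b\}$. Hypotheses. $T>0$ is fixed. There are constants $L,c,\rho_1,\rho_2>0$, $\sigma_1,\sigma_2\ge0$, $\mu\ge1$, $\mu_0,\mu_1,\mu_2\in\mathbb{R}$ such that, for all $t\in[0,T]$, $x,y\in\mathbb{R}^n$, $u_1\in U_1$, $u_2\in U_2$: (a) $U_i\subseteq\mathbb{R}^{m_i}$ is closed and $0\in U_i$, $i=1,2$. (b) $f:[0,T]\times\mathbb{R}^n\times U_1\times U_2\to\mathbb{R}^n$ is continuous, $|f(t,x,u_1,u_2)|\le L(\langle x\rangle+|u_1|^{\sigma_1}+|u_2|^{\sigma_2})$, $|f(t,x,u_1,u_2)-f(t,y,u_1,u_2)|\le[(\langle x\rangle\vee\langle y\rangle)^{\mu_0}+(\langle x\rangle\vee\langle y\rangle)^{\mu_1}|u_1|^{\sigma_1}+(\langle x\rangle\vee\langle y\rangle)^{\mu_2}|u_2|^{\sigma_2}]\,|x-y|$, and $\langle f(t,x,u_1,u_2)-f(t,y,u_1,u_2),x-y\rangle\le L|x-y|^2$. (c) $g:[0,T]\times\mathbb{R}^n\times U_1\times U_2\to\mathbb{R}$ is continuous, $c|u_1|^{\rho_1}-L(\langle x\rangle^\mu+|u_2|^{\rho_2})\le g(t,x,u_1,u_2)\le L(\langle x\rangle^\mu+|u_1|^{\rho_1})-c|u_2|^{\rho_2}$, and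 $|g(t,x,u_1,u_2)-g(t,y,u_1,u_2)|\le[(\langle x\rangle\vee\langle y\rangle)^{\mu-1}+|u_1|^{\rho_1(\mu-1)/\mu}+|u_2|^{\rho_2(\mu-1)/\mu}]\,|x-y|$. (d) $h:\mathbb{R}^n\to\mathbb{R}$ is continuous, $|h(x)-h(y)|\le L(\langle x\rangle\vee\langle y\rangle)^{\mu-1}|x-y|$ and $|h(0)|\le L$. (e) $\sigma_i\mu<\rho_i$, $i=1,2$. Game. For $t\in[0,T]$, $\mathcal{U}_i^1[t,T]$ is the set of measurable $u_i:[t,T]\to U_i$ with $\int_t^T|u_i(s)|ds<\infty$, and $\mathcal{U}_i[t,T]=\mathcal{U}_i^\infty[t,T]$ is the set of essentially bounded measurable $u_i:[t,T]\to U_i$. For $u_i\in\mathcal{U}_i[t,T]$ and $x\in\mathbb{R}^n$, $y(\cdot)=y(\cdot;t,x,u_1,u_2)$ is the solution on $[t,T]$ of $\dot y(s)=f(s,y(s),u_1(s),u_2(s))$, $y(t)=x$, and $$J(t,x;u_1,u_2)=\int_t^Tg(s,y(s),u_1(s),u_2(s))ds+h(y(T)).$$ An Elliott–Kalton strategy for Player 1 is a map $\alpha_1:\mathcal{U}_2^1[t,T]\to\mathcal{U}_1^\infty[t,T]$ that is non-anticipating: for any $u_2,\bar u_2\in\mathcal{U}^1_2[t,T]$ and $\hat t\in[t,T]$, if $u_2=\bar u_2$ a.e. on $[t,\hat t]$ then $\alpha_1[u_2]=\alpha_1[\bar u_2]$ a.e. on $[t,\hat t]$. The set of these is $\mathcal{A}_1[t,T]$.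 Symmetrically, $\mathcal{A}_2[t,T]$ is the set of non-anticipating maps $\alpha_2:\mathcal{U}_1^1[t,T]\to\mathcal{U}_2^\infty[t,T]$. The upper and lower value functions are $$V^+(t,x)=\sup_{\alpha_2\in\mathcal{A}_2[t,T]}\inf_{u_1\in\mathcal{U}_1[t,T]}J(t,x;u_1,\alpha_2[u_1]),\qquad V^-(t,x)=\inf_{\alpha_1\in\mathcal{A}_1[t,T]}\sup_{u_2\in\mathcal{U}_2[t,T]}J(t,x;\alpha_1[u_2],u_2).$$ *)

(* Defs.v *)
From HB Require Import structures.
From mathcomp Require Import all_boot all_order all_algebra.
From mathcomp Require Import all_classical all_reals all_analysis.
Set Implicit Arguments.
Unset Strict Implicit.
Unset Printing Implicit Defensive.
Import Order.TTheory GRing.Theory Num.Theory.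
Import numFieldNormedType.Exports.
Local Open Scope classical_set_scope.
Local Open Scope ring_scope.

(* MathComp-Analysis norms row vectors by the max-norm, hence the explicit
   Euclidean structure; both norms induce the same topology. *)
Definition dotp (R : realType) (n : nat) (x y : 'rV[R]_n) : R :=
  \sum_(i < n) x 0 i * y 0 i.

Definition enorm (R : realType) (n : nat) (x : 'rV[R]_n) : R :=
  Num.sqrt (dotp x x).

Definition jap (R : realType) (n : nat) (x : 'rV[R]_n) : R :=
  Num.sqrt (1 + enorm x ^+ 2).

Definition japmax (R : realType) (n : nat) (x y : 'rV[R]_n) : R :=
  Num.max (jap x) (jap y).

(* In the conditions below functions on [0,T] x R^n x U1 x U2 are total, but
   only their restriction to that set is constrained. Real powers follow
   [powR], for which 0 `^ 0 = 1. *)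
Definition game_domain (R : realType) (n m1 m2 : nat) (T : R)
    (U1 : set 'rV[R]_m1) (U2 : set 'rV[R]_m2) :
    set (R * 'rV[R]_n * 'rV[R]_m1 * 'rV[R]_m2) :=
  [set p | [/\ 0 <= p.1.1.1 <= T, U1 p.1.2 & U2 p.2]].

Definition control_set_cond (R : realType) (m : nat) (U : set 'rV[R]_m) : Prop :=
  closed U /\ U 0.

Definition dynamics_cond (R : realType) (n m1 m2 : nat)
    (T L sigma1 sigma2 mu0 mu1 mu2 : R)
    (U1 : set 'rV[R]_m1) (U2 : set 'rV[R]_m2)
    (f : R -> 'rV[R]_n -> 'rV[R]_m1 -> 'rV[R]_m2 -> 'rV[R]_n) : Prop :=
  {within game_domain T U1 U2,
    continuous (fun p : R * 'rV[R]_n * 'rV[R]_m1 * 'rV[R]_m2 =>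
                  f p.1.1.1 p.1.1.2 p.1.2 p.2)} /\
  forall (t : R) (x y : 'rV[R]_n) (u1 : 'rV[R]_m1) (u2 : 'rV[R]_m2),
    0 <= t <= T -> U1 u1 -> U2 u2 ->
    [/\ enorm (f t x u1 u2)
          <= L * (jap x + enorm u1 `^ sigma1 + enorm u2 `^ sigma2),
        enorm (f t x u1 u2 - f t y u1 u2)
          <= (japmax x y `^ mu0
              + japmax x y `^ mu1 * enorm u1 `^ sigma1
              + japmax x y `^ mu2 * enorm u2 `^ sigma2) * enorm (x - y)
      & dotp (f t x u1 u2 - f t y u1 u2) (x - y) <= L * enorm (x - y) ^+ 2].

Definition running_cost_cond (R : realType) (n m1 m2 : nat)
    (T L c rho1 rho2 mu : R)
    (U1 : set 'rV[R]_m1) (U2 : set 'rV[R]_m2)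
    (g : R -> 'rV[R]_n -> 'rV[R]_m1 -> 'rV[R]_m2 -> R) : Prop :=
  {within game_domain T U1 U2,
    continuous (fun p : R * 'rV[R]_n * 'rV[R]_m1 * 'rV[R]_m2 =>
                  g p.1.1.1 p.1.1.2 p.1.2 p.2)} /\
  forall (t : R) (x y : 'rV[R]_n) (u1 : 'rV[R]_m1) (u2 : 'rV[R]_m2),
    0 <= t <= T -> U1 u1 -> U2 u2 ->
    [/\ c * enorm u1 `^ rho1 - L * (jap x `^ mu + enorm u2 `^ rho2)
          <= g t x u1 u2,
        g t x u1 u2
          <= L * (jap x `^ mu + enorm u1 `^ rho1) - c * enorm u2 `^ rho2
      & `|g t x u1 u2 - g t y u1 u2|
          <= (japmax x y `^ (mu - 1)
              + enorm u1 `^ (rho1 * (mu - 1) / mu)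
              + enorm u2 `^ (rho2 * (mu - 1) / mu)) * enorm (x - y)].

Definition terminal_cost_cond (R : realType) (n : nat) (L mu : R)
    (h : 'rV[R]_n -> R) : Prop :=
  [/\ continuous h,
      forall x y : 'rV[R]_n,
        `|h x - h y| <= L * japmax x y `^ (mu - 1) * enorm (x - y)
    & `|h 0| <= L].

(* A control on [t,T] is a total function of time of which only the values on
   [t,T] matter. Measurability is Borel and componentwise: every Lebesgue
   measurable control agrees almost everywhere on [t,T] with a Borel one with
   values in the same set, and trajectories, payoffs and the nonanticipation
   property only depend on almost-everywhere classes. *)
Definition is_control (R : realType) (m : nat) (U : set 'rV[R]_m) (t T : R)
    (u : R -> 'rV[R]_m) : Prop :=
  (forall s : R, t <= s <= T -> U (u s)) /\
  (forall i : 'I_m, measurable_fun `[t, T] (fun s : R => u s 0 i)).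

Definition controls_L1 (R : realType) (m : nat) (U : set 'rV[R]_m) (t T : R) :
    set (R -> 'rV[R]_m) :=
  [set u | is_control U t T u /\
    (\int[@lebesgue_measure R]_(s in `[t, T]) (enorm (u s))%:E < +oo)%E].

Definition controls_Loo (R : realType) (m : nat) (U : set 'rV[R]_m) (t T : R) :
    set (R -> 'rV[R]_m) :=
  [set u | is_control U t T u /\
    exists M : R,
      {ae @lebesgue_measure R, forall s : R, t <= s <= T -> enorm (u s) <= M}].

(* Caratheodory solutions, i.e. the integral form of the initial value
   problem. *)
Definition is_trajectory (R : realType) (n m1 m2 : nat) (T : R)
    (f : R -> 'rV[R]_n -> 'rV[R]_m1 -> 'rV[R]_m2 -> 'rV[R]_n)
    (t : R) (x : 'rV[R]_n) (u1 : R -> 'rV[R]_m1) (u2 : R -> 'rV[R]_m2)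
    (y : R -> 'rV[R]_n) : Prop :=
  {within `[t, T], continuous y} /\
  forall i : 'I_n,
    (@lebesgue_measure R).-integrable `[t, T]
      (fun r : R => (f r (y r) (u1 r) (u2 r) 0 i)%:E) /\
    forall s : R, t <= s <= T ->
      y s 0 i = x 0 i +
        \int[@lebesgue_measure R]_(r in `[t, s]) f r (y r) (u1 r) (u2 r) 0 i.

(* The standing conditions determine the trajectory uniquely on [t,T] for
   essentially bounded controls; [get] selects it. *)
Definition trajectory (R : realType) (n m1 m2 : nat) (T : R)
    (f : R -> 'rV[R]_n -> 'rV[R]_m1 -> 'rV[R]_m2 -> 'rV[R]_n)
    (t : R) (x : 'rV[R]_n) (u1 : R -> 'rV[R]_m1) (u2 : R -> 'rV[R]_m2) :
    R -> 'rV[R]_n :=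
  get [set y | is_trajectory T f t x u1 u2 y].

Definition payoff (R : realType) (n m1 m2 : nat) (T : R)
    (f : R -> 'rV[R]_n -> 'rV[R]_m1 -> 'rV[R]_m2 -> 'rV[R]_n)
    (g : R -> 'rV[R]_n -> 'rV[R]_m1 -> 'rV[R]_m2 -> R)
    (h : 'rV[R]_n -> R)
    (t : R) (x : 'rV[R]_n) (u1 : R -> 'rV[R]_m1) (u2 : R -> 'rV[R]_m2) : R :=
  let y := trajectory T f t x u1 u2 in
  \int[@lebesgue_measure R]_(s in `[t, T]) g s (y s) (u1 s) (u2 s) + h (y T).

(* [W] is the opponent's control set, [U] the player's own. *)
Definition strategies (R : realType) (k m : nat)
    (W : set 'rV[R]_k) (U : set 'rV[R]_m) (t T : R) :
    set ((R -> 'rV[R]_k) -> (R -> 'rV[R]_m)) :=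
  [set a |
    (forall w, controls_L1 W t T w -> controls_Loo U t T (a w)) /\
    (forall (w w' : R -> 'rV[R]_k) (th : R),
      controls_L1 W t T w -> controls_L1 W t T w' -> t <= th <= T ->
      {ae @lebesgue_measure R, forall s : R, t <= s <= th -> w s = w' s} ->
      {ae @lebesgue_measure R, forall s : R, t <= s <= th -> a w s = a w' s})].

Definition upper_value (R : realType) (n m1 m2 : nat) (T : R)
    (U1 : set 'rV[R]_m1) (U2 : set 'rV[R]_m2)
    (f : R -> 'rV[R]_n -> 'rV[R]_m1 -> 'rV[R]_m2 -> 'rV[R]_n)
    (g : R -> 'rV[R]_n -> 'rV[R]_m1 -> 'rV[R]_m2 -> R)
    (h : 'rV[R]_n -> R) (t : R) (x : 'rV[R]_n) : \bar R :=
  ereal_sup [set ereal_inf [set (payoff T f g h t x u1 (a2 u1))%:E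
                           | u1 in controls_Loo U1 t T]
            | a2 in strategies U1 U2 t T].

Definition lower_value (R : realType) (n m1 m2 : nat) (T : R)
    (U1 : set 'rV[R]_m1) (U2 : set 'rV[R]_m2)
    (f : R -> 'rV[R]_n -> 'rV[R]_m1 -> 'rV[R]_m2 -> 'rV[R]_n)
    (g : R -> 'rV[R]_n -> 'rV[R]_m1 -> 'rV[R]_m2 -> R)
    (h : 'rV[R]_n -> R) (t : R) (x : 'rV[R]_n) : \bar R :=
  ereal_inf [set ereal_sup [set (payoff T f g h t x (a1 u2) u2)%:E
                           | u2 in controls_Loo U2 t T]
            | a1 in strategies U2 U1 t T].

(* Main.v *)
(* Write W_i for the integral of |u_i|^rho_i. Gronwall's inequality and
   monotonicity of the dynamics give, up to constants,
   W_1 - <x>^mu - W_2 <= J <= <x>^mu + W_1 - W_2 and a Lipschitz bound for J in x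
   that depends on W_1 and W_2 only. The coercivity of J bounds W_1 for near-optimal
   answers of player 1, but near-optimal strategies of player 2 may reply to large
   controls with arbitrarily large W_2. They are replaced by truncations: whenever
   |u_1|^rho_1 exceeds Z^mu, with Z a large multiple of <x>, the reply is set to 0 and
   the original strategy is fed 0 instead of u_1. Since sigma_i mu < rho_i, the coercive
   gain of player 2 at these instants outweighs the displacement of the trajectory,
   so the payoff does not decrease, while W_2 becomes at most a constant times <x>^mu.
   The Lipschitz bound in x follows for V^+. For regularity in time, controls on [t', T]
   are extended by 0 to [t, T], and the bound on W_i makes the state move by at most a
   constant times (t' - t)^(1 - sigma_i / rho_i). Exchanging the players and the sign
   of the costs turns V^- into - V^+. *)
Require Import Defs.
From HB Require Import structures.
From mathcomp Require Import all_boot all_order all_algebra.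
From mathcomp Require Import all_classical all_reals all_analysis.
From mathcomp Require Import measurable_realfun ring lra.
Set Implicit Arguments.
Unset Strict Implicit.
Unset Printing Implicit Defensive.
Import Order.TTheory GRing.Theory Num.Theory.
Import numFieldNormedType.Exports.
Local Open Scope classical_set_scope.
Local Open Scope ring_scope.

(** * Euclidean norm *)

(** Everything turns on one small parameter. Let kap < 1 be the larger of sigma_i mu / rho_i. At any
    scale r >= C the control terms of the dynamics satisfy |u_i|^sigma_i <= C^(kap - 1) (r + r^(1 -
    mu) |u_i|^rho_i). Hence, if C <x> <= r, weights W_i of size r^mu keep the state within a
    multiple of C^(kap - 1) r, whereas coercivity acts on W_i with the fixed constant c. A large C
    then lets c absorb <y>^mu and every error caused by a displacement. The scale is chosen after
    the controls, as the maximum of a multiple of <x> and the mu-th root of the weight at hand: the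
    weight of u_1 that a truncation removes has no a priori bound, so no scale fixed in advance
    would do. The order of choices matters too: the bound on W_2 must hold for the replies to all
    controls before an almost minimizing control is picked, since the bound on W_1 is derived from
    it. The Lipschitz constant of the dynamics in the state grows with the controls; trajectories
    are therefore compared through the one-sided bound, whose constant is L. *)

Section euclidean.
Context {R : realType} {n : nat}.
Implicit Types (x y z : 'rV[R]_n) (a : R).

Lemma dotpC x y : dotp x y = dotp y x.
Proof. by apply: eq_bigr => i _; rewrite mulrC. Qed.

Lemma dotpDl x y z : dotp (x + y) z = dotp x z + dotp y z.
Proof. by rewrite -big_split; apply: eq_bigr => i _; rewrite mxE mulrDl. Qed.

Lemma dotpZl a x y : dotp (a *: x) y = a * dotp x y.
Proof. by rewrite /dotp mulr_sumr; apply: eq_bigr => i _; rewrite mxE mulrA. Qed.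

Lemma dotpNl x y : dotp (- x) y = - dotp x y.
Proof. by rewrite -scaleN1r dotpZl mulN1r. Qed.

Lemma dotpDr x y z : dotp x (y + z) = dotp x y + dotp x z.
Proof. by rewrite dotpC dotpDl !(dotpC x). Qed.

Lemma dotpZr a x y : dotp x (a *: y) = a * dotp x y.
Proof. by rewrite dotpC dotpZl dotpC. Qed.

Lemma dotpNr x y : dotp x (- y) = - dotp x y.
Proof. by rewrite dotpC dotpNl dotpC. Qed.

Lemma dotp_ge0 x : 0 <= dotp x x.
Proof. by apply: sumr_ge0 => i _; rewrite -expr2 sqr_ge0. Qed.

Lemma enorm_ge0 x : 0 <= enorm x.
Proof. exact: sqrtr_ge0. Qed.

Lemma enorm_sqr x : enorm x ^+ 2 = dotp x x.
Proof. by rewrite sqr_sqrtr// dotp_ge0. Qed.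

(** Cauchy-Schwarz, from the nonnegative square of [enorm y *: x - enorm x *: y]; vanishing norms
    are treated apart because the expansion is divided by their product. *)
Lemma dotp_le_enorm x y : dotp x y <= enorm x * enorm y.
Proof.
have [y0|y0] := eqVneq (enorm y) 0.
  have Hy : y = 0.
    have := enorm_sqr y; rewrite y0 expr0n/= => /esym/eqP.
    rewrite psumr_eq0 => [/allP h|i _]; last by rewrite -expr2 sqr_ge0.
    apply/rowP => i; rewrite mxE.
    by have := h i (mem_index_enum _); rewrite -expr2 sqrf_eq0 => /eqP.
  by rewrite y0 mulr0 dotpC Hy /dotp big1// => i _; rewrite mxE mul0r.
have yp : 0 < enorm y by rewrite lt_def y0 enorm_ge0.
have [x0|x0] := eqVneq (enorm x) 0.
  have Hx : x = 0.
    have := enorm_sqr x; rewrite x0 expr0n/= => /esym/eqP.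
    rewrite psumr_eq0 => [/allP h|i _]; last by rewrite -expr2 sqr_ge0.
    apply/rowP => i; rewrite mxE.
    by have := h i (mem_index_enum _); rewrite -expr2 sqrf_eq0 => /eqP.
  by rewrite x0 mul0r Hx /dotp big1// => i _; rewrite mxE mul0r.
have xp : 0 < enorm x by rewrite lt_def x0 enorm_ge0.
have := dotp_ge0 (enorm y *: x - enorm x *: y).
rewrite !(dotpDl, dotpDr, dotpNl, dotpNr, dotpZl, dotpZr) -!enorm_sqr (dotpC y x).
move: (mulr_gt0 xp yp); set p := enorm x; set q := enorm y; set d := dotp _ _ => pq H.
rewrite -(ler_pM2l pq); nra.
Qed.

Lemma ler_enormD x y : enorm (x + y) <= enorm x + enorm y.
Proof.
rewrite -(ler_pXn2r (n := 2))// ?nnegrE ?addr_ge0 ?enorm_ge0//.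
rewrite enorm_sqr sqrrD !(dotpDl, dotpDr) (dotpC y x) !enorm_sqr.
have := dotp_le_enorm x y; lra.
Qed.

Lemma enormZ a x : enorm (a *: x) = `|a| * enorm x.
Proof.
by rewrite /enorm dotpZl dotpZr mulrA -expr2 sqrtrM ?sqr_ge0// sqrtr_sqr.
Qed.

Lemma enormN x : enorm (- x) = enorm x.
Proof. by rewrite -scaleN1r enormZ normrN1 mul1r. Qed.

Lemma enorm0 : enorm (0 : 'rV[R]_n) = 0.
Proof. by rewrite -(scale0r 0) enormZ normr0 mul0r. Qed.

Lemma enorm_distC x y : enorm (x - y) = enorm (y - x).
Proof. by rewrite -enormN opprB. Qed.

Lemma ler_enormB x y : enorm (x - y) <= enorm x + enorm y.
Proof. by rewrite (le_trans (ler_enormD _ _))// enormN. Qed.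

Lemma ler_coord_enorm x i : `|x 0 i| <= enorm x.
Proof.
rewrite -sqrtr_sqr ler_sqrt ?dotp_ge0// /dotp (bigD1 i)//= -expr2 lerDl.
by apply: sumr_ge0 => j _; rewrite -expr2 sqr_ge0.
Qed.

(** Interface between the max-norm of the topology and the Euclidean norm; the factor n stands in
    for the sharp square root of n. *)
Lemma enorm_le_bound x (M : R) : 0 <= M -> (forall i, `|x 0 i| <= M) ->
  enorm x <= n%:R * M.
Proof.
move=> M0 xM.
have h : forall (m : nat), m%:R <= (m%:R ^+ 2 : R).
  by move=> m; rewrite -natrX ler_nat; case: m => // m; rewrite -[leqLHS]expn1 leq_pexp2l.
rewrite -(ler_pXn2r (n := 2))// ?nnegrE ?mulr_ge0 ?ler0n ?enorm_ge0//.
rewrite enorm_sqr exprMn (le_trans (y := n%:R * M ^+ 2))//; last first.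
  by rewrite ler_wpM2r// sqr_ge0.
rewrite mulr_natl -[in leRHS](card_ord n) -sumr_const ler_sum// => i _.
rewrite -expr2 -(real_normK (num_real (x 0 i))).
by rewrite ler_pXn2r// nnegrE.
Qed.

Lemma enorm_le_monotone x y : (forall i, `|x 0 i| <= `|y 0 i|) -> enorm x <= enorm y.
Proof.
move=> h; rewrite ler_sqrt ?dotp_ge0// ler_sum// => i _.
rewrite -!expr2 -(real_normK (num_real (x 0 i))) -(real_normK (num_real (y 0 i))).
by rewrite ler_pXn2r// nnegrE.
Qed.

Lemma jap_ge1 x : 1 <= jap x.
Proof.
by rewrite -[leLHS]sqrtr1 ler_sqrt ?lerDl ?sqr_ge0// addr_ge0// sqr_ge0.
Qed.

Lemma jap_gt0 x : 0 < jap x.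
Proof. exact: lt_le_trans ltr01 (jap_ge1 x). Qed.

Lemma jap_sqr x : jap x ^+ 2 = 1 + enorm x ^+ 2.
Proof. by rewrite sqr_sqrtr// addr_ge0// sqr_ge0. Qed.

Lemma enorm_le_jap x : enorm x <= jap x.
Proof.
rewrite -(ler_pXn2r (n := 2))// ?nnegrE ?enorm_ge0 ?(ltW (jap_gt0 _))//.
rewrite jap_sqr; lra.
Qed.

Lemma jap_le_enorm x : jap x <= 1 + enorm x.
Proof.
have e0 := enorm_ge0 x.
rewrite -(ler_pXn2r (n := 2))// ?nnegrE ?addr_ge0 ?(ltW (jap_gt0 _))//.
rewrite jap_sqr; nra.
Qed.

Lemma jap_le_shift x y : jap x <= jap y + enorm (x - y).
Proof.
have e0 := enorm_ge0 (x - y); have j0 := jap_gt0 y; have ej := enorm_le_jap y.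
rewrite -(ler_pXn2r (n := 2))// ?nnegrE ?addr_ge0 ?(ltW (jap_gt0 _))//.
rewrite jap_sqr sqrrD jap_sqr.
have : enorm x ^+ 2 <= (enorm y + enorm (x - y)) ^+ 2.
  rewrite ler_pXn2r// ?nnegrE ?addr_ge0 ?enorm_ge0//.
  by rewrite -{1}(subrK y x) addrC ler_enormD.
have := enorm_ge0 y; nra.
Qed.

Lemma japmax_le x y (M : R) : jap x <= M -> jap y <= M -> japmax x y <= M.
Proof. by move=> hx hy; rewrite /japmax ge_max hx hy. Qed.

Lemma japmax_ge1 x y : 1 <= japmax x y.
Proof. by rewrite /japmax le_max jap_ge1. Qed.

End euclidean.

(** * Integrals over intervals and Gronwall's inequality *)

Definition inton (R : realType) (a b : R) (f : R -> R) : Prop :=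
  (@lebesgue_measure R).-integrable `[a, b] (EFin \o f).

(** Locked, so that an integral stays an atom for unification and for the arithmetic tactics. *)
HB.lock Definition integ (R : realType) (a b : R) (f : R -> R) : R :=
  \int[@lebesgue_measure R]_(r in `[a, b]) f r.

Lemma integE (R : realType) (a b : R) (f : R -> R) :
  integ a b f = \int[@lebesgue_measure R]_(r in `[a, b]) f r.
Proof. by rewrite unlock. Qed.

Section interval_integral.
Context {R : realType}.
Implicit Types (a b c k : R) (f g : R -> R).
Local Notation mu := (@lebesgue_measure R).

Lemma ae_mono (P Q : R -> Prop) : (forall s, P s -> Q s) ->
  {ae mu, forall s, P s} -> {ae mu, forall s, Q s}.
Proof. by move=> PQ; apply: filterS; first exact: (ae_filter_ringOfSetsType mu). Qed.

Lemma ae_and (P Q : R -> Prop) : {ae mu, forall s, P s} -> {ae mu, forall s, Q s} ->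
  {ae mu, forall s, P s /\ Q s}.
Proof.
move=> hP hQ; have h : {ae mu, forall s, P s -> P s /\ Q s}.
  by apply: ae_mono hQ => s h; split.
exact: (@filter_app _ _ (ae_filter_ringOfSetsType mu) _ _ h hP).
Qed.

Lemma inton_meas a b f : inton a b f -> measurable_fun `[a, b] f.
Proof. by move=> /integrableP[/measurable_EFinP]. Qed.

Lemma inton_eq a b f g : (forall s, a <= s <= b -> f s = g s) ->
  inton a b f -> inton a b g.
Proof.
move=> fg; apply: eq_integrable => // s; rewrite inE/= in_itv/= => /fg/= ->.
by [].
Qed.

Lemma inton_le a b f g : measurable_fun `[a, b] f ->
  (forall s, a <= s <= b -> `|f s| <= g s) -> inton a b g -> inton a b f.
Proof.
move=> mf fg; apply: le_integrable => //; first exact/measurable_EFinP.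
move=> s /=; rewrite in_itv/= => sab; rewrite lee_fin (le_trans (fg _ sab))//.
exact: ler_norm.
Qed.

Lemma intonD a b f g : inton a b f -> inton a b g -> inton a b (fun s => f s + g s).
Proof.
by move=> hf hg; exact: (@integrableD _ _ _ mu `[a, b] (measurable_itv _) (EFin \o f) (EFin \o g)).
Qed.

Lemma intonB a b f g : inton a b f -> inton a b g -> inton a b (fun s => f s - g s).
Proof.
by move=> hf hg; exact: (@integrableB _ _ _ mu `[a, b] (measurable_itv _) (EFin \o f) (EFin \o g)).
Qed.

Lemma intonZ a b k f : inton a b f -> inton a b (fun s => k * f s).
Proof. by move=> hf; exact: (@integrableZl _ _ _ mu `[a, b] (measurable_itv _) k (EFin \o f)). Qed.

Lemma inton_norm a b f : inton a b f -> inton a b (fun s => `|f s|).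
Proof. exact: integrable_norm. Qed.

Lemma inton_cont a b f : {within `[a, b], continuous f} -> inton a b f.
Proof. by move=> cf; apply: continuous_compact_integrable => //; exact: segment_compact. Qed.

Lemma inton_cst a b k : inton a b (fun=> k).
Proof. by apply: inton_cont; apply: continuous_subspaceT => x; exact: cvg_cst. Qed.

Lemma inton_sum a b (I : Type) (s : seq I) (F : I -> R -> R) :
  (forall i, inton a b (F i)) -> inton a b (fun r => \sum_(i <- s) F i r).
Proof.
move=> hF; elim: s => [|i s IH].
  by apply: inton_eq (inton_cst a b 0) => r _; rewrite big_nil.
by apply: inton_eq (intonD (hF i) IH) => r _; rewrite big_cons.
Qed.

Lemma inton_sub a b c d f : a <= c -> d <= b -> inton a b f -> inton c d f.
Proof.
move=> ac db; apply: integrableS => //= s/=.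
by rewrite !in_itv/= => /andP[cs sd]; rewrite (le_trans ac)//= (le_trans sd).
Qed.

Lemma eq_integ a b f g : (forall s, a <= s <= b -> f s = g s) ->
  integ a b f = integ a b g.
Proof.
by move=> fg; rewrite !integE; apply: eq_Rintegral => s; rewrite inE/= in_itv/= => /fg ->.
Qed.

Lemma integD a b f g : inton a b f -> inton a b g ->
  integ a b (fun s => f s + g s) = integ a b f + integ a b g.
Proof. by move=> hf hg; rewrite !integE; exact: RintegralD. Qed.

Lemma integB a b f g : inton a b f -> inton a b g ->
  integ a b (fun s => f s - g s) = integ a b f - integ a b g.
Proof. by move=> hf hg; rewrite !integE; exact: RintegralB. Qed.

Lemma integZ a b k f : inton a b f -> integ a b (fun s => k * f s) = k * integ a b f.
Proof. by move=> hf; rewrite !integE; exact: RintegralZl. Qed.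

Lemma integ_sum a b (I : Type) (s : seq I) (F : I -> R -> R) :
  (forall i, inton a b (F i)) ->
  integ a b (fun r => \sum_(i <- s) F i r) = \sum_(i <- s) integ a b (F i).
Proof.
move=> hF; elim: s => [|i s IH].
  rewrite big_nil; under [LHS]eq_integ do rewrite big_nil.
  by rewrite !integE Rintegral_cst// mul0r.
rewrite big_cons -IH -integD//; last exact: inton_sum.
by apply: eq_integ => r _; rewrite big_cons.
Qed.

Lemma integ_cst a b k : a <= b -> integ a b (fun=> k) = k * (b - a).
Proof.
move=> ab; rewrite !integE Rintegral_cst// /= [fine _](_ : _ = b - a)//; last first.
  rewrite lebesgue_measure_itv/= lte_fin; case: ltP => //= ba.
  by apply/esym/eqP; rewrite subr_eq0; apply/eqP/le_anti; rewrite ab ba.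
Qed.

Lemma integ_le a b f g : inton a b f -> inton a b g ->
  (forall s, a <= s <= b -> f s <= g s) -> integ a b f <= integ a b g.
Proof.
by move=> hf hg fg; rewrite !integE; apply: le_Rintegral => // s /=; rewrite in_itv/= => /fg.
Qed.

Lemma integ_ge0 a b f : (forall s, a <= s <= b -> 0 <= f s) -> 0 <= integ a b f.
Proof. by move=> f0; rewrite integE; apply: Rintegral_ge0 => s /=; rewrite in_itv/= => /f0. Qed.

Lemma integ_le_cst a b f k : a <= b -> inton a b f ->
  (forall s, a <= s <= b -> f s <= k) -> integ a b f <= k * (b - a).
Proof. by move=> ab hf fk; rewrite -integ_cst//; apply: integ_le => //; exact: inton_cst. Qed.

Lemma integ_norm a b f : inton a b f -> `|integ a b f| <= integ a b (fun s => `|f s|).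
Proof. by move=> hf; rewrite !integE; exact: le_normr_Rintegral. Qed.

Lemma integ_norm_le a b f g : inton a b f -> inton a b g ->
  (forall s, a <= s <= b -> `|f s| <= g s) -> `|integ a b f| <= integ a b g.
Proof.
move=> hf hg fg; apply: le_trans (integ_norm hf) _.
by apply: integ_le => //; exact: inton_norm.
Qed.

Lemma integ_refl a f : integ a a f = 0.
Proof. by rewrite !integE set_itv1 Rintegral_set1. Qed.

Lemma integ_split a c b f : a <= c <= b -> inton a b f ->
  integ a b f = integ a c f + integ c b f.
Proof.
move=> /andP[ac cb] hf; rewrite !integE.
rewrite -[X in _ = _ + X]Rintegral_itv_obnd_cbnd; last first.
  apply: integrableS hf => //= s /=; rewrite !in_itv/= => /andP[cs ->].
  by rewrite (le_trans ac)// ltW.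
rewrite -(@Rintegral_itvB _ f (BLeft a) (BRight b) c) ?bnd_simp//.
by rewrite addrC subrK.
Qed.

Lemma integ_mono a b c d f : a <= c -> d <= b -> inton a b f ->
  (forall s, a <= s <= b -> 0 <= f s) -> integ c d f <= integ a b f.
Proof.
move=> ac db hf f0; have [cd|dc] := leP c d; last first.
  rewrite integE set_itv_ge ?bnd_simp -?ltNge// Rintegral_set0.
  exact: integ_ge0.
have cb : c <= b by exact: le_trans db.
have hcb : inton c b f by apply: inton_sub hf.
rewrite (@integ_split a c b f) ?ac//.
rewrite (@integ_split c d b f) ?cd//.
rewrite addrCA lerDl addr_ge0//; apply: integ_ge0 => s /andP[h1 h2]; apply: f0.
- by rewrite h1 (le_trans h2).
- by rewrite h2 andbT (le_trans _ h1)// (le_trans ac).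
Qed.

Lemma integ_continuous a b f : a <= b -> inton a b f ->
  {within `[a, b], continuous (fun s => integ a s f)}.
Proof.
move=> ab hf; rewrite (_ : (fun s => integ a s f) =
    (fun s => \int[mu]_(r in `[a, s]) f r)); last by apply/funext => s; rewrite integE.
exact: parameterized_integral_continuous.
Qed.

Lemma within_meas a b f : {within `[a, b], continuous f} -> measurable_fun `[a, b] f.
Proof. by move=> cf; apply: inton_meas; exact: inton_cont. Qed.

Lemma eq_integ_ae a b f g : measurable_fun `[a, b] f -> measurable_fun `[a, b] g ->
  {ae mu, forall s, a <= s <= b -> f s = g s} -> integ a b f = integ a b g.
Proof.
move=> mf mg fg; rewrite !integE /Rintegral; congr fine.
apply: ae_eq_integral => //; [exact/measurable_EFinP|exact/measurable_EFinP|].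
by apply: ae_mono fg => s h /=; rewrite in_itv/= => /h ->.
Qed.

Lemma inton_ae a b f g : measurable_fun `[a, b] g -> inton a b f ->
  {ae mu, forall s, a <= s <= b -> f s = g s} -> inton a b g.
Proof.
move=> mg hf fg; have mf := inton_meas hf.
move/integrableP : hf => [_ hf]; apply/integrableP; split; first exact/measurable_EFinP.
rewrite (@ae_eq_integral _ _ _ mu _ (fun x => `|(EFin \o f) x|%E))//.
- by apply: measurableT_comp => //; exact/measurable_EFinP.
- by apply: measurableT_comp => //; exact/measurable_EFinP.
- by apply: ae_mono fg => s h /=; rewrite in_itv/= => /h ->.
Qed.

Lemma integ_le_ae a b f g : inton a b f -> inton a b g ->
  {ae mu, forall s, a <= s <= b -> f s <= g s} -> integ a b f <= integ a b g.
Proof.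
move=> hf hg fg.
(* Changing [g] on a null set turns the inequality into one that holds everywhere. *)
pose g' s := Num.max (f s) (g s).
have mg' : measurable_fun `[a, b] g'.
  by apply: measurable_maxr; exact: inton_meas.
have gg' : {ae mu, forall s, a <= s <= b -> g s = g' s}.
  by apply: ae_mono fg => s h /h fgs; rewrite /g' max_r.
have hg' : inton a b g' := inton_ae mg' hg gg'.
rewrite (@eq_integ_ae _ _ g g')//; last exact: inton_meas.
by apply: integ_le => // s _; rewrite /g' le_max lexx.
Qed.

End interval_integral.

(** * Gronwall's inequality and the square of a primitive *)

Section gronwall.
Context {R : realType}.
Implicit Types (a b c k : R) (f g : R -> R).

(** Takes the place of a passage to the limit wherever an error is halved repeatedly; the
    Archimedean property suffices because 2 ^ n exceeds n. *)
Lemma le0_of_le_half_pow (x C : R) : (forall n, x <= C / 2 ^+ n) -> x <= 0.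
Proof.
move=> h; rewrite leNgt; apply/negP => x0.
have C0 : 0 <= C by have := h 0; rewrite expr0 divr1; apply: le_trans; exact: ltW.
pose n := Num.bound (C / x).
have hn : C / x < n%:R by rewrite archi_boundP// divr_ge0// ltW.
have := h n; rewrite ler_pdivlMr ?exprn_gt0//.
rewrite leNgt => /negP; apply; rewrite mulrC -ltr_pdivrMr//.
by rewrite (lt_le_trans hn)// -natrX ler_nat ltnW// ltn_expl.
Qed.

Lemma integ_primitive_continuous a b (z F : R -> R) : a <= b -> inton a b F ->
  (forall s, a <= s <= b -> z s = z a + integ a s F) -> {within `[a, b], continuous z}.
Proof.
move=> ab hF hz.
apply: (@subspace_eq_continuous _ _ _ (fun s => z a + integ a s F)).
  by move=> s; rewrite inE/= in_itv/= => h; exact/esym/hz.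
apply: (@within_continuousD _ _ _ _ (fun=> z a) (fun s => integ a s F)).
  by apply: continuous_subspaceT => x; exact: cvg_cst.
exact: integ_continuous.
Qed.

Lemma within_bounded a b f : a <= b -> {within `[a, b], continuous f} ->
  exists2 M, 0 <= M & forall s, a <= s <= b -> `|f s| <= M.
Proof.
move=> ab cf; have [c1 _ h1] := EVT_max ab cf; have [c2 _ h2] := EVT_min ab cf.
exists (`|f c1| + `|f c2|) => [|s sab]; first by rewrite addr_ge0.
have := h1 s; have := h2 s; rewrite in_itv/= => /(_ sab) l /(_ sab) u.
have := ler_norm (f c1); have := ler_norm (- f c2); rewrite normrN => *.
have := normr_ge0 (f c1); have := normr_ge0 (f c2) => *.
by rewrite ler_norml; apply/andP; split; lra.
Qed.

Lemma inton_mul_bounded a b f g (M : R) : measurable_fun `[a, b] f ->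
  (forall s, a <= s <= b -> `|f s| <= M) -> inton a b g -> inton a b (fun s => f s * g s).
Proof.
move=> mf fM hg; apply: (@inton_le _ _ _ _ (fun s => M * `|g s|)).
- by apply: measurable_funM => //; exact: inton_meas.
- by move=> s sab; rewrite normrM ler_wpM2r// fM.
- by apply: intonZ; exact: inton_norm.
Qed.

(* phi s := z s ^ 2 - \int_a^s 2 z F satisfies |phi s - phi r| <= 2 (\int_r^s |F|)^2;
   halving [r, s] at the midpoint of \int |F| improves the constant by 1/2. *)
Lemma sqr_primitive a b (z F : R -> R) : inton a b F ->
  (forall s, a <= s <= b -> z s = z a + integ a s F) ->
  forall s, a <= s <= b -> z s ^+ 2 = z a ^+ 2 + integ a s (fun r => 2 * (z r * F r)).
Proof.
move=> hF hz s0 /andP[as0 s0b].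
have ab : a <= b by exact: le_trans s0b.
have cz := integ_primitive_continuous ab hF hz.
have [M M0 zM] := within_bounded ab cz.
have hzF0 : inton a b (fun r => z r * F r).
  exact: (inton_mul_bounded (within_meas cz) zM).
have hzF : inton a b (fun r => 2 * (z r * F r)) by exact: intonZ.
have hnF := inton_norm hF.
have dz r s : a <= r -> r <= s -> s <= b -> z s - z r = integ r s F.
  move=> ar rs sb; rewrite (hz s) ?(le_trans ar)// (hz r) ?ar ?(le_trans rs)//.
  rewrite (@integ_split _ a r s) ?ar ?rs//; first by ring.
  exact: inton_sub hF.
pose phi s := z s ^+ 2 - integ a s (fun r => 2 * (z r * F r)).
have dphi r s : a <= r -> r <= s -> s <= b ->
    `|phi s - phi r| <= 2 * (integ r s (fun q => `|F q|)) ^+ 2.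
  move=> ar rs sb; set D := integ r s (fun q => `|F q|).
  (* The increment of z ^ 2 is z s + z r times the integral of F. The remaining factor z s + z r - 2
     * z q is of the order of the oscillation of z, whence the quadratic error. *)
  have -> : phi s - phi r = integ r s (fun q => (z s + z r - 2 * z q) * F q).
    rewrite /phi (@integ_split _ a r s (fun r => 2 * (z r * F r))) ?ar ?rs//; last first.
      exact: inton_sub hzF.
    have -> : integ r s (fun q => (z s + z r - 2 * z q) * F q) =
        integ r s (fun q => (z s + z r) * F q - 2 * (z q * F q)).
      by apply: eq_integ => q _; ring.
    have h1 : inton r s F by apply: inton_sub hF.
    have h2 : inton r s (fun q => z q * F q) by apply: inton_sub hzF0.
    have h3 : inton a r (fun q => z q * F q).
      by apply: inton_sub hzF0 => //; exact: le_trans sb.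
    rewrite integB; [|exact: intonZ|exact: intonZ].
    by rewrite !integZ// -dz//; ring.
  have hFrs : inton r s F by apply: inton_sub hF.
  have hnFrs : inton r s (fun q => `|F q|) by exact: inton_norm.
  have zq q : r <= q <= s -> `|z s + z r - 2 * z q| <= 2 * D.
    move=> /andP[rq qs].
    have h1 : `|z s - z q| <= D.
      rewrite dz ?(le_trans ar)//; apply: le_trans (integ_norm _) _.
        by apply: inton_sub hFrs.
      by apply: integ_mono.
    have h2 : `|z q - z r| <= D.
      rewrite dz ?(le_trans qs)//; apply: le_trans (integ_norm _) _.
        by apply: inton_sub hFrs.
      by apply: integ_mono.
    move: h1 h2; rewrite !ler_norml => /andP[? ?] /andP[? ?].
    by apply/andP; split; lra.
  have -> : 2 * D ^+ 2 = integ r s (fun q => 2 * D * `|F q|).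
    by rewrite integZ// -/D; ring.
  apply: integ_norm_le.
  - apply: (@inton_mul_bounded _ _ _ _ (2 * D)) => //.
    apply: measurable_funB; first exact: measurable_cst.
    apply: measurable_funM; first exact: measurable_cst.
    apply: measurable_funS (within_meas cz) => // q/=.
    rewrite !in_itv/= => /andP[? ?]; apply/andP; split; lra.
  - exact: intonZ.
  - by move=> q qrs; rewrite normrM ler_wpM2r// zq.
have dphin n : forall r s, a <= r -> r <= s -> s <= b ->
    `|phi s - phi r| <= 2 * (integ r s (fun q => `|F q|)) ^+ 2 / 2 ^+ n.
  elim: n => [|n IH] r s ar rs sb; first by rewrite expr0 divr1; exact: dphi.
  set D := integ r s (fun q => `|F q|).
  have hD : inton r s (fun q => `|F q|) by apply: inton_sub hnF.
  have D0 : 0 <= D by apply: integ_ge0.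
  have [||m] := @IVT R (fun q => integ r q (fun q => `|F q|)) r s (D / 2) rs.
  - exact: integ_continuous.
  - rewrite integ_refl -/D min_l// max_r//; apply/andP; split; lra.
  rewrite in_itv/= => /andP[rm ms] hm.
  have hm' : integ m s (fun q => `|F q|) = D / 2.
    by have := @integ_split _ r m s _ _ hD; rewrite rm ms hm -/D => /(_ isT); lra.
  have := IH r m ar rm (le_trans ms sb); have := IH m s (le_trans ar rm) ms sb.
  rewrite hm hm' => h1 h2.
  rewrite (_ : phi s - phi r = (phi s - phi m) + (phi m - phi r)); last by ring.
  apply: le_trans (ler_normD _ _) _; apply: le_trans (lerD h1 h2) _.
  rewrite [2 ^+ n.+1]exprS le_eqVlt; apply/orP; left; apply/eqP.
  by field; rewrite expf_neq0.
have : `|phi s0 - phi a| <= 0.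
  by apply: (@le0_of_le_half_pow _ (2 * (integ a s0 (fun q => `|F q|)) ^+ 2)) => n; exact: dphin.
by rewrite normr_le0 subr_eq0 /phi integ_refl => /eqP; lra.
Qed.

Lemma continuous_expR_affine (k a : R) : continuous (fun s => expR (k * (s - a))).
Proof.
move=> x; apply: (@continuous_comp _ _ _ (fun s => k * (s - a)) expR).
  apply: continuousM; first exact: cvg_cst.
  by apply: continuousB; [exact: cvg_id|exact: cvg_cst].
exact: continuous_expR.
Qed.

Lemma integ_expR (k a c : R) : 0 < k -> a <= c ->
  integ a c (fun r => expR (k * (r - a))) = (expR (k * (c - a)) - 1) / k.
Proof.
move=> k0; rewrite le_eqVlt => /orP[/eqP <-|ac].
  by rewrite integ_refl subrr mulr0 expR0 subrr mul0r.
have D (x : R) : is_derive x 1 (fun r => expR (k * (r - a)) / k) (expR (k * (x - a))).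
  apply: is_derive_eq; rewrite /GRing.scale/=.
  by field; rewrite gt_eqF.
have cF : continuous (fun r => expR (k * (r - a)) / k).
  move=> x; apply: differentiable_continuous; apply/derivable1_diffP.
  by have [] := D x.
rewrite integE /Rintegral (@continuous_FTC2 _ _ (fun r => expR (k * (r - a)) / k))//.
- by rewrite -EFinB/= subrr mulr0 expR0; ring.
- by apply: continuous_subspaceT; exact: continuous_expR_affine.
- split => [x _||].
  + by have [] := D x.
  + by apply: cvg_at_right_filter; exact: cF.
  + by apply: cvg_at_left_filter; exact: cF.
- by move=> x _; rewrite derive1E; apply: derive_val.
Qed.

(* Evaluate the hypothesis where phi s * exp (- 2 K (s - a)) is maximal. *)
Lemma gronwall a b (phi : R -> R) (A K : R) : 0 <= A -> 0 < K ->
  {within `[a, b], continuous phi} ->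
  (forall s, a <= s <= b -> phi s <= A + K * integ a s phi) ->
  forall s, a <= s <= b -> phi s <= 2 * A * expR (2 * K * (s - a)).
Proof.
move=> A0 K0 cphi hphi s sab.
have ab : a <= b by case/andP: sab; exact: le_trans.
pose E s := expR (2 * K * (s - a)).
have cE : continuous E by exact: continuous_expR_affine.
have E0 x : 0 < E x by exact: expR_gt0.
have cpsi : {within `[a, b], continuous (fun s => phi s * (E s)^-1)}.
  apply/subspace_continuousP => x xab.
  apply: cvgM; first by move/subspace_continuousP: cphi; exact.
  apply: cvgV; first by rewrite gt_eqF.
  by apply: cvg_within_filter; exact: cE.
have [c cab hM] := EVT_max ab cpsi.
set M := phi c * (E c)^-1 in hM.
have le_phi r : a <= r <= b -> phi r <= M * E r.
  by move=> rab; rewrite -ler_pdivrMr//; apply: hM; rewrite in_itv.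
move: cab; rewrite in_itv/= => cab; have [ac cb] := andP cab.
have cEi u v : inton u v E by apply: inton_cont; exact: continuous_subspaceT.
have hphic : inton a c phi by apply: (@inton_sub _ a b) => //; exact: inton_cont.
(* At the maximizer, phi c = M * E c. As the weight has rate 2 * K, the integral term is at most
   half of M * E c and can be absorbed, at the price of the factor 2 before A. *)
have M2A : M <= 2 * A.
  have [M0|M0] := leP M 0; first by rewrite (le_trans M0)// mulr_ge0.
  have I : integ a c phi <= M * ((E c - 1) / (2 * K)).
    rewrite -integ_expR ?mulr_gt0// -integZ; last exact: cEi.
    apply: integ_le => //; first by apply: intonZ; exact: cEi.
    move=> r /andP[ar rc]; apply: le_phi; rewrite ar/=; exact: le_trans cb.
  have h := hphi c cab.
  have pc : phi c = M * E c by rewrite /M mulfVK// gt_eqF.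
  have E1 : 1 <= E c by rewrite -expR0 ler_expR mulr_ge0 ?subr_ge0// mulr_ge0// ltW.
  have KI : K * integ a c phi <= M * (E c - 1) / 2.
    apply: le_trans (ler_wpM2l (ltW K0) I) _.
    by rewrite le_eqVlt; apply/orP; left; apply/eqP; field; rewrite gt_eqF.
  rewrite -(ler_pM2r (E0 c)); nra.
by apply: le_trans (le_phi _ sab) _; rewrite ler_wpM2r// ltW.
Qed.

End gronwall.

(** * Absolutely continuous paths and Caratheodory solutions *)

(** The velocity is a separate argument, so that the difference of two trajectories, which solves no
    equation of its own, is again a path. *)
Definition is_path (R : realType) (n : nat) (a b : R) (y F : R -> 'rV[R]_n) : Prop :=
  forall i : 'I_n, inton a b (fun s => F s 0 i) /\
    forall s, a <= s <= b -> y s 0 i = y a 0 i + integ a s (fun r => F r 0 i).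

Section paths.
Context {R : realType} {n : nat}.
Implicit Types (a b c : R) (y z F G : R -> 'rV[R]_n).

(** Pairing with [v] itself reduces the vector integral to a scalar one, so the Euclidean norm
    passes under the integral without a constant. *)
Lemma enorm_integ_le a b F (v : 'rV[R]_n) (g : R -> R) :
  (forall i, inton a b (fun s => F s 0 i)) -> inton a b g ->
  (forall i, v 0 i = integ a b (fun s => F s 0 i)) ->
  (forall s, a <= s <= b -> enorm (F s) <= g s) -> enorm v <= integ a b g.
Proof.
move=> hF hg hv Fg.
have [->|v0] := eqVneq (enorm v) 0.
  by apply: integ_ge0 => s sab; apply: le_trans (Fg s sab); exact: enorm_ge0.
have vp : 0 < enorm v by rewrite lt_def v0 enorm_ge0.
rewrite -(ler_pM2l vp) -expr2 enorm_sqr.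
have -> : dotp v v = integ a b (fun s => \sum_(i < n) v 0 i * F s 0 i).
  rewrite integ_sum; last by move=> i; exact: intonZ.
  by apply: eq_bigr => i _; rewrite integZ// hv.
rewrite -integZ//; apply: integ_le.
- by apply: inton_sum => i; exact: intonZ.
- exact: intonZ.
- move=> s sab; apply: le_trans (dotp_le_enorm v (F s)) _.
  by rewrite ler_wpM2l ?enorm_ge0// Fg.
Qed.

Lemma within_rowP a b y : (forall i, {within `[a, b], continuous (fun s => y s 0 i)}) ->
  {within `[a, b], continuous y}.
Proof.
move=> cy; apply/subspace_continuousP => x xab.
apply/cvg_ballP => e e0.
have h : forall i, \forall s \near within `[a, b] (nbhs x), ball (y x 0 i) e (y s 0 i).
  move=> i; have /subspace_continuousP/(_ x xab)/cvg_ballP/(_ e e0) := cy i.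
  by [].
have h' : \forall s \near within `[a, b] (nbhs x), forall i, ball (y x 0 i) e (y s 0 i).
  exact: filter_forall.
by apply: filterS h' => s hs; split => // i j; rewrite ord1; exact: hs.
Qed.

Lemma within_coord a b y i : {within `[a, b], continuous y} ->
  {within `[a, b], continuous (fun s => y s 0 i)}.
Proof.
move=> cy; apply/subspace_continuousP => x xab.
move/subspace_continuousP/(_ x xab) : cy => cy.
by apply: (@cvg_comp _ _ _ y (fun v : 'rV[R]_n => v 0 i) _ _ _ cy); exact: coord_continuous.
Qed.

Lemma within_enorm_sqr a b y : {within `[a, b], continuous y} ->
  {within `[a, b], continuous (fun s => enorm (y s) ^+ 2)}.
Proof.
move=> cy; apply/subspace_continuousP => x xab.
have -> : (fun s => enorm (y s) ^+ 2) = (fun s => \sum_(i < n) y s 0 i * y s 0 i).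
  by apply/funext => s; rewrite enorm_sqr.
rewrite /from_subspace; apply: cvg_big => [|i _]; first exact: add_continuous.
by apply: cvgM; move/(@within_coord _ _ _ i)/subspace_continuousP/(_ x xab) : (cy).
Qed.

Lemma within_enorm a b y : {within `[a, b], continuous y} ->
  {within `[a, b], continuous (fun s => enorm (y s))}.
Proof.
move=> cy; apply/subspace_continuousP => x xab.
have -> : (fun s => enorm (y s)) = Num.sqrt \o (fun s => enorm (y s) ^+ 2).
  by apply/funext => s/=; rewrite enorm_sqr.
move/within_enorm_sqr/subspace_continuousP/(_ x xab) : cy => cy.
by apply: (@cvg_comp _ _ _ (fun s => enorm (y s) ^+ 2) Num.sqrt _ _ _ cy); exact: sqrt_continuous.
Qed.

Lemma path_continuous a b y F : a <= b -> is_path a b y F -> {within `[a, b], continuous y}.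
Proof.
move=> ab hy; apply: within_rowP => i; have [hF hz] := hy i.
exact: integ_primitive_continuous hF hz.
Qed.

Lemma path_sub a b c y F : a <= c <= b -> is_path a b y F -> is_path c b y F.
Proof.
move=> /andP[ac cb] hy i; have [hF hz] := hy i; split; first exact: inton_sub hF.
move=> s /andP[cs sb]; rewrite (hz s) ?(le_trans ac)// (hz c) ?ac//.
rewrite (@integ_split _ a c s) ?ac ?cs// ?addrA//; exact: inton_sub hF.
Qed.

Lemma pathB a b y z F G : is_path a b y F -> is_path a b z G ->
  is_path a b (fun s => y s - z s) (fun s => F s - G s).
Proof.
move=> hy hz i; have [hF hy'] := hy i; have [hG hz'] := hz i; split.
  by apply: inton_eq (intonB hF hG) => s _; rewrite !mxE.
move=> s sab; rewrite !mxE hy'// hz'//.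
have -> : integ a s (fun r => (F r - G r) 0 i) = integ a s (fun r => F r 0 i - G r 0 i).
  by apply: eq_integ => r _; rewrite !mxE.
case/andP: sab => _ sb.
by rewrite integB; [ring|exact: inton_sub hF|exact: inton_sub hG].
Qed.

Lemma path_dist a b y F (g : R -> R) : is_path a b y F -> inton a b g ->
  (forall s, a <= s <= b -> enorm (F s) <= g s) ->
  forall s, a <= s <= b -> enorm (y s - y a) <= integ a s g.
Proof.
move=> hy hg Fg s /andP[as_ sb].
apply: (@enorm_integ_le _ _ F).
- by move=> i; have [hF _] := hy i; apply: inton_sub hF.
- exact: inton_sub hg.
- by move=> i; have [_ hz'] := hy i; rewrite !mxE hz' ?as_//; ring.
- by move=> r /andP[ar rs]; apply: Fg; rewrite ar (le_trans rs).
Qed.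

Lemma path_growth a b y F (L : R) (g : R -> R) : 0 < L -> is_path a b y F ->
  inton a b g -> (forall s, a <= s <= b -> 0 <= g s) ->
  (forall s, a <= s <= b -> enorm (F s) <= L * enorm (y s) + g s) ->
  forall s, a <= s <= b ->
    enorm (y s) <= 2 * expR (2 * L * (b - a)) * (enorm (y a) + integ a b g).
Proof.
move=> L0 hy hg g0 Fg s sab.
have ab : a <= b by case/andP: sab; exact: le_trans.
have cy := within_enorm (path_continuous ab hy).
have A0 : 0 <= enorm (y a) + integ a b g by rewrite addr_ge0 ?enorm_ge0 ?integ_ge0.
apply: le_trans (gronwall A0 L0 cy _ sab) _.
  move=> r /andP[ar rb].
  have hen : inton a b (fun s => enorm (y s)) by exact: inton_cont.
  have := @path_dist a b y F (fun s => L * enorm (y s) + g s) hy.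
  move=> /(_ (intonD (intonZ L hen) hg) Fg r); rewrite ar rb => /(_ isT).
  have hen' : inton a r (fun s => enorm (y s)) by apply: inton_sub hen.
  rewrite integD ?integZ//; [|exact: intonZ|exact: inton_sub hg].
  have : integ a r g <= integ a b g by exact: integ_mono.
  have := ler_enormD (y r - y a) (y a); rewrite subrK; lra.
rewrite -!mulrA ler_wpM2l// [leRHS]mulrC ler_wpM2l//.
rewrite ler_expR ler_wpM2l// ler_wpM2l ?(ltW L0)//.
by case/andP: sab => _ sb; rewrite lerD2r.
Qed.

(** Chain rule for the squared norm: the sum of [sqr_primitive] over the coordinates. *)
Lemma path_energy a b z F : is_path a b z F -> forall s, a <= s <= b ->
  enorm (z s) ^+ 2 = enorm (z a) ^+ 2 + integ a s (fun r => 2 * dotp (F r) (z r)).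
Proof.
move=> hz s sab.
have ab : a <= b by case/andP: sab; exact: le_trans.
have hzF i : inton a b (fun r => 2 * (z r 0 i * F r 0 i)).
  have [hF hz'] := hz i.
  have ci := integ_primitive_continuous ab hF hz'.
  have [M M0 zM] := within_bounded ab ci.
  by apply/intonZ/(inton_mul_bounded (within_meas ci) zM).
rewrite !enorm_sqr.
have -> : integ a s (fun r => 2 * dotp (F r) (z r)) =
    integ a s (fun r => \sum_(i < n) 2 * (z r 0 i * F r 0 i)).
  apply: eq_integ => r _; rewrite /dotp mulr_sumr.
  by apply: eq_bigr => i _; rewrite [F _ _ _ * _]mulrC.
case/andP: sab => as_ sb.
rewrite integ_sum; last by move=> i; apply: inton_sub (hzF i).
rewrite -big_split; apply: eq_bigr => i _/=; have [hF hz'] := hz i.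
by rewrite -!expr2 (sqr_primitive hF hz')// as_.
Qed.

(* With M the maximum of |z|, Gronwall applied to |z|^2 gives
   M^2 <= E (|z a|^2 + 2 M \int g), hence the linear bound. *)
Lemma path_monotone a b z F (L : R) (g : R -> R) : 0 < L -> is_path a b z F ->
  inton a b g -> (forall s, a <= s <= b -> 0 <= g s) ->
  (forall s, a <= s <= b ->
     dotp (F s) (z s) <= L * enorm (z s) ^+ 2 + g s * enorm (z s)) ->
  forall s, a <= s <= b ->
    enorm (z s) <= 2 * expR (4 * L * (b - a)) * (enorm (z a) + 2 * integ a b g).
Proof.
move=> L0 hz hg g0 Fg s sab.
have ab : a <= b by case/andP: sab; exact: le_trans.
have cz := path_continuous ab hz.
have cn := within_enorm cz; have cn2 := within_enorm_sqr cz.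
have [c cab hM] := EVT_max ab cn.
set M := enorm (z c) in hM.
have zM r : a <= r <= b -> enorm (z r) <= M by move=> rab; apply: hM; rewrite in_itv.
have M0 : 0 <= M by exact: enorm_ge0.
apply: le_trans (zM _ sab) _.
set B := integ a b g; set E := 2 * expR _; set z0 := enorm (z a).
have B0 : 0 <= B by exact: integ_ge0.
have z00 : 0 <= z0 by exact: enorm_ge0.
have A0 : 0 <= z0 ^+ 2 + 2 * M * B by rewrite addr_ge0 ?sqr_ge0// mulr_ge0// mulr_ge0.
have L20 : 0 < 2 * L by rewrite mulr_gt0.
have key : M ^+ 2 <= E * (z0 ^+ 2 + 2 * M * B).
  move: cab; rewrite in_itv/= => cab.
  apply: le_trans (gronwall A0 L20 cn2 _ cab) _.
    move=> r rab; rewrite (path_energy hz rab) -addrA lerD2l.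
    have [ar rb] := andP rab.
    have hn2 : inton a b (fun s => enorm (z s) ^+ 2) by exact: inton_cont.
    have hn2' : inton a r (fun s => enorm (z s) ^+ 2) by apply: inton_sub hn2.
    have hg' : inton a r g by apply: inton_sub hg.
    apply: le_trans (_ : integ a r (fun r => 2 * M * g r + 2 * L * enorm (z r) ^+ 2) <= _).
      apply: integ_le.
      - apply: intonZ.
        have -> : (fun r => dotp (F r) (z r)) = (fun r => \sum_(i < n) z r 0 i * F r 0 i).
          by apply/funext => q; apply: eq_bigr => i _; rewrite mulrC.
        apply: inton_sum => i.
        have [hF hz'] := hz i.
        have ci := integ_primitive_continuous ab hF hz'.
        have [M' _ zM'] := within_bounded ab ci.
        apply: (@inton_sub _ a b) => //.
        exact: (inton_mul_bounded (within_meas ci) zM').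
      - by apply: intonD; exact: intonZ.
      - move=> q /andP[aq qr].
        have qab : a <= q <= b by rewrite aq (le_trans qr).
        have := Fg q qab; have := zM q qab; have := g0 q qab; have := enorm_ge0 (z q).
        nra.
    rewrite integD ?integZ//; [|exact: intonZ|exact: intonZ].
    rewrite lerD2r ler_wpM2l ?mulr_ge0//.
    by apply: integ_mono.
  have -> : 2 * (2 * L) * (c - a) = 4 * L * (c - a) by ring.
  rewrite /E mulrAC ler_wpM2r// ler_wpM2l// ler_expR ler_wpM2l ?mulr_ge0 ?(ltW L0)//.
  by case/andP: cab => _ cb; rewrite lerD2r.
have E1 : 1 <= E.
  have : 1 <= expR (4 * L * (b - a)) by rewrite -expR0 ler_expR !mulr_ge0 ?subr_ge0 ?(ltW L0).
  rewrite /E; lra.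
(* If M exceeded E * (z0 + 2 * B), then z0 <= E * z0 <= M, so z0 ^ 2 <= M * z0 in [key]; dividing
   [key] by M > 0 would give the bound itself. *)
rewrite leNgt; apply/negP => Mgt.
have h1 : E * z0 <= M.
  apply: le_trans (ltW Mgt); rewrite ler_wpM2l ?(le_trans ler01 E1)//.
  by rewrite lerDl mulr_ge0.
have h2 : E * z0 ^+ 2 <= M * (E * z0).
  by rewrite expr2 mulrA [leRHS]mulrC ler_wpM2l// ?(le_trans _ h1)//; nra.
have Mp : 0 < M.
  by apply: le_lt_trans Mgt; rewrite mulr_ge0 ?(le_trans ler01 E1)// addr_ge0// mulr_ge0.
have := Mgt; rewrite -(ltr_pM2l Mp) ltNge => /negP; apply.
rewrite -expr2; apply: le_trans key _.
rewrite mulrDr; nra.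
Qed.

End paths.

(** * Measurability of the data along states and controls *)

Section measurable_superposition.
Context {R : realType}.

Lemma measurable_row_ball (m : nat) (D : set R) (y : R -> 'rV[R]_m) (q : 'rV[R]_m) (e : R) :
  measurable D -> (forall i, measurable_fun D (fun s => y s 0 i)) ->
  measurable (D `&` [set s | ball q e (y s)]).
Proof.
move=> mD my; have [e0|e0] := ltP 0 e; last first.
  rewrite (_ : _ `&` _ = set0)//; apply/seteqP; split => // s [_ [/lt_geF]].
  by rewrite e0.
rewrite (_ : _ `&` _ = D `&` \bigcap_(i in [set: 'I_m])
    (D `&` (fun s => y s 0 i) @^-1` ball (q 0 i) e)).
  apply: measurableI => //; apply: fin_bigcap_measurable => // i _.
  apply: my => //; apply: open_measurable; exact: ball_open.
apply/seteqP; split => [s [Ds [_ h]]|s [Ds h]].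
  by split => // i _; split => //; exact: h.
by split => //; split => // i j; rewrite ord1; have [] := h j I.
Qed.

Lemma ratr_dense_ball (x e : R) : 0 < e -> exists q : rat, ball (ratr q : R) e x.
Proof.
move=> e0; have /rat_in_itvoo[q] : x - e < x + e by lra.
rewrite in_itv/= => /andP[h1 h2]; exists q.
by rewrite /ball/= ltr_norml; apply/andP; split; lra.
Qed.

Lemma row_ratr_dense_ball m (x : 'rV[R]_m) (e : R) : 0 < e ->
  exists q : 'rV[rat]_m, ball (map_mx ratr q : 'rV[R]_m) e x.
Proof.
move=> e0; have /choice[q hq] : forall i, exists q : rat, ball (ratr q : R) e (x 0 i).
  by move=> i; exact: ratr_dense_ball.
by exists (\row_i q i); split => // i j; rewrite ord1 !mxE; exact: hq.
Qed.

(* {F (s, y s, v s, w s) > a} is the countable union of the preimages of the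
   rational boxes on whose trace on [Dom] F exceeds a. *)
Lemma measurable_superposition (n m1 m2 : nat)
    (Dom : set (R * 'rV[R]_n * 'rV[R]_m1 * 'rV[R]_m2))
    (F : R * 'rV[R]_n * 'rV[R]_m1 * 'rV[R]_m2 -> R) (a b : R)
    (y : R -> 'rV[R]_n) (v : R -> 'rV[R]_m1) (w : R -> 'rV[R]_m2) :
  {within Dom, continuous F} ->
  (forall s, a <= s <= b -> Dom (s, y s, v s, w s)) ->
  (forall i, measurable_fun `[a, b] (fun s => y s 0 i)) ->
  (forall i, measurable_fun `[a, b] (fun s => v s 0 i)) ->
  (forall i, measurable_fun `[a, b] (fun s => w s 0 i)) ->
  measurable_fun `[a, b] (fun s => F (s, y s, v s, w s)).
Proof.
move=> cF hD my mv mw; apply: (measurability _ (RGenOInfty.measurableE R)) => //.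
move=> /= _ [_ [r ->] <-].
pose K := (rat * 'rV[rat]_n * 'rV[rat]_m1 * 'rV[rat]_m2 * nat)%type.
pose Psi (k : K) : R * 'rV[R]_n * 'rV[R]_m1 * 'rV[R]_m2 :=
  (ratr k.1.1.1.1, map_mx ratr k.1.1.1.2, map_mx ratr k.1.1.2, map_mx ratr k.1.2).
pose good := [set k : K | forall q, Dom q -> ball (Psi k) (k.2.+1%:R^-1) q -> r < F q].
rewrite (_ : _ `&` _ = \bigcup_(k : K) (if `[< good k >] then
    `[a, b] `&` [set s | ball (Psi k) (k.2.+1%:R^-1) (s, y s, v s, w s)] else set0)).
  apply: countable_bigcupT_measurable; first exact: countableP.
  move=> k; case: asboolP => // _.
  set e := _^-1.
  rewrite (_ : _ `&` _ =
     (`[a, b] `&` (ball (ratr k.1.1.1.1 : R) e)) `&`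
     (`[a, b] `&` [set s | ball (map_mx ratr k.1.1.1.2 : 'rV[R]_n) e (y s)]) `&`
     (`[a, b] `&` [set s | ball (map_mx ratr k.1.1.2 : 'rV[R]_m1) e (v s)]) `&`
     (`[a, b] `&` [set s | ball (map_mx ratr k.1.2 : 'rV[R]_m2) e (w s)])).
    apply: measurableI; [apply: measurableI; [apply: measurableI|]|];
      try by apply: measurable_row_ball.
    by apply: measurableI => //; apply: open_measurable; exact: ball_open.
  apply/seteqP; split => [s [Ds [[[h1 h2] h3] h4]]|s].
    by split; [split; [split|]|].
  by move=> [[[[Ds h1] [_ h2]] [_ h3]] [_ h4]]; split.
apply/seteqP; split => [s [sab]|s [k _]].
  rewrite /= in_itv/= andbT => rF.
  have sab' : a <= s <= b by move: sab; rewrite /= in_itv.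
  have := hD _ sab' => Ds.
  move/subspace_continuousP/(_ _ Ds) : cF => /(_ `]r, +oo[%classic).
  have Or : nbhs (F (s, y s, v s, w s)) `]r, +oo[%classic.
    by apply: open_nbhs_nbhs; split => //=; rewrite in_itv/= rF.
  move=> /(_ Or); rewrite /from_subspace => /nbhs_ballP[e /= e0 he].
  have [j je] : exists j : nat, j.+1%:R^-1 < e / 2.
    exists (Num.bound (e / 2)^-1).
    rewrite invf_plt ?posrE ?divr_gt0//.
    have e20 : 0 <= (e / 2)^-1 by rewrite invr_ge0 divr_ge0// ltW.
    by rewrite (lt_trans (archi_boundP e20))// ltr_nat.
  have j0 : 0 < (j.+1%:R^-1 : R) by rewrite invr_gt0 ltr0n.
  have [q1 hq1] := ratr_dense_ball s j0.
  have [q2 hq2] := row_ratr_dense_ball (y s) j0.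
  have [q3 hq3] := row_ratr_dense_ball (v s) j0.
  have [q4 hq4] := row_ratr_dense_ball (w s) j0.
  exists (q1, q2, q3, q4, j) => //.
  have hb : ball (Psi (q1, q2, q3, q4, j)) (j.+1%:R^-1) (s, y s, v s, w s).
    by split; [split; [split|]|].
  case: asboolP => [_|[]]; first by split.
  have je2 : j.+1%:R^-1 + j.+1%:R^-1 <= e by move: je; set z := _^-1; lra.
  move=> q Dq hq; have := he q; rewrite /= in_itv/= andbT; apply => //.
  have : ball (s, y s, v s, w s) (j.+1%:R^-1 + j.+1%:R^-1) q.
    by apply: ball_triangle hq; apply: ball_sym.
  exact: le_ball.
case: asboolP => // gk [sab hb]; split => //=.
rewrite in_itv/= andbT; apply: gk => //; apply: hD.
by move: sab; rewrite /= in_itv.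
Qed.

End measurable_superposition.

(** * Existence of Caratheodory solutions for bounded Lipschitz fields *)

Section picard.
Context {R : realType} {n : nat}.

(** The limit is the supremum of the lower ends of the error intervals; every upper end bounds all
    of them, so existence and rate come together. *)
Lemma geometric_limit (u : nat -> R) (C : R) : 0 <= C ->
  (forall k m, (k <= m)%N -> `|u m - u k| <= C / 2 ^+ k) ->
  exists l, forall k, `|l - u k| <= C / 2 ^+ k.
Proof.
move=> C0 hu.
pose S := [set u k - C / 2 ^+ k | k in [set: nat]].
have ub k : ubound S (u k + C / 2 ^+ k).
  move=> _ [m _ <-].
  have C0' j : 0 <= C / 2 ^+ j by rewrite divr_ge0// exprn_ge0.
  have := C0' k; have := C0' m.
  have [km|/ltnW mk] := leqP k m.
    by have := hu k m km; rewrite ler_norml => /andP[]; lra.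
  by have := hu m k mk; rewrite ler_norml => /andP[]; lra.
have hS : has_sup S.
  by split; [exists (u 0 - C / 2 ^+ 0), 0|exists (u 0 + C / 2 ^+ 0); exact: ub].
exists (sup S) => k; rewrite ler_norml; apply/andP; split.
  have : u k - C / 2 ^+ k <= sup S by apply: ub_le_sup; [case: hS|exists k].
  lra.
have : sup S <= u k + C / 2 ^+ k by apply: ge_sup; [case: hS|exact: ub].
lra.
Qed.

Lemma lipschitz_within a b (y : R -> R) (M : R) :
  (forall r s, a <= r <= b -> a <= s <= b -> `|y r - y s| <= M * `|r - s|) ->
  {within `[a, b], continuous y}.
Proof.
move=> hy; apply/subspace_continuousP => x /=; rewrite in_itv/= => xab.
apply/cvgrPdist_lt => e e0; rewrite /from_subspace near_withinE.
have M0 : 0 < `|M| + 1 by rewrite ltr_wpDl.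
near=> s; rewrite /= in_itv/= => sab.
apply: le_lt_trans (hy _ _ xab sab) _.
apply: le_lt_trans (_ : (`|M| + 1) * `|x - s| < e).
  by rewrite ler_wpM2r//; have := ler_norm M; lra.
rewrite mulrC -ltr_pdivlMr//.
near: s; apply: (@cvgr_dist_lt _ _ _ (nbhs x) _ id x) => //.
by rewrite divr_gt0.
Unshelve. all: by end_near. Qed.

(* Picard iteration, contracting by 1/2 in the norm weighted by
   exp (- 2 Lam (s - a)). *)
Lemma caratheodory_existence (a b : R) (G : R -> 'rV[R]_n -> 'rV[R]_n)
    (x0 : 'rV[R]_n) (Lam M : R) : a <= b -> 0 < Lam -> 0 <= M ->
  (forall y : R -> 'rV[R]_n, {within `[a, b], continuous y} ->
     forall i, measurable_fun `[a, b] (fun s => G s (y s) 0 i)) ->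
  (forall s x z, a <= s <= b -> enorm (G s x - G s z) <= Lam * enorm (x - z)) ->
  (forall s x, a <= s <= b -> enorm (G s x) <= M) ->
  exists2 y, is_path a b y (fun s => G s (y s)) & y a = x0.
Proof.
move=> ab Lam0 M0 mG lipG bG.
pose P (y : R -> 'rV[R]_n) : R -> 'rV[R]_n :=
  fun s => \row_i (x0 0 i + integ a s (fun r => G r (y r) 0 i)).
have GL1 (y : R -> 'rV[R]_n) i : {within `[a, b], continuous y} -> inton a b (fun s => G s (y s) 0 i).
  move=> cy; apply: (@inton_le _ _ _ _ (fun=> M)); [exact: mG| |exact: inton_cst].
  by move=> s sab; apply: le_trans (ler_coord_enorm _ _) (bG _ _ sab).
have pP (y : R -> 'rV[R]_n) : {within `[a, b], continuous y} -> is_path a b (P y) (fun s => G s (y s)).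
  move=> cy i; split; first exact: GL1.
  by move=> s sab; rewrite !mxE integ_refl addr0.
have lipP (y : R -> 'rV[R]_n) : {within `[a, b], continuous y} -> forall i r s,
    a <= r <= b -> a <= s <= b -> `|P y r 0 i - P y s 0 i| <= M * `|r - s|.
  move=> cy i.
  have H r s : a <= r <= b -> a <= s <= b -> r <= s ->
      `|P y r 0 i - P y s 0 i| <= M * `|r - s|.
    move=> rab sab rs; have [ar rb] := andP rab; have [as_ sb] := andP sab.
    rewrite !mxE (@integ_split _ a r s) ?ar ?rs//; last first.
      by apply: inton_sub (GL1 y i cy).
    set A := integ a r _; set B := integ r s _.
    have -> : x0 0 i + A - (x0 0 i + (A + B)) = - B by ring.
    rewrite normrN [`|r - s|]distrC [`|s - r|]ger0_norm ?subr_ge0// -integ_cst//.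
    apply: integ_norm_le; [|exact: inton_cst|].
      by apply: inton_sub (GL1 y i cy).
    move=> q /andP[rq qs]; apply: le_trans (ler_coord_enorm _ _) _.
    by apply: bG; rewrite (le_trans ar rq) (le_trans qs sb).
  move=> r s rab sab; have [rs|/ltW sr] := leP r s; first exact: H.
  by rewrite distrC [`|r - s|]distrC; exact: H.
have cP (y : R -> 'rV[R]_n) : {within `[a, b], continuous y} -> {within `[a, b], continuous (P y)}.
  by move=> cy; exact: path_continuous (pP y cy).
pose w s := expR (2 * Lam * (s - a)).
have w0 s : 0 < w s by exact: expR_gt0.
have w1 s : a <= s -> 1 <= w s.
  by move=> as_; rewrite -expR0 ler_expR !mulr_ge0 ?subr_ge0 ?(ltW Lam0).
have wb s : s <= b -> w s <= w b.
  by move=> sb; rewrite ler_expR ler_wpM2l ?mulr_ge0 ?(ltW Lam0)// lerB.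
have wI c : inton a c w.
  by apply: inton_cont; apply: continuous_subspaceT; exact: continuous_expR_affine.
(* The weight has derivative 2 * Lam * w, so integrating Lam * D * w gains the factor 1/2. *)
have contr (y z : R -> 'rV[R]_n) (D : R) : {within `[a, b], continuous y} -> {within `[a, b], continuous z} ->
    0 <= D ->
    (forall s, a <= s <= b -> enorm (y s - z s) <= D * w s) ->
    forall s, a <= s <= b -> enorm (P y s - P z s) <= D / 2 * w s.
  move=> cy cz D0 hyz s sab; have [as_ sb] := andP sab.
  have hp := pathB (pP y cy) (pP z cz).
  have := @path_dist _ _ a b _ _ (fun s => Lam * D * w s) hp.
  have -> : P y a - P z a = 0.
    by apply/rowP => i; rewrite !mxE !integ_refl subrr.
  move=> /(_ (intonZ _ (wI b))) H; have {H} := H _ s sab.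
  rewrite subr0 integZ// integ_expR ?mulr_gt0// => H.
  apply: le_trans (H _) _.
    move=> r rab; apply: le_trans (lipG _ _ _ rab) _.
    by rewrite -mulrA ler_wpM2l ?(ltW Lam0)// hyz.
  rewrite -/(w s) (_ : Lam * D * ((w s - 1) / (2 * Lam)) = D / 2 * (w s - 1)); last first.
    by field; rewrite gt_eqF.
  by rewrite ler_wpM2l ?divr_ge0// gerBl.
pose Y k := iter k P (fun=> x0).
have cY k : {within `[a, b], continuous (Y k)}.
  elim: k => [|k IH]; last exact: cP.
  by apply: continuous_subspaceT => x; exact: cvg_cst.
pose D := M * (b - a).
have D0 : 0 <= D by rewrite mulr_ge0// subr_ge0.
have stepY k s : a <= s <= b -> enorm (Y k.+1 s - Y k s) <= D / 2 ^+ k * w s.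
  elim: k s => [|k IH] s sab; last first.
    rewrite exprS (_ : D / (2 * 2 ^+ k) = D / 2 ^+ k / 2); last first.
      by field; rewrite expf_neq0.
    by apply: (contr _ _ _ (cY k.+1) (cY k)) => //; rewrite divr_ge0// exprn_ge0.
  have hp := pP _ (cY 0).
  have [as_ sb] := andP sab.
  have := path_dist hp (inton_cst a b M) (fun s => @bG s _) sab.
  have -> : P (Y 0) a = x0 by apply/rowP => i; rewrite !mxE integ_refl addr0.
  rewrite integ_cst// expr0 divr1 => /le_trans; apply.
  rewrite -[leLHS]mulr1; apply: ler_pM => //; last exact: w1.
    by rewrite mulr_ge0// subr_ge0.
  by rewrite ler_wpM2l// lerB.
(* Sum of the geometric series in [stepY], with the weight replaced by its largest value. *)
pose C := 2 * D * w b.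
have C0 : 0 <= C by apply: mulr_ge0; [exact: mulr_ge0|exact: ltW].
have cauchyY k m s : a <= s <= b -> (k <= m)%N -> enorm (Y m s - Y k s) <= C / 2 ^+ k.
  move=> sab; move=> /subnK <-; move: (m - k)%N => d; elim: d k => [|j IH] k.
    by rewrite add0n subrr enorm0 divr_ge0// exprn_ge0.
  rewrite addSnnS; have := IH k.+1; have := stepY k s sab.
  have -> : Y (j + k.+1)%N s - Y k s = (Y (j + k.+1)%N s - Y k.+1 s) + (Y k.+1 s - Y k s).
    by rewrite addrA subrK.
  move=> h1 h2; apply: le_trans (ler_enormD _ _) _; apply: le_trans (lerD h2 h1) _.
  have [as_ sb] := andP sab.
  have : D / 2 ^+ k * w s <= D / 2 ^+ k * w b.
    by rewrite ler_wpM2l ?wb// divr_ge0// exprn_ge0.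
  rewrite exprS (_ : C / (2 * 2 ^+ k) = D / 2 ^+ k * w b); last first.
    by rewrite /C; field; rewrite expf_neq0.
  rewrite (_ : C / 2 ^+ k = D / 2 ^+ k * w b + D / 2 ^+ k * w b); last first.
    by rewrite /C; field; rewrite expf_neq0.
  lra.
have /choice[Z hZ] : forall s, exists z : 'rV[R]_n, a <= s <= b ->
    forall k i, `|z 0 i - Y k s 0 i| <= C / 2 ^+ k.
  move=> s; have [sab|nsab] := boolP (a <= s <= b); last by exists 0.
  have /choice[l hl] : forall i, exists l, forall k, `|l - Y k s 0 i| <= C / 2 ^+ k.
    move=> i; apply: geometric_limit => // k m km.
    have -> : Y m s 0 i - Y k s 0 i = (Y m s - Y k s) 0 i by rewrite !mxE.
    by apply: le_trans (ler_coord_enorm _ _) _; exact: cauchyY.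
  by exists (\row_i l i) => _ k i; rewrite mxE.
have cZ : {within `[a, b], continuous Z}.
  apply: within_rowP => i; apply: (@lipschitz_within _ _ _ M) => r s rab sab.
  (* The limit inherits the Lipschitz constant M of the iterates; [k.+1] appears because [lipP]
     concerns images of [P]. *)
  rewrite -subr_le0; apply: (@le0_of_le_half_pow _ _ (2 * C)) => k.
  have h1 := hZ r rab k.+1 i; have h2 := hZ s sab k.+1 i.
  have h3 : `|Y k.+1 r 0 i - Y k.+1 s 0 i| <= M * `|r - s| by exact: lipP.
  have h4 : C / 2 ^+ k.+1 <= C / 2 ^+ k.
    rewrite ler_wpM2l// lef_pV2 ?posrE ?exprn_gt0//.
    by rewrite exprS ler_peMl// ?exprn_ge0// ler1n.
  move: h1 h2 h3; rewrite (distrC (Z s 0 i)) => h1 h2 h3.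
  rewrite -mulrA; move: (C / 2 ^+ k) (C / 2 ^+ k.+1) h4 h1 h2 => c1 c2 h4 h1 h2.
  have := ler_normD (Z r 0 i - Y k.+1 r 0 i) (Y k.+1 r 0 i - Z s 0 i).
  rewrite addrA subrK.
  have := ler_normD (Y k.+1 r 0 i - Y k.+1 s 0 i) (Y k.+1 s 0 i - Z s 0 i).
  rewrite addrA subrK; lra.
have dZ k s : a <= s <= b -> enorm (Z s - Y k s) <= n%:R * (C / 2 ^+ k).
  move=> sab; apply: enorm_le_bound; first by rewrite divr_ge0// exprn_ge0.
  by move=> i; rewrite !mxE; exact: hZ.
(* Both sides are close to [Y k.+1], that is [P (Y k)]: the left one by the rate of convergence, the
   right one by the contraction. *)
have ZP s : a <= s <= b -> Z s = P Z s.
  move=> sab; apply/rowP => i; apply/eqP; rewrite -subr_eq0 -normr_le0.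
  apply: (@le0_of_le_half_pow _ _ (C + n%:R * C / 2 * w b)) => k.
  have [as_ sb] := andP sab.
  have h1 := hZ s sab k.+1 i.
  have h2 : enorm (P (Y k) s - P Z s) <= n%:R * (C / 2 ^+ k) / 2 * w s.
    apply: (contr _ _ _ (cY k) cZ) => //; first by rewrite mulr_ge0// divr_ge0// exprn_ge0.
    move=> r rab; rewrite enorm_distC; apply: le_trans (dZ k r rab) _.
    rewrite ler_peMr ?w1//; last by case/andP: rab.
    by rewrite mulr_ge0// divr_ge0// exprn_ge0.
  have h3 := ler_coord_enorm (P (Y k) s - P Z s) i.
  have h4 : C / 2 ^+ k.+1 <= C / 2 ^+ k.
    rewrite ler_wpM2l// lef_pV2 ?posrE ?exprn_gt0//.
    by rewrite exprS ler_peMl// ?exprn_ge0// ler1n.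
  have h5 : n%:R * (C / 2 ^+ k) / 2 * w s <= n%:R * C / 2 * w b / 2 ^+ k.
    rewrite (_ : n%:R * C / 2 * w b / 2 ^+ k = n%:R * (C / 2 ^+ k) / 2 * w b); last first.
      by ring.
    by rewrite ler_wpM2l ?wb// !divr_ge0// mulr_ge0// divr_ge0// exprn_ge0.
  move: h1; rewrite -[Y k.+1 s]/(P (Y k) s) => h1.
  have := ler_normD (Z s 0 i - P (Y k) s 0 i) (P (Y k) s 0 i - P Z s 0 i).
  have E3 : (P (Y k) s - P Z s) 0 i = P (Y k) s 0 i - P Z s 0 i by rewrite !mxE.
  rewrite addrA subrK mulrDl; rewrite E3 in h3; lra.
exists Z; last by rewrite ZP ?lexx//; apply/rowP => i; rewrite !mxE integ_refl addr0.
move=> i; split; first exact: GL1.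
move=> s sab; rewrite (ZP s sab) (ZP a) ?lexx//.
by have [_ ->//] := pP Z cZ i.
Qed.

End picard.

(** * Estimates for trajectories and costs *)

Section power_inequalities.
Context {R : realType}.
Implicit Types (w Z a r mu kap C : R).

Lemma powR_mono w Z a : 0 <= a -> 0 <= w -> w <= Z -> w `^ a <= Z `^ a.
Proof. by move=> a0 w0 wZ; apply: ge0_ler_powR; rewrite ?nnegrE// (le_trans w0). Qed.

Lemma powR_anti w Z a : a <= 0 -> 0 < Z -> Z <= w -> w `^ a <= Z `^ a.
Proof.
move=> a0 Z0 Zw; have w0 := lt_le_trans Z0 Zw.
rewrite -[a]opprK !(powRN _ (- a)) lef_pV2 ?posrE ?powR_gt0//.
by apply: powR_mono; rewrite ?oppr_ge0// ltW.
Qed.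

Lemma powRD_pos w a r : 0 < w -> w `^ (a + r) = w `^ a * w `^ r.
Proof. by move=> w0; rewrite powRD// (gt_eqF w0) implybT. Qed.

Lemma powR_split w a : 0 < w -> w `^ a = w * w `^ (a - 1).
Proof.
move=> w0; rewrite -[X in X * _]powRr1 ?ltW// -powRD_pos//.
by congr (_ `^ _); ring.
Qed.

Lemma powR_ge1 w a : 0 <= a -> 1 <= w -> 1 <= w `^ a.
Proof.
move=> a0 w1; have H : 1 `^ a = 1 :> R by rewrite powR1.
by rewrite -[leLHS]H; exact: powR_mono.
Qed.

(* A scale-dependent substitute for Young's and Hoelder's inequalities. *)
Lemma powR_le_affine w Z a : 0 <= w -> 0 < Z -> 0 <= a -> a <= 1 ->
  w `^ a <= Z `^ a + Z `^ (a - 1) * w.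
Proof.
move=> w0 Z0 a0 a1; have [wZ|/ltW Zw] := leP w Z.
  by rewrite ler_wpDr ?mulr_ge0 ?powR_ge0// powR_mono.
rewrite ler_wpDl ?powR_ge0// powR_split ?(lt_le_trans Z0)// mulrC ler_wpM2r//.
by apply: powR_anti; rewrite ?subr_le0.
Qed.

(** This is [powR_le_affine] at scale r ^ mu. Since a * mu <= kap <= 1, a factor r ^ (kap - 1)
    remains, which is at most C ^ (kap - 1) for every r >= C. The bracket is homogeneous: for a
    weight of integral at most r ^ mu it integrates to a multiple of r. *)
Lemma powR_le_scaled w r a mu kap C : 0 <= w -> 1 <= C -> C <= r -> 1 <= mu ->
  0 <= a -> a * mu <= kap -> kap <= 1 ->
  w `^ a <= C `^ (kap - 1) * (r + r `^ (1 - mu) * w).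
Proof.
move=> w0 C1 Cr mu1 a0 ak k1.
have C0 : 0 < C by exact: lt_le_trans C1.
have r0 : 0 < r by exact: lt_le_trans Cr.
have r1 : 1 <= r by exact: le_trans Cr.
have a1 : a <= 1 by nra.
have rk : r `^ (kap - 1) <= C `^ (kap - 1) by apply: powR_anti; rewrite ?subr_le0.
apply: le_trans (powR_le_affine w0 (powR_gt0 mu r0) a0 a1) _.
rewrite -!powRrM [leRHS]mulrDr; apply: lerD.
  apply: le_trans (_ : r `^ kap <= _); first by apply: ler_powR => //; rewrite mulrC.
  by rewrite powR_split// mulrC ler_wpM2r// ltW.
rewrite mulrA ler_wpM2r//.
apply: le_trans (_ : r `^ ((kap - 1) + (1 - mu)) <= _).
  by apply: ler_powR => //; nra.
by rewrite powRD_pos// ler_wpM2r// powR_ge0.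
Qed.

(** Again [powR_le_affine] at scale r ^ mu, now for the exponent with which the weights enter the
    Lipschitz bound of the running cost; a weight of integral r ^ mu yields r ^ (mu - 1). *)
Lemma powR_le_dual w r mu : 0 <= w -> 0 < r -> 1 <= mu ->
  w `^ ((mu - 1) / mu) <= r `^ (mu - 1) + r^-1 * w.
Proof.
move=> w0 r0 mu1; have mu0 : 0 < mu by exact: lt_le_trans mu1.
have mun : mu != 0 by rewrite gt_eqF.
have := @powR_le_affine w (r `^ mu) ((mu - 1) / mu) w0 (powR_gt0 _ r0).
rewrite divr_ge0 ?subr_ge0 ?(ltW mu0)// ler_pdivrMr// mul1r.
rewrite (_ : mu - 1 <= mu); last lra.
rewrite -!powRrM (_ : mu * ((mu - 1) / mu) = mu - 1); last by field.
rewrite (_ : mu * ((mu - 1) / mu - 1) = - 1); last by field.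
by rewrite powR_inv1 ?(ltW r0)// => /(_ isT isT).
Qed.

End power_inequalities.

(** Bundling the data with the standing conditions makes the exchange of the players a map between
    games, so that the estimates are proved for the upper value alone. *)
Record game (R : realType) (n m1 m2 : nat) := Game {
  horizon : R; gL : R; gc : R; grho1 : R; grho2 : R; gsig1 : R; gsig2 : R;
  gmu : R; gmu0 : R; gmu1 : R; gmu2 : R;
  ctrl1 : set 'rV[R]_m1; ctrl2 : set 'rV[R]_m2;
  dyn : R -> 'rV[R]_n -> 'rV[R]_m1 -> 'rV[R]_m2 -> 'rV[R]_n;
  rcost : R -> 'rV[R]_n -> 'rV[R]_m1 -> 'rV[R]_m2 -> R;
  tcost : 'rV[R]_n -> R;
  horizon_gt0 : 0 < horizon; gL_gt0 : 0 < gL; gc_gt0 : 0 < gc;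
  grho1_gt0 : 0 < grho1; grho2_gt0 : 0 < grho2; gsig1_ge0 : 0 <= gsig1; gsig2_ge0 : 0 <= gsig2;
  gmu_ge1 : 1 <= gmu;
  ctrl1P : control_set_cond ctrl1; ctrl2P : control_set_cond ctrl2;
  dynP : dynamics_cond horizon gL gsig1 gsig2 gmu0 gmu1 gmu2 ctrl1 ctrl2 dyn;
  rcostP : running_cost_cond horizon gL gc grho1 grho2 gmu ctrl1 ctrl2 rcost;
  tcostP : terminal_cost_cond gL gmu tcost;
  gsig1_mu : gsig1 * gmu < grho1; gsig2_mu : gsig2 * gmu < grho2 }.

(* Without the generalization, [lra] compares these atoms up to conversion. *)
Ltac abstract_atoms :=
  repeat match goal with
  | H : is_true (_ <= _) |- _ => revert H
  | H : is_true (_ < _) |- _ => revert H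
  end;
  repeat match goal with
  | |- context [integ ?a ?b ?f] => generalize (integ a b f); intro
  end;
  repeat match goal with
  | |- context [powR ?a ?b] => generalize (powR a b); intro
  | |- context [expR ?a] => generalize (expR a); intro
  end;
  repeat match goal with
  | |- context [enorm ?a] => generalize (enorm a); intro
  | |- context [jap ?a] => generalize (jap a); intro
  | |- context [tcost ?G ?x] => generalize (tcost G x); intro
  | |- context [rcost ?G ?t ?x ?u ?v] => generalize (rcost G t x u v); intro
  end;
  intros;
  repeat match goal with
  | x := _ |- _ => clearbody x
  end.

Ltac alra := abstract_atoms; lra.

(** The coercive quantity whose integral is W_i. The growth terms of the dynamics are rewritten as
    its powers: |u| ^ sigma is [wgt rho u] to the power sigma / rho. *)
Definition wgt (R : realType) (m : nat) (rho : R) (u : 'rV[R]_m) : R := enorm u `^ rho.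

Section game_basics.
Context {R : realType} {n m1 m2 : nat} (G : game R n m1 m2).
Local Notation T := (horizon G).
Local Notation L := (gL G).
Local Notation c := (gc G).
Local Notation mu := (gmu G).
Local Notation f := (dyn G).
Local Notation g := (rcost G).
Local Notation h := (tcost G).
Local Notation U1 := (ctrl1 G).
Local Notation U2 := (ctrl2 G).
Local Notation w1 := (wgt (grho1 G)).
Local Notation w2 := (wgt (grho2 G)).
Local Notation a1 := (gsig1 G / grho1 G).
Local Notation a2 := (gsig2 G / grho2 G).

Implicit Types (t s : R) (x z : 'rV[R]_n) (y : R -> 'rV[R]_n).

(** Condition (e) in the form used below: it amounts to kap < 1, and the power kap - 1 of a large
    constant is the small parameter of the estimates. *)
Definition kap : R := Num.max (a1 * mu) (a2 * mu).

Lemma mu_gt0 : 0 < mu. Proof. exact: lt_le_trans ltr01 (gmu_ge1 G). Qed.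
Lemma a1_ge0 : 0 <= a1. Proof. by rewrite divr_ge0 ?gsig1_ge0 ?(ltW (grho1_gt0 G)). Qed.
Lemma a2_ge0 : 0 <= a2. Proof. by rewrite divr_ge0 ?gsig2_ge0 ?(ltW (grho2_gt0 G)). Qed.

Lemma kap_lt1 : kap < 1.
Proof.
rewrite /kap gt_max -!mulrA ![_^-1 * _]mulrC !mulrA.
by rewrite !ltr_pdivrMr ?grho1_gt0 ?grho2_gt0// !mul1r gsig1_mu gsig2_mu.
Qed.

Lemma a1_kap : a1 * mu <= kap. Proof. by rewrite /kap le_max lexx. Qed.
Lemma a2_kap : a2 * mu <= kap. Proof. by rewrite /kap le_max lexx orbT. Qed.

Lemma kap_ge0 : 0 <= kap.
Proof. by apply: le_trans a1_kap; rewrite mulr_ge0 ?a1_ge0 ?(ltW mu_gt0). Qed.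

Lemma a1_lt1 : a1 < 1.
Proof. have := kap_lt1; have := a1_kap; have := a1_ge0; have := gmu_ge1 G; nra. Qed.
Lemma a2_lt1 : a2 < 1.
Proof. have := kap_lt1; have := a2_kap; have := a2_ge0; have := gmu_ge1 G; nra. Qed.

Lemma wgt_ge0 m rho (u : 'rV[R]_m) : 0 <= wgt rho u. Proof. exact: powR_ge0. Qed.

Lemma wgt_sig1 (u : 'rV[R]_m1) : enorm u `^ gsig1 G = w1 u `^ a1.
Proof. by rewrite /wgt -powRrM mulrCA mulfV ?mulr1// gt_eqF// grho1_gt0. Qed.
Lemma wgt_sig2 (u : 'rV[R]_m2) : enorm u `^ gsig2 G = w2 u `^ a2.
Proof. by rewrite /wgt -powRrM mulrCA mulfV ?mulr1// gt_eqF// grho2_gt0. Qed.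

Lemma wgt0 m rho : 0 < rho -> wgt rho (0 : 'rV[R]_m) = 0.
Proof. by move=> r0; rewrite /wgt enorm0 powR0// gt_eqF. Qed.

Lemma dyn_growth t x u v : 0 <= t <= T -> U1 u -> U2 v ->
  enorm (f t x u v) <= L * (jap x + w1 u `^ a1 + w2 v `^ a2).
Proof.
move=> tT hu hv; have [_ /(_ t x x u v tT hu hv)[]] := dynP G.
by rewrite wgt_sig1 wgt_sig2.
Qed.

Lemma dyn_monotone t x z u v : 0 <= t <= T -> U1 u -> U2 v ->
  dotp (f t x u v - f t z u v) (x - z) <= L * enorm (x - z) ^+ 2.
Proof. by move=> tT hu hv; have [_ /(_ t x z u v tT hu hv)[]] := dynP G. Qed.

Lemma run_lower t x u v : 0 <= t <= T -> U1 u -> U2 v ->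
  c * w1 u - L * (jap x `^ mu + w2 v) <= g t x u v.
Proof. by move=> tT hu hv; have [_ /(_ t x x u v tT hu hv)[]] := rcostP G. Qed.

Lemma run_upper t x u v : 0 <= t <= T -> U1 u -> U2 v ->
  g t x u v <= L * (jap x `^ mu + w1 u) - c * w2 v.
Proof. by move=> tT hu hv; have [_ /(_ t x x u v tT hu hv)[]] := rcostP G. Qed.

Lemma run_lipschitz t x z u v : 0 <= t <= T -> U1 u -> U2 v ->
  `|g t x u v - g t z u v| <=
  (japmax x z `^ (mu - 1) + w1 u `^ ((mu - 1) / mu) + w2 v `^ ((mu - 1) / mu)) * enorm (x - z).
Proof.
move=> tT hu hv; have [_ /(_ t x z u v tT hu hv)[_ _]] := rcostP G.
by rewrite /wgt -!powRrM -!mulrA.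
Qed.

Lemma term_lipschitz x z : `|h x - h z| <= L * japmax x z `^ (mu - 1) * enorm (x - z).
Proof. by have [_ + _] := tcostP G; exact. Qed.

Lemma term_bound x : `|h x| <= 2 * L * jap x `^ mu.
Proof.
have [_ _ h0] := tcostP G; have L0 := gL_gt0 G; have mu1 := gmu_ge1 G.
have j1 := jap_ge1 x; have j0 := jap_gt0 x.
have Jp : 1 <= jap x `^ mu by apply: powR_ge1 => //; lra.
have := term_lipschitz x 0; rewrite subr0 => H.
have E : jap x `^ mu = jap x * jap x `^ (mu - 1) by exact: powR_split.
have J0 : japmax x (0 : 'rV_n) <= jap x.
  apply: japmax_le => //; apply: le_trans (jap_le_enorm _) _.
  by rewrite enorm0 addr0.
have H2 : L * japmax x (0 : 'rV_n) `^ (mu - 1) * enorm x <= L * jap x `^ mu.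
  rewrite -mulrA ler_wpM2l ?(ltW L0)// E mulrC; apply: ler_pM.
  - exact: enorm_ge0.
  - exact: powR_ge0.
  - exact: enorm_le_jap.
  - apply: powR_mono => //; [lra|exact: le_trans ler01 (japmax_ge1 _ _)].
have := ler_normD (h x - h 0) (h 0); rewrite subrK; nra.
Qed.

Lemma control_meas m (U : set 'rV[R]_m) t u rho : is_control U t T u ->
  measurable_fun `[t, T] (fun s => wgt rho (u s)).
Proof.
move=> [_ mu_]; rewrite /wgt.
have me : measurable_fun `[t, T] (fun s => enorm (u s)).
  apply: (@measurableT_comp _ _ _ _ _ _ (@Num.sqrt R)).
    by apply: continuous_measurable_fun; exact: sqrt_continuous.
  by apply: measurable_sum => i; apply: measurable_funM.
by apply: (@measurableT_comp _ _ _ _ _ _ (@powR R ^~ rho)) => //; exact: measurable_powR.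
Qed.

Lemma control_sub m (U : set 'rV[R]_m) t t' u : t <= t' -> is_control U t T u ->
  is_control U t' T u.
Proof.
move=> tt' [uU mu_]; split; first by move=> s /andP[h1 h2]; apply: uU; rewrite (le_trans tt').
move=> i; apply: measurable_funS (mu_ i) => //= s; rewrite /= !in_itv/= => /andP[h1 ->].
by rewrite (le_trans tt').
Qed.

Lemma trajectory_path t x u v y : t <= T -> is_trajectory T f t x u v y ->
  is_path t T y (fun r => f r (y r) (u r) (v r)) /\ y t = x.
Proof.
move=> tT [_ H]; have yt : y t = x.
  apply/rowP => i; have [_ ->] := H i; rewrite ?lexx//.
  by rewrite -integE integ_refl addr0.
split => // i; have [H1 H2] := H i; split => // s st.
by rewrite yt integE; exact: H2.
Qed.

Lemma path_trajectory t x u v y : t <= T ->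
  is_path t T y (fun r => f r (y r) (u r) (v r)) -> y t = x ->
  is_trajectory T f t x u v y.
Proof.
move=> tT hp yt; split; first exact: path_continuous hp.
move=> i; have [H1 H2] := hp i; split => // s st.
by rewrite -yt -integE; exact: H2.
Qed.

Lemma measurable_rcost t u v y : 0 <= t -> is_control U1 t T u -> is_control U2 t T v ->
  (forall i, measurable_fun `[t, T] (fun s => y s 0 i)) ->
  measurable_fun `[t, T] (fun s => g s (y s) (u s) (v s)).
Proof.
move=> t0 [uU mu_] [vU mv] my; have [cg _] := rcostP G.
apply: (measurable_superposition cg) => // s /andP[ts sT].
by split; [rewrite (le_trans t0)|apply: uU; rewrite ts|apply: vU; rewrite ts].
Qed.

Lemma measurable_dyn t u v y i : 0 <= t -> is_control U1 t T u -> is_control U2 t T v ->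
  (forall i, measurable_fun `[t, T] (fun s => y s 0 i)) ->
  measurable_fun `[t, T] (fun s => f s (y s) (u s) (v s) 0 i).
Proof.
move=> t0 [uU mu_] [vU mv] my; have [cf _] := dynP G.
apply: (@measurable_superposition _ _ _ _ (game_domain T U1 U2)
  (fun p => f p.1.1.1 p.1.1.2 p.1.2 p.2 0 i)) => // [|s /andP[ts sT]]; last first.
  by split; [rewrite (le_trans t0)|apply: uU; rewrite ts|apply: vU; rewrite ts].
apply/subspace_continuousP => p Dp.
move/subspace_continuousP/(_ p Dp) : cf => cf.
by apply: (@cvg_comp _ _ _ _ (fun v : 'rV[R]_n => v 0 i) _ _ _ cf); exact: coord_continuous.
Qed.

Lemma within_meas_coord t y : {within `[t, T], continuous y} ->
  forall i, measurable_fun `[t, T] (fun s => y s 0 i).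
Proof. by move=> cy i; apply: within_meas; exact: within_coord. Qed.

End game_basics.

(** * Trajectories of bounded controls and their costs *)

Section game_trajectories.
Context {R : realType} {n m1 m2 : nat} (G : game R n m1 m2).
Local Notation T := (horizon G).
Local Notation L := (gL G).
Local Notation c := (gc G).
Local Notation mu := (gmu G).
Local Notation f := (dyn G).
Local Notation g := (rcost G).
Local Notation h := (tcost G).
Local Notation U1 := (ctrl1 G).
Local Notation U2 := (ctrl2 G).
Local Notation w1 := (wgt (grho1 G)).
Local Notation w2 := (wgt (grho2 G)).
Local Notation a1 := (gsig1 G / grho1 G).
Local Notation kap := (kap G).
Implicit Types (t s : R) (x z : 'rV[R]_n) (y : R -> 'rV[R]_n).

(** The construction of trajectories needs a bound at every instant. Resetting the values above the
    essential bound to the admissible value 0 changes the control on a null set only. *)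
Lemma Loo_truncate m (U : set 'rV[R]_m) t u : U 0 -> controls_Loo U t T u ->
  exists (u' : R -> 'rV[R]_m) (M : R), [/\ 0 <= M, is_control U t T u',
    forall s, enorm (u' s) <= M &
    {ae @lebesgue_measure R, forall s, t <= s <= T -> u s = u' s}].
Proof.
move=> U0 [[uU mu_] [M hM]].
exists (fun s => if enorm (u s) <= `|M| then u s else 0), `|M|; split => //.
- split => [s st|i]; first by case: ifP => // _; exact: uU.
  rewrite (_ : (fun s => _) = (fun s => if enorm (u s) <= `|M| then u s 0 i else 0)); last first.
    by apply/funext => s; case: ifP => // _; rewrite mxE.
  apply: measurable_fun_if => //.
  + apply: measurable_fun_ler; last exact: measurable_cst.
    have := @control_meas _ _ _ _ G m U t u 1 (conj uU mu_).
    by apply: eq_measurable_fun => s _; rewrite /wgt powRr1// enorm_ge0.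
  + by apply: (@measurable_funS _ _ _ _ `[t, T]) => // s [].
- by move=> s; case: ifP => // _; rewrite enorm0.
- apply: ae_mono hM => s hs st; rewrite (le_trans (hs st)) ?ler_norm//.
Qed.

(** Projection onto a box rather than a ball: working coordinate by coordinate, it is nonexpansive
    for the Euclidean norm and preserves measurability at once. *)
Definition clamp (B : R) x : 'rV[R]_n := \row_i Num.max (- B) (Num.min B (x 0 i)).

Lemma clamp_bound (B : R) x i : 0 <= B -> `|clamp B x 0 i| <= B.
Proof.
move=> B0; rewrite mxE ler_norml le_max lexx/= ge_max ge_min lexx/= andbT; lra.
Qed.

Lemma clamp_lip (B : R) x z : 0 <= B -> enorm (clamp B x - clamp B z) <= enorm (x - z).
Proof.
move=> B0; apply: enorm_le_monotone => i; rewrite !mxE.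
move: (x 0 i) (z 0 i) => p q; rewrite ler_norml.
have := ler_norm (p - q); have := ler_norm (q - p); rewrite (distrC q).
rewrite /Num.max /Num.min; case: (ltP B p) => ?; case: (ltP B q) => ?.
all: case: ltP => ?; try (case: ltP => ?).
all: by move=> *; apply/andP; split; lra.
Qed.

Lemma clamp_le (B : R) x : 0 <= B -> enorm (clamp B x) <= enorm x.
Proof.
move=> B0; have := clamp_lip x 0 B0; rewrite subr0.
rewrite (_ : clamp B 0 = 0) ?subr0//; apply/rowP => i; rewrite !mxE.
by rewrite min_r// max_r// oppr_le0.
Qed.

Lemma clamp_id (B : R) x : enorm x <= B -> clamp B x = x.
Proof.
move=> xB; apply/rowP => i; rewrite !mxE.
have := le_trans (ler_coord_enorm x i) xB; rewrite ler_norml => /andP[h1 h2].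
by rewrite min_r// max_r.
Qed.

(* The dynamics are Lipschitz once the state is clamped to a box, and the a priori
   bound keeps the solution inside the box. *)
Lemma trajectory_exists t x u v : 0 <= t <= T ->
  controls_Loo U1 t T u -> controls_Loo U2 t T v ->
  exists y, is_trajectory T f t x u v y.
Proof.
move=> /andP[t0 tT] hu hv.
have [_ U10] := ctrl1P G; have [_ U20] := ctrl2P G.
have [u' [M1 [M10 cu uM uu']]] := Loo_truncate U10 hu.
have [v' [M2 [M20 cv vM vv']]] := Loo_truncate U20 hv.
have L0 := gL_gt0 G.
pose K1 := M1 `^ gsig1 G; pose K2 := M2 `^ gsig2 G.
have K10 : 0 <= K1 by exact: powR_ge0.
have K20 : 0 <= K2 by exact: powR_ge0.
have uK s : enorm (u' s) `^ gsig1 G <= K1 by apply: powR_mono; rewrite ?gsig1_ge0 ?enorm_ge0.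
have vK s : enorm (v' s) `^ gsig2 G <= K2 by apply: powR_mono; rewrite ?gsig2_ge0 ?enorm_ge0.
(* The bound of [path_growth] for velocities of size at most L * |y| + L * (1 + K1 + K2). *)
pose B := 2 * expR (2 * L * (T - t)) * (enorm x + L * (1 + K1 + K2) * (T - t)).
have B0 : 0 <= B.
  by rewrite !mulr_ge0 ?expR_ge0 ?addr_ge0 ?enorm_ge0 ?mulr_ge0 ?subr_ge0 ?(ltW L0)// !addr_ge0.
pose J := 1 + n%:R * B.
have J1 : 1 <= J by rewrite /J lerDl mulr_ge0.
have clJ z : jap (clamp B z) <= J.
  apply: le_trans (jap_le_enorm _) _; rewrite lerD2l; apply: enorm_le_bound => // i.
  exact: clamp_bound.
pose Gf s z := f s (clamp B z) (u' s) (v' s).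
(* The exponents [gmu0], [gmu1], [gmu2] may be negative; as the Japanese brackets are at least 1,
   their absolute values serve as upper bounds. *)
pose Lam := J `^ `|gmu0 G| + J `^ `|gmu1 G| * K1 + J `^ `|gmu2 G| * K2.
have Lam0 : 0 < Lam.
  by rewrite ltr_pwDl ?mulr_ge0 ?powR_ge0// ltr_pwDl ?mulr_ge0 ?powR_ge0// powR_gt0; lra.
have in_dom s : t <= s <= T -> [/\ 0 <= s <= T, U1 (u' s) & U2 (v' s)].
  move=> st; have [ts sT] := andP st.
  by rewrite (le_trans t0 ts) sT; split => //; [exact: (proj1 cu)|exact: (proj1 cv)].
have jm (z z' : 'rV[R]_n) (p : R) : japmax (clamp B z) (clamp B z') `^ p <= J `^ `|p|.
  have j1 := japmax_ge1 (clamp B z) (clamp B z').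
  apply: le_trans (_ : japmax (clamp B z) (clamp B z') `^ `|p| <= _).
    by apply: ler_powR => //; exact: ler_norm.
  apply: powR_mono => //; first by lra.
  exact: japmax_le.
have [_ dynH] := dynP G.
have mGf y : {within `[t, T], continuous y} ->
    forall i, measurable_fun `[t, T] (fun s => Gf s (y s) 0 i).
  move=> cy i; apply: (measurable_dyn i t0 cu cv) => j.
  rewrite (_ : (fun s => _) = (fun s => Num.max (- B) (Num.min B (y s 0 j)))); last first.
    by apply/funext => s; rewrite mxE.
  apply: measurable_maxr; first exact: measurable_cst.
  apply: measurable_minr; first exact: measurable_cst.
  exact: within_meas_coord.
have [|||y hy yt] := @caratheodory_existence R n t T Gf x Lam (L * (J + K1 + K2)) tT Lam0 _ mGf.
- have J0 : 0 <= J by lra.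
  by apply: mulr_ge0; [exact: ltW|do 2 apply: addr_ge0 => //].
- move=> s z z' st; have [sT us vs] := in_dom s st.
  have [_ + _] := dynH s (clamp B z) (clamp B z') _ _ sT us vs.
  move=> /le_trans; apply; apply: ler_pM.
  + by rewrite !addr_ge0 ?mulr_ge0 ?powR_ge0.
  + exact: enorm_ge0.
  + by rewrite !lerD// ler_pM ?powR_ge0.
  + exact: clamp_lip.
- move=> s z st; have [sT us vs] := in_dom s st.
  have [+ _ _] := dynH s (clamp B z) (clamp B z) _ _ sT us vs.
  by move=> /le_trans; apply; rewrite ler_wpM2l ?(ltW L0)// !lerD.
exists y; rewrite -yt.
have yB s : t <= s <= T -> clamp B (y s) = y s.
  move=> st; apply: clamp_id.
  have C0 : 0 <= L * (1 + K1 + K2).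
    by apply: mulr_ge0; [exact: ltW|do 2 apply: addr_ge0 => //].
  (* Clamping does not increase the norm, so the growth bound holds for the clamped field in terms
     of the unclamped state, and [y] never leaves the ball of radius B. *)
  have := @path_growth R n t T y _ L (fun=> L * (1 + K1 + K2)) L0 hy (inton_cst _ _ _).
  rewrite integ_cst// yt -/B; apply => // r rt.
  have [rT us vs] := in_dom r rt.
  have [+ _ _] := dynH r (clamp B (y r)) (clamp B (y r)) _ _ rT us vs.
  move=> /le_trans; apply; rewrite -mulrDr ler_wpM2l ?(ltW L0)//.
  have := jap_le_enorm (clamp B (y r)); have := clamp_le (y r) B0.
  have := uK r; have := vK r; lra.
have cy := path_continuous tT hy.
have my := within_meas_coord cy.
have cu0 := proj1 hu; have cv0 := proj1 hv.
(* Back to the original controls: they differ from the truncated ones on a null set, which no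
   integral sees. *)
have eqae i : {ae @lebesgue_measure R, forall s, t <= s <= T ->
    Gf s (y s) 0 i = f s (y s) (u s) (v s) 0 i}.
  apply: ae_mono (ae_and uu' vv') => s [h1 h2] st.
  by rewrite /Gf yB// h1// h2.
apply: path_trajectory => // i; have [hF hE] := hy i.
have mF : measurable_fun `[t, T] (fun s => f s (y s) (u s) (v s) 0 i).
  exact: (measurable_dyn i t0 cu0 cv0).
split; first exact: inton_ae (eqae i).
move=> s st; rewrite (hE _ st); congr (_ + _).
have [ts sT] := andP st.
have sub : `[t, s] `<=` `[t, T].
  by move=> r /=; rewrite !in_itv/= => /andP[-> /= rs]; exact: le_trans sT.
apply: eq_integ_ae.
- by apply: measurable_funS sub _ => //; exact: inton_meas.
- exact: measurable_funS sub mF.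
- by apply: ae_mono (eqae i) => r hr /andP[tr rs]; apply: hr; rewrite tr (le_trans rs).
Qed.

Lemma trajectoryP t x u v : 0 <= t <= T ->
  controls_Loo U1 t T u -> controls_Loo U2 t T v ->
  is_trajectory T f t x u v (trajectory T f t x u v).
Proof.
by move=> tT hu hv; apply: getPex; exact: trajectory_exists.
Qed.

Lemma Loo_wgt m (U : set 'rV[R]_m) t u (rho : R) : U 0 -> 0 <= rho -> controls_Loo U t T u ->
  inton t T (fun s => wgt rho (u s)).
Proof.
move=> U0 rho0 hu; have [u' [M [M0 cu uM uu']]] := Loo_truncate U0 hu.
apply: (@inton_ae _ _ _ (fun s => wgt rho (u' s))).
- exact: (@control_meas _ _ _ _ G _ _ _ _ rho (proj1 hu)).
- apply: (@inton_le _ _ _ _ (fun=> M `^ rho)); last exact: inton_cst.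
    exact: (@control_meas _ _ _ _ G _ _ _ _ rho cu).
  by move=> s _; rewrite ger0_norm ?wgt_ge0// powR_mono ?enorm_ge0.
- by apply: ae_mono uu' => s h st; rewrite h.
Qed.

(** The class in which the estimates live: integrable weights instead of essential bounds, which
    serve to construct trajectories. *)
Definition adm t (u : R -> 'rV[R]_m1) (v : R -> 'rV[R]_m2) : Prop :=
  [/\ 0 <= t <= T, is_control U1 t T u, is_control U2 t T v,
      inton t T (fun s => w1 (u s)) & inton t T (fun s => w2 (v s))].

Lemma Loo_adm t u v : 0 <= t <= T -> controls_Loo U1 t T u -> controls_Loo U2 t T v ->
  adm t u v.
Proof.
move=> tT hu hv; have [_ U10] := ctrl1P G; have [_ U20] := ctrl2P G.
split => //; [exact: (proj1 hu)|exact: (proj1 hv)| |].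
- by apply: (Loo_wgt U10) hu; exact/ltW/grho1_gt0.
- by apply: (Loo_wgt U20) hv; exact/ltW/grho2_gt0.
Qed.

Lemma adm_dom t u v s : adm t u v -> t <= s <= T -> [/\ 0 <= s <= T, U1 (u s) & U2 (v s)].
Proof.
move=> [/andP[t0 tT] cu cv _ _] st; have [ts sT] := andP st.
by rewrite (le_trans t0 ts) sT; split => //; [exact: (proj1 cu)|exact: (proj1 cv)].
Qed.

Lemma adm_sub t t' u v : adm t u v -> t <= t' <= T -> adm t' u v.
Proof.
move=> [/andP[t0 tT] cu cv hu hv] /andP[tt' t'T]; split.
- by rewrite (le_trans t0).
- exact: control_sub cu.
- exact: control_sub cv.
- exact: inton_sub hu.
- exact: inton_sub hv.
Qed.

Lemma inton_wgt_pow m (U : set 'rV[R]_m) t u (rho a : R) : is_control U t T u ->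
  inton t T (fun s => wgt rho (u s)) -> 0 <= a -> a <= 1 ->
  inton t T (fun s => wgt rho (u s) `^ a).
Proof.
move=> cu hw a0 a1.
apply: (@inton_le _ _ _ _ (fun s => 1 + wgt rho (u s))).
- apply: (@measurableT_comp _ _ _ _ _ _ (@powR R ^~ a)); first exact: measurable_powR.
  exact: (@control_meas _ _ _ _ G _ _ _ _ rho cu).
- move=> s _; rewrite ger0_norm ?powR_ge0//.
  have := @powR_le_affine R (wgt rho (u s)) 1 a (wgt_ge0 _ _) ltr01 a0 a1.
  by rewrite !powR1 mul1r.
- by apply: intonD => //; exact: inton_cst.
Qed.

(** The initial value is left free, so that the restriction of a trajectory to a later interval is
    again one. *)
Definition traj t u v y : Prop :=
  is_path t T y (fun r => f r (y r) (u r) (v r)).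

Definition cost t u v y : R := integ t T (fun s => g s (y s) (u s) (v s)) + h (y T).

Lemma payoffE t x u v : payoff T f g h t x u v = cost t u v (trajectory T f t x u v).
Proof. by rewrite /cost integE. Qed.

Lemma run_inton t u v y : adm t u v -> traj t u v y ->
  inton t T (fun s => g s (y s) (u s) (v s)).
Proof.
move=> had hy; have [/andP[t0 tT] cu cv hu hv] := had.
have cy := path_continuous tT hy.
have [M M0 yM] := within_bounded tT (within_enorm cy).
have L0 := gL_gt0 G; have c0 := gc_gt0 G.
pose K := L * (1 + M) `^ mu.
apply: (@inton_le _ _ _ _ (fun s => K + (L + c) * (w1 (u s) + w2 (v s)))).
- by apply: (measurable_rcost t0 cu cv); exact: within_meas_coord.
- move=> s st; have [sT us vs] := adm_dom had st.
  have lo := run_lower (y s) sT us vs; have up := run_upper (y s) sT us vs.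
  have J : jap (y s) `^ mu <= (1 + M) `^ mu.
    apply: powR_mono; [exact: ltW (mu_gt0 G)|exact: ltW (jap_gt0 _)|].
    apply: le_trans (jap_le_enorm _) _; rewrite lerD2l.
    by have := yM _ st; rewrite ger0_norm ?enorm_ge0.
  have W1 := wgt_ge0 (grho1 G) (u s); have W2 := wgt_ge0 (grho2 G) (v s).
  have KJ : L * jap (y s) `^ mu <= K by rewrite ler_wpM2l ?(ltW L0).
  have Q1 := mulr_ge0 (ltW L0) W1; have Q2 := mulr_ge0 (ltW L0) W2.
  have Q3 := mulr_ge0 (ltW c0) W1; have Q4 := mulr_ge0 (ltW c0) W2.
  rewrite ler_norml; apply/andP; split; alra.
- by apply: intonD; [exact: inton_cst|apply: intonZ; exact: intonD].
Qed.

End game_trajectories.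

(** * State and cost estimates in terms of the weights *)

Section game_estimates.
Context {R : realType} {n m1 m2 : nat} (G : game R n m1 m2).
Local Notation T := (horizon G).
Local Notation L := (gL G).
Local Notation c := (gc G).
Local Notation mu := (gmu G).
Local Notation f := (dyn G).
Local Notation g := (rcost G).
Local Notation h := (tcost G).
Local Notation w1 := (wgt (grho1 G)).
Local Notation w2 := (wgt (grho2 G)).
Local Notation a1 := (gsig1 G / grho1 G).
Local Notation a2 := (gsig2 G / grho2 G).
Local Notation kap := (kap G).
Implicit Types (t s : R) (x z : 'rV[R]_n) (y : R -> 'rV[R]_n).

(** Possible because kap - 1 is negative: here the strict inequalities sigma_i mu < rho_i pay
    off. *)
Lemma eta_small (e : R) : 0 < e -> exists2 C : R, 1 <= C & C `^ (kap - 1) <= e.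
Proof.
move=> e0; have k1 := kap_lt1 G; have kn : kap - 1 != 0 by rewrite lt_eqF// subr_lt0.
exists (Num.max 1 (e `^ (kap - 1)^-1)); first by rewrite le_max lexx.
apply: le_trans (_ : (e `^ (kap - 1)^-1) `^ (kap - 1) <= _).
  apply: powR_anti; [by rewrite subr_le0 ltW|exact: powR_gt0|by rewrite le_max lexx orbT].
by rewrite -powRrM mulVf// powRr1// ltW.
Qed.

Lemma eta_gt0 (C : R) : 1 <= C -> 0 < C `^ (kap - 1).
Proof. by move=> C1; apply: powR_gt0; exact: lt_le_trans C1. Qed.

(** Constants are absorbed as well: 1 <= r ^ kap = r ^ (kap - 1) * r. In [le_scale] the initial
    state is absorbed in the same way, as C ^ (kap - 1) * C = C ^ kap >= 1. *)
Lemma powR_scale (C r : R) : 1 <= C -> C <= r -> 1 <= C `^ (kap - 1) * r.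
Proof.
move=> C1 Cr; have r1 : 1 <= r by exact: le_trans Cr.
have r0 : 0 < r by exact: lt_le_trans r1.
apply: le_trans (_ : r `^ kap <= _); first by apply: powR_ge1 => //; exact: kap_ge0.
rewrite powR_split// mulrC ler_wpM2r ?(ltW r0)//; apply: powR_anti => //.
  by rewrite subr_le0 ltW ?kap_lt1.
exact: lt_le_trans C1.
Qed.

Lemma le_scale (C r j : R) : 1 <= C -> 0 <= j -> C * j <= r -> j <= C `^ (kap - 1) * r.
Proof.
move=> C1 j0 Cj; have C0 : 0 < C by exact: lt_le_trans C1.
apply: le_trans (_ : C `^ (kap - 1) * (C * j) <= _); last first.
  by rewrite ler_wpM2l ?powR_ge0.
rewrite mulrA [_ * C]mulrC -powR_split// ler_peMl//.
by apply: powR_ge1 => //; exact: kap_ge0.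
Qed.

(** Integrated form of [powR_le_scaled]: r ^ (1 - mu) times K * r ^ mu is K * r, so the control
    terms of the dynamics add up to a small multiple of r. *)
Lemma integ_pow_le m (U : set 'rV[R]_m) t (u : R -> 'rV[R]_m) (rho a C r K : R) :
  0 <= t <= T -> is_control U t T u -> inton t T (fun s => wgt rho (u s)) ->
  0 <= a -> a * mu <= kap -> 1 <= C -> C <= r ->
  integ t T (fun s => wgt rho (u s)) <= K * r `^ mu ->
  integ t T (fun s => wgt rho (u s) `^ a) <= C `^ (kap - 1) * r * (T + K).
Proof.
move=> /andP[t0 tT] cu hw a0 ak C1 Cr WK.
have k1 := kap_lt1 G; have mu1 := gmu_ge1 G.
have a1 : a <= 1 by nra.
have r0 : 0 < r by apply: lt_le_trans Cr; exact: lt_le_trans C1.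
have hpos : 0 <= C `^ (kap - 1) by exact: powR_ge0.
apply: le_trans (_ : integ t T (fun s => C `^ (kap - 1) * (r + r `^ (1 - mu) * wgt rho (u s))) <= _).
  apply: integ_le.
  - exact: (inton_wgt_pow cu).
  - by apply: intonZ; apply: intonD; [exact: inton_cst|exact: intonZ].
  - by move=> s _; apply: powR_le_scaled; rewrite ?wgt_ge0// ltW.
rewrite integZ; last by apply: intonD; [exact: inton_cst|exact: intonZ].
rewrite integD; [|exact: inton_cst|exact: intonZ].
rewrite integ_cst// integZ// -mulrA; apply: ler_wpM2l => //.
rewrite [leRHS]mulrDr; apply: lerD.
  by rewrite ler_wpM2l ?(ltW r0)//; alra.
apply: le_trans (ler_wpM2l (powR_ge0 _ _) WK) _.
have E1 : 1 - mu + mu = 1 by ring.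
by rewrite mulrCA -powRD_pos// E1 powRr1 ?(ltW r0)// mulrC.
Qed.

Lemma integ_dual_le m (U : set 'rV[R]_m) t (u : R -> 'rV[R]_m) (rho r K : R) :
  0 <= t <= T -> is_control U t T u -> inton t T (fun s => wgt rho (u s)) -> 0 < r ->
  integ t T (fun s => wgt rho (u s)) <= K * r `^ mu ->
  integ t T (fun s => wgt rho (u s) `^ ((mu - 1) / mu)) <= r `^ (mu - 1) * (T + K).
Proof.
move=> /andP[t0 tT] cu hw r0 WK; have mu1 := gmu_ge1 G; have mu0 := mu_gt0 G.
apply: le_trans (_ : integ t T (fun s => r `^ (mu - 1) + r^-1 * wgt rho (u s)) <= _).
  apply: integ_le.
  - apply: (inton_wgt_pow cu) => //; first by rewrite divr_ge0 ?subr_ge0 ?(ltW mu0).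
    by rewrite ler_pdivrMr// mul1r; alra.
  - by apply: intonD; [exact: inton_cst|exact: intonZ].
  - by move=> s _; apply: powR_le_dual; rewrite ?wgt_ge0.
rewrite integD; [|exact: inton_cst|exact: intonZ].
rewrite integ_cst// integZ// [leRHS]mulrDr; apply: lerD.
  by rewrite ler_wpM2l ?powR_ge0//; alra.
have ri : 0 <= r^-1 by rewrite invr_ge0 ltW.
apply: le_trans (ler_wpM2l ri WK) _.
rewrite mulrCA [leRHS]mulrC; apply: ler_wpM2l.
  have W0 : 0 <= integ t T (fun s => wgt rho (u s)) by apply: integ_ge0 => s _; exact: wgt_ge0.
  by rewrite -(pmulr_lge0 _ (powR_gt0 mu r0)); exact: le_trans WK.
by rewrite powR_split// mulrA mulVf ?gt_eqF// mul1r.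
Qed.

(** The exponential is the factor of [path_growth]. The bracket collects the initial state, the
    constant part of the growth, L * T, and the two control integrals, 2 * L * (T + K); the leading
    1 passes from |y| to <y>. Likewise [Cdist] is the factor of [path_monotone] over [0, T]. *)
Definition Cgrow : R := 1 + 2 * expR (2 * L * T) * (1 + 3 * L * T + 2 * L).
Definition Cdist : R := 2 * expR (4 * L * T).

Lemma Cgrow_ge1 : 1 <= Cgrow.
Proof.
rewrite /Cgrow lerDl mulr_ge0 ?mulr_ge0 ?expR_ge0//.
have L0 := gL_gt0 G; have := mulr_gt0 L0 (horizon_gt0 G); alra.
Qed.

Lemma Cdist_gt0 : 0 < Cdist.
Proof. by rewrite /Cdist mulr_gt0// expR_gt0. Qed.

(** While the weights may be as large as r ^ mu, the state is small compared with r once C is large.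
    This imbalance is what lets the coercive terms dominate <y> ^ mu. *)
Lemma traj_growth t u v y (C K r : R) : adm G t u v -> traj G t u v y ->
  1 <= C -> 0 <= K -> C * jap (y t) <= r ->
  integ t T (fun s => w1 (u s)) <= K * r `^ mu ->
  integ t T (fun s => w2 (v s)) <= K * r `^ mu ->
  forall s, t <= s <= T -> jap (y s) <= Cgrow * (1 + K) * (C `^ (kap - 1) * r).
Proof.
move=> had hy C1 K0 Cr W1 W2 s st.
have [/andP[t0 tT] cu cv hu hv] := had; have tT' : 0 <= t <= T by rewrite t0.
have L0 := gL_gt0 G; have T0 := horizon_gt0 G; have j1 := jap_ge1 (y t).
have Crr : C <= r by apply: le_trans Cr; rewrite ler_peMr//; alra.
set E := C `^ (kap - 1) * r.
have E1 : 1 <= E by exact: powR_scale.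
have jE : jap (y t) <= E by apply: le_scale => //; exact/ltW/jap_gt0.
have S1 := integ_pow_le tT' cu hu (a1_ge0 G) (a1_kap G) C1 Crr W1.
have S2 := integ_pow_le tT' cv hv (a2_ge0 G) (a2_kap G) C1 Crr W2.
have i1 := inton_wgt_pow cu hu (a1_ge0 G) (ltW (a1_lt1 G)).
have i2 := inton_wgt_pow cv hv (a2_ge0 G) (ltW (a2_lt1 G)).
have i12 := intonD i1 i2.
have := @path_growth R n t T y _ L
  (fun s => L * 1 + L * (w1 (u s) `^ a1 + w2 (v s) `^ a2)) L0 hy.
move=> /(_ (intonD (inton_cst _ _ _) (intonZ _ i12))).
rewrite integD; [|exact: inton_cst|exact: intonZ].
rewrite integ_cst// integZ// integD// => H.
have {H} := H _ _ s st; set X := 2 * expR _; rewrite -/E in S1 S2.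
move=> H; have {}H : enorm (y s) <= X *
    (enorm (y t) + (L * 1 * (T - t) + L * (integ t T (fun s => w1 (u s) `^ a1) +
       integ t T (fun s => w2 (v s) `^ a2)))).
  apply: H => q qt.
    by apply: addr_ge0; [alra|apply: mulr_ge0; [exact: ltW|apply: addr_ge0; exact: powR_ge0]].
  have [qT us vs] := adm_dom had qt.
  apply: le_trans (dyn_growth (y q) qT us vs) _; rewrite -!mulrDr ler_wpM2l ?(ltW L0)//.
  have := jap_le_enorm (y q); alra.
have XX : X <= 2 * expR (2 * L * T).
  by rewrite /X ler_wpM2l// ler_expR ler_wpM2l ?mulr_ge0 ?(ltW L0)//; alra.
have X0 : 0 <= X by rewrite /X mulr_ge0 ?expR_ge0.
have en := enorm_le_jap (y t).
have S10 : 0 <= integ t T (fun s => w1 (u s) `^ a1).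
  by apply: integ_ge0 => q _; exact: powR_ge0.
have S20 : 0 <= integ t T (fun s => w2 (v s) `^ a2).
  by apply: integ_ge0 => q _; exact: powR_ge0.
move: S1 S2 S10 S20 H; generalize (integ t T (fun s => w1 (u s) `^ a1)) => S1'.
generalize (integ t T (fun s => w2 (v s) `^ a2)) => S2' S1 S2 S10 S20 H.
have B : enorm (y t) + (L * 1 * (T - t) + L * (S1' + S2')) <= (1 + 3 * L * T + 2 * L) * (1 + K) * E.
  have h1 : L * S1' <= L * (E * (T + K)) by rewrite ler_wpM2l ?(ltW L0).
  have h2 : L * S2' <= L * (E * (T + K)) by rewrite ler_wpM2l ?(ltW L0).
  have h3 : L * 1 * (T - t) <= L * T * E.
    apply: le_trans (_ : L * T <= _); first by rewrite mulr1 ler_wpM2l ?(ltW L0)//; alra.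
    by rewrite ler_peMr// mulr_ge0 ?(ltW L0)// ltW.
  have h4 : 0 <= E * K by apply: mulr_ge0 => //; alra.
  have h5 : 0 <= L * T * (E * K) by apply: mulr_ge0 => //; apply: mulr_ge0; exact: ltW.
  have h6 : 0 <= L * E by apply: mulr_ge0; [exact: ltW|alra].
  alra.
apply: le_trans (jap_le_enorm _) _.
have E0 : 0 <= E by alra.
have Bp : 0 <= (1 + 3 * L * T + 2 * L) * (1 + K) * E.
  have LTp : 0 <= L * T by rewrite mulr_ge0 ?(ltW L0) ?(ltW T0).
  by apply: mulr_ge0 => //; apply: mulr_ge0; alra.
have H2 : enorm (y s) <= 2 * expR (2 * L * T) * ((1 + 3 * L * T + 2 * L) * (1 + K) * E).
  apply: le_trans H _; apply: ler_pM => //.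
  apply: addr_ge0; first exact: enorm_ge0.
  apply: addr_ge0; apply: mulr_ge0; [|alra|exact: ltW|exact: addr_ge0].
  by rewrite mulr1 ltW.
have : 1 <= (1 + K) * E by rewrite -[leLHS]mulr1; apply: ler_pM => //; alra.
rewrite /Cgrow; move: H2; set X' := 2 * expR _; alra.
Qed.

(** Inserting the velocity at [y] under the primed controls leaves a difference at equal controls,
    covered by the one-sided Lipschitz bound, and a defect [b] measured along [y] alone, where
    growth bounds are at hand. *)
Lemma traj_compare t u v u' v' y (z : R -> 'rV[R]_n) (b : R -> R) :
  adm G t u v -> adm G t u' v' -> traj G t u v y -> traj G t u' v' z ->
  inton t T b -> (forall s, t <= s <= T -> 0 <= b s) ->
  (forall s, t <= s <= T -> enorm (f s (y s) (u' s) (v' s) - f s (y s) (u s) (v s)) <= b s) ->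
  forall s, t <= s <= T ->
    enorm (z s - y s) <= Cdist * (enorm (z t - y t) + 2 * integ t T b).
Proof.
move=> had had' hy hz hb b0 hfb s st.
have [/andP[t0 tT] _ _ _ _] := had; have L0 := gL_gt0 G.
have := path_monotone L0 (pathB hz hy) hb b0 => H.
apply: le_trans (H _ s st) _.
  move=> q qt; have [qT us vs] := adm_dom had' qt.
  rewrite (_ : f q (z q) (u' q) (v' q) - f q (y q) (u q) (v q) =
     (f q (z q) (u' q) (v' q) - f q (y q) (u' q) (v' q)) +
     (f q (y q) (u' q) (v' q) - f q (y q) (u q) (v q))); last by rewrite addrA subrK.
  rewrite dotpDl lerD ?dyn_monotone//.
  by apply: le_trans (dotp_le_enorm _ _) _; rewrite ler_wpM2r ?enorm_ge0// hfb.
rewrite /Cdist ler_wpM2r//.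
  by rewrite addr_ge0 ?enorm_ge0// mulr_ge0// integ_ge0.
by rewrite ler_wpM2l// ler_expR ler_wpM2l ?mulr_ge0 ?(ltW L0)//; alra.
Qed.

Lemma cost_lipschitz (K : R) : 0 <= K -> exists2 C : R, 0 < C &
  forall t u v y (z : R -> 'rV[R]_n) (r : R), adm G t u v -> traj G t u v y -> traj G t u v z ->
    jap (y t) <= r -> jap (z t) <= r ->
    integ t T (fun s => w1 (u s)) <= K * r `^ mu ->
    integ t T (fun s => w2 (v s)) <= K * r `^ mu ->
    `|cost G t u v y - cost G t u v z| <= C * r `^ (mu - 1) * enorm (y t - z t).
Proof.
move=> K0; have T0 := horizon_gt0 G; have L0 := gL_gt0 G; have mu1 := gmu_ge1 G.
pose A := (Cgrow * (1 + K)) `^ (mu - 1).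
have A0 : 0 <= A by exact: powR_ge0.
have CG := Cgrow_ge1; have CD := Cdist_gt0.
(* [A] converts the state bound into a multiple of r ^ (mu - 1); T and L stem from the running and
   the terminal cost, 2 * (T + K) from the two integrals of [integ_dual_le]. *)
exists (Cdist * ((T + L) * A + 2 * (T + K) + 1)).
  apply: mulr_gt0 => //; have : 0 <= (T + L) * A by apply: mulr_ge0 => //; alra.
  alra.
move=> t u v y z r had hy hz yr zr W1 W2.
have [/andP[t0 tT] cu cv hu hv] := had; have tT' : 0 <= t <= T by rewrite t0.
have r1 : 1 <= r by exact: le_trans (jap_ge1 _) yr.
have r0 : 0 < r by alra.
have yr1 : 1 * jap (y t) <= r by rewrite mul1r.
have zr1 : 1 * jap (z t) <= r by rewrite mul1r.
(* No smallness is wanted here: with C = 1 the factor C ^ (kap - 1) is 1. *)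
have By := traj_growth had hy (lexx 1) K0 yr1 W1 W2.
have Bz := traj_growth had hz (lexx 1) K0 zr1 W1 W2.
rewrite (_ : 1 `^ (kap - 1) = 1) ?mul1r in By Bz; last by rewrite powR1.
set Y := Cgrow * (1 + K) * r in By Bz.
have JY s p : t <= s <= T -> 0 <= p -> japmax (y s) (z s) `^ p <= Y `^ p.
  move=> st p0; apply: powR_mono => //; first exact: le_trans ler01 (japmax_ge1 _ _).
  by apply: japmax_le; [exact: By|exact: Bz].
have mup : 0 <= mu - 1 by alra.
have YA : Y `^ (mu - 1) = A * r `^ (mu - 1).
  by rewrite /Y powRM ?(ltW r0)//; rewrite mulr_ge0//; alra.
pose D := Cdist * enorm (y t - z t).
have D0 : 0 <= D by rewrite mulr_ge0 ?enorm_ge0 ?(ltW CD).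
have dist s : t <= s <= T -> enorm (y s - z s) <= D.
  move=> st; have := @traj_compare t u v u v z y (fun=> 0) had had hz hy (inton_cst _ _ _).
  rewrite integ_cst// mul0r mulr0 addr0 -/D; apply => // q _.
  by rewrite subrr enorm0.
have ig := run_inton had hy; have ig' := run_inton had hz.
have dp : 0 <= (mu - 1) / mu by rewrite divr_ge0// ltW// mu_gt0.
have dp1 : (mu - 1) / mu <= 1 by rewrite ler_pdivrMr ?mu_gt0// mul1r; alra.
have i1 := inton_wgt_pow cu hu dp dp1.
have i2 := inton_wgt_pow cv hv dp dp1.
have S1 := integ_dual_le tT' cu hu r0 W1.
have S2 := integ_dual_le tT' cv hv r0 W2.
have i12 := intonD i1 i2.
have RI : `|integ t T (fun s => g s (y s) (u s) (v s)) -
           integ t T (fun s => g s (z s) (u s) (v s))| <=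
   integ t T (fun s => D * (Y `^ (mu - 1) + (w1 (u s) `^ ((mu - 1) / mu) +
       w2 (v s) `^ ((mu - 1) / mu)))).
  rewrite -integB//; apply: integ_norm_le; first exact: intonB.
    by apply: intonZ; apply: intonD => //; exact: inton_cst.
  move=> s st; have [sT us vs] := adm_dom had st.
  apply: le_trans (run_lipschitz (y s) (z s) sT us vs) _.
  rewrite mulrC; apply: ler_pM; rewrite ?enorm_ge0 ?addr_ge0 ?powR_ge0 ?dist//.
  by rewrite -addrA lerD2r JY.
move: RI; rewrite integZ; last by apply: intonD => //; exact: inton_cst.
rewrite integD//; last exact: inton_cst.
rewrite integ_cst// integD// YA => RI.
have TI : `|h (y T) - h (z T)| <= L * (A * r `^ (mu - 1)) * D.
  have TT : t <= T <= T by rewrite tT lexx.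
  apply: le_trans (term_lipschitz _ _ _) _.
  rewrite -YA; apply: ler_pM; rewrite ?enorm_ge0 ?dist// ?mulr_ge0 ?powR_ge0 ?(ltW L0)//.
  by rewrite ler_wpM2l ?(ltW L0)// JY.
set I1 := integ _ _ _ in RI; set I2 := integ _ _ _ in RI.
have -> : cost G t u v y - cost G t u v z = (I1 - I2) + (h (y T) - h (z T)).
  by rewrite /cost -/I1 -/I2; ring.
apply: le_trans (ler_normD _ _) _; apply: le_trans (lerD RI TI) _.
set P := r `^ (mu - 1) in S1 S2 YA *.
have P0 : 0 <= P by exact: powR_ge0.
move: S1 S2; generalize (integ t T (fun s => w1 (u s) `^ ((mu - 1) / mu))) => S1'.
generalize (integ t T (fun s => w2 (v s) `^ ((mu - 1) / mu))) => S2' S1 S2.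
have h1 : D * (A * P * (T - t) + (S1' + S2')) <= D * (A * P * T + 2 * (P * (T + K))).
  apply: ler_wpM2l => //; have : A * P * (T - t) <= A * P * T.
    by rewrite ler_wpM2l ?mulr_ge0//; alra.
  alra.
apply: le_trans (_ : ((T + L) * A + 2 * (T + K)) * P * D <= _); first alra.
rewrite /D; have := mulr_ge0 P0 D0; rewrite /D; alra.
Qed.

(* With r = max (C <x>) ((W1 + W2) `^ mu^-1) the state is at most a small
   multiple of r, so its mu-th power is absorbed by the coercive terms. *)
Lemma cost_bounds : exists2 C : R, 0 < C &
  forall t u v y, adm G t u v -> traj G t u v y ->
    let W1 := integ t T (fun s => w1 (u s)) in
    let W2 := integ t T (fun s => w2 (v s)) in
    cost G t u v y <= C * jap (y t) `^ mu + C * W1 - c / 2 * W2 /\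
    c / 2 * W1 - C * jap (y t) `^ mu - C * W2 <= cost G t u v y.
Proof.
have T0 := horizon_gt0 G; have L0 := gL_gt0 G; have mu1 := gmu_ge1 G.
have mu0 := mu_gt0 G; have c0 := gc_gt0 G; have CG := Cgrow_ge1.
(* [e1] ensures th <= 1, hence th ^ mu <= th; [e2] keeps the cost of the state below half of the
   coercivity. The 2 beside [Cgrow] is 1 + K with K = 1, as both weights are at most r ^ mu. *)
pose e1 := (2 * Cgrow)^-1; pose e2 := c / 2 / (L * (T + 2) * (2 * Cgrow)).
have CG2 : 0 < 2 * Cgrow by alra.
have LT : 0 < L * (T + 2) by apply: mulr_gt0 => //; alra.
have e10 : 0 < e1 by rewrite invr_gt0.
have e20 : 0 < e2 by apply: divr_gt0; [exact: divr_gt0|exact: mulr_gt0].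
have emin : 0 < Num.min e1 e2 by rewrite lt_min e10 e20.
have [C C1 Ce] := eta_small emin.
set eta := C `^ (kap - 1) in Ce.
have eta0 : 0 < eta by exact: eta_gt0.
move: Ce; rewrite le_min => /andP[Ce1 Ce2].
pose th := 2 * Cgrow * eta.
have th0 : 0 < th by rewrite /th mulr_gt0.
have th1 : th <= 1 by rewrite /th mulrC -ler_pdivlMr// mul1r.
have th2 : L * (T + 2) * th <= c / 2.
  by rewrite /th mulrA mulrC -ler_pdivlMr// mulr_gt0.
exists (c / 2 * C `^ mu + L + c).
  have C0 : 0 < C by alra.
  have : 0 < c / 2 * C `^ mu by apply: mulr_gt0; [alra|exact: powR_gt0].
  alra.
move=> t u v y had hy W1 W2.
have [/andP[t0 tT] cu cv hu hv] := had; have tT' : 0 <= t <= T by rewrite t0.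
have W10 : 0 <= W1 by apply: integ_ge0 => s _; exact: wgt_ge0.
have W20 : 0 <= W2 by apply: integ_ge0 => s _; exact: wgt_ge0.
have j1 := jap_ge1 (y t).
pose r := Num.max (C * jap (y t)) ((W1 + W2) `^ mu^-1).
have Cj : C * jap (y t) <= r by rewrite /r le_max lexx.
have Wr : W1 + W2 <= r `^ mu.
  apply: le_trans (_ : ((W1 + W2) `^ mu^-1) `^ mu <= _).
    by rewrite -powRrM mulVf ?gt_eqF// powRr1// addr_ge0.
  by apply: powR_mono; rewrite ?(ltW mu0) ?powR_ge0// /r le_max lexx orbT.
have rW : r `^ mu <= C `^ mu * jap (y t) `^ mu + (W1 + W2).
  rewrite /r; case: (leP (C * jap (y t))) => _.
    rewrite -powRrM mulVf ?gt_eqF// powRr1 ?addr_ge0// lerDr mulr_ge0 ?powR_ge0//.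
  by rewrite powRM ?lerDl ?addr_ge0//; alra.
have r0 : 0 < r by apply: lt_le_trans Cj; apply: mulr_gt0; alra.
have B := @traj_growth t u v y C 1 r had hy C1 ler01 Cj.
rewrite !mul1r in B.
have W1r : W1 <= r `^ mu by alra.
have W2r : W2 <= r `^ mu by alra.
have {}B s : t <= s <= T -> jap (y s) `^ mu <= th * r `^ mu.
  move=> st; have := B W1r W2r s st.
  rewrite (_ : Cgrow * (1 + 1) * (C `^ (kap - 1) * r) = th * r); last by rewrite /th /eta; ring.
  move=> jt; apply: le_trans (_ : (th * r) `^ mu <= _).
    by apply: powR_mono => //; [exact: ltW|exact/ltW/jap_gt0].
  rewrite powRM ?(ltW th0) ?(ltW r0)// ler_wpM2r ?powR_ge0//.
  rewrite powR_split// ler_piMr ?(ltW th0)//.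
  have := @powR_mono R th 1 (mu - 1) _ (ltW th0) th1; rewrite powR1; apply; alra.
have ig := run_inton had hy.
set X := th * r `^ mu in B.
have X0 : 0 <= X by rewrite mulr_ge0 ?powR_ge0// ltW.
have up : integ t T (fun s => g s (y s) (u s) (v s)) <= L * X * T + L * W1 - c * W2.
  apply: le_trans (_ : integ t T (fun s => L * X + L * w1 (u s) - c * w2 (v s)) <= _).
    apply: integ_le => //.
      by apply: intonB; [apply: intonD; [exact: inton_cst|exact: intonZ]|exact: intonZ].
    move=> s st; have [sT us vs] := adm_dom had st.
    apply: le_trans (run_upper (y s) sT us vs) _.
    by have := ler_wpM2l (ltW L0) (B s st); alra.
  rewrite integB; [|by apply: intonD; [exact: inton_cst|exact: intonZ]|exact: intonZ].
  rewrite integD; [|exact: inton_cst|exact: intonZ].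
  rewrite integ_cst// !integZ// -/W1 -/W2 !lerD2r.
  by rewrite ler_wpM2l ?mulr_ge0 ?(ltW L0)//; alra.
have lo : c * W1 - L * W2 - L * X * T <= integ t T (fun s => g s (y s) (u s) (v s)).
  apply: le_trans (_ : _ <= integ t T (fun s => c * w1 (u s) - L * w2 (v s) - L * X)) _.
    rewrite integB; [|by apply: intonB; exact: intonZ|exact: inton_cst].
    rewrite integB; [|exact: intonZ|exact: intonZ].
    rewrite integ_cst// !integZ// -/W1 -/W2 lerD2l lerN2.
    by rewrite ler_wpM2l ?mulr_ge0 ?(ltW L0)//; alra.
  apply: integ_le => //.
    by apply: intonB; [apply: intonB; exact: intonZ|exact: inton_cst].
  move=> s st; have [sT us vs] := adm_dom had st.
  apply: le_trans (run_lower (y s) sT us vs).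
  by have := ler_wpM2l (ltW L0) (B s st); alra.
have hb : `|h (y T)| <= 2 * L * X.
  apply: le_trans (term_bound G _) _; rewrite ler_wpM2l ?mulr_ge0 ?(ltW L0)//.
  by apply: B; rewrite tT lexx.
have LX : L * X * T + 2 * L * X <= c / 2 * C `^ mu * jap (y t) `^ mu + c / 2 * (W1 + W2).
  rewrite (_ : L * X * T + 2 * L * X = L * (T + 2) * th * r `^ mu); last by rewrite /X; ring.
  apply: le_trans (ler_wpM2r (powR_ge0 _ _) th2) _.
  rewrite -mulrA -mulrDr ler_wpM2l ?divr_ge0 ?(ltW c0)//.
have J0 : 0 <= jap (y t) `^ mu by exact: powR_ge0.
have h1 := mulr_ge0 (ltW L0) J0; have h2 := mulr_ge0 (ltW c0) J0.
have h3 := mulr_ge0 (ltW L0) W10; have h4 := mulr_ge0 (ltW c0) W10.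
have h5 := mulr_ge0 (ltW L0) W20; have h6 := mulr_ge0 (ltW c0) W20.
have Cm : 0 <= c / 2 * C `^ mu by rewrite mulr_ge0 ?powR_ge0// divr_ge0// ltW.
have h7 := mulr_ge0 Cm W10; have h8 := mulr_ge0 Cm W20.
move: hb; rewrite ler_norml => /andP[hb1 hb2].
by rewrite /cost; split; alra.
Qed.

End game_estimates.

(** * Truncation of strategies *)

Section game_truncation.
Context {R : realType} {n m1 m2 : nat} (G : game R n m1 m2).
Local Notation T := (horizon G).
Local Notation L := (gL G).
Local Notation c := (gc G).
Local Notation mu := (gmu G).
Local Notation f := (dyn G).
Local Notation g := (rcost G).
Local Notation h := (tcost G).
Local Notation U1 := (ctrl1 G).
Local Notation w1 := (wgt (grho1 G)).
Local Notation w2 := (wgt (grho2 G)).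
Local Notation kap := (kap G).
Implicit Types (t s : R) (x z : 'rV[R]_n) (y : R -> 'rV[R]_n).

Lemma cut_meas m' (U' : set 'rV[R]_m') t (w : R -> 'rV[R]_m') (rho B : R) (p q : R -> R) :
  is_control U' t T w -> measurable_fun `[t, T] p -> measurable_fun `[t, T] q ->
  measurable_fun `[t, T] (fun s => if wgt rho (w s) <= B then p s else q s).
Proof.
move=> cw mp mq; apply: measurable_fun_if => //.
- by apply: measurable_fun_ler; [exact: (control_meas rho cw)|exact: measurable_cst].
- by apply: (@measurable_funS _ _ _ _ `[t, T]) => // s [].
- by apply: (@measurable_funS _ _ _ _ `[t, T]) => // s [].
Qed.

Lemma cut_control m m' (U : set 'rV[R]_m) (U' : set 'rV[R]_m') t (u : R -> 'rV[R]_m)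
    (w : R -> 'rV[R]_m') (rho B : R) : U 0 -> is_control U t T u -> is_control U' t T w ->
  is_control U t T (fun s => if wgt rho (w s) <= B then u s else 0).
Proof.
move=> U0 [uU mu_] cw; split => [s st|i]; first by case: ifP => // _; exact: uU.
rewrite (_ : (fun s => _) = (fun s => if wgt rho (w s) <= B then u s 0 i else 0)); last first.
  by apply/funext => s; case: ifP => // _; rewrite mxE.
exact: (cut_meas rho B cw (mu_ i) (measurable_cst _)).
Qed.

Lemma cut_inton m' (U' : set 'rV[R]_m') t (w : R -> 'rV[R]_m') (rho B : R) (q : R -> R) :
  is_control U' t T w -> inton t T q ->
  inton t T (fun s => if wgt rho (w s) <= B then 0 else q s).
Proof.
move=> cw hq; apply: (@inton_le _ _ _ _ (fun s => `|q s|)); last exact: inton_norm.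
  by apply: (cut_meas rho B cw); [exact: measurable_cst|exact: inton_meas].
by move=> s _; case: ifP; rewrite ?normr0.
Qed.

Lemma powR0_le1 (a : R) : 0 <= a -> (0 : R) `^ a <= 1.
Proof.
move=> a0; have [->|an] := eqVneq a 0; first by rewrite powRr0.
by rewrite powR0.
Qed.

(** This and the next two statements carry the arithmetic of the truncation with the analytic terms
    replaced by variables. *)
Lemma arith_dyn (A E r rm j x1 x2 p1 p2 z1 z2 : R) :
  j <= A * E * r -> z1 <= 1 -> z2 <= 1 -> 1 <= E * r ->
  p1 <= E * (r + rm * x1) -> p2 <= E * (r + rm * x2) ->
  j + p1 + z2 + (j + z1 + p2) <= E * ((2 * A + 4) * r * 1 + rm * (x1 + x2)).
Proof. by move=> *; lra. Qed.

Lemma arith_cost (k l x1 x2 j1 j2 th B g1 g2 X : R) :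
  k * x1 - l * j1 <= g1 -> g2 <= l * j2 - k * x2 -> l * j1 <= l * (th * B) ->
  l * j2 <= l * (th * B) -> 0 <= X ->
  k * (x1 + x2) - 2 * l * th * B * 1 - X <= g1 - g2.
Proof. by move=> *; lra. Qed.

(** The final balance. [k * Q] is the coercive gain; the state on the exceptional set, the
    displacement in the running cost and the displacement in the terminal cost each lose a multiple
    of E * Q, and the bound by [k] says that the gain covers their sum. *)
Lemma arith_total (K S l A A2 E s P Rm Zm Rmu Q EE I1 I2 J1 J2 H1 H2 k : R) :
  0 <= K -> 0 <= S -> 0 <= l -> 0 <= A -> 0 <= A2 -> 0 <= E -> 0 <= s ->
  0 <= P -> 0 <= Rm -> Rm * P = Q -> EE * Rmu <= (S + 1) * Q ->
  E * (2 * l * (A + A2) * (S + 1) + (3 * S + 2 * (K + S) + l) * A2) <= k ->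
  I1 <= Zm * (S + (K + S)) -> I2 <= Zm * (S + (K + S)) ->
  - (l * Rm * (A2 * E * P)) <= H2 - H1 -> Zm <= Rm ->
  k * Q - 2 * l * ((A + A2) * E) * Rmu * EE - A2 * E * P * (Rm * (S - s) + (I1 + I2)) <=
    J2 - J1 ->
  J1 + H1 <= J2 + H2.
Proof.
move=> K0 S0 l0 A0 A20 E0 s0 P0 Rm0 hQ hE hM S1 S2 hT Zr main.
have Q0 : 0 <= Q by rewrite -hQ mulr_ge0.
have DP : 0 <= A2 * E * P by rewrite !mulr_ge0.
have SK : 0 <= S + (K + S) by rewrite !addr_ge0.
have x1 : 2 * l * ((A + A2) * E) * (EE * Rmu) <= 2 * l * ((A + A2) * E) * ((S + 1) * Q).
  by apply: ler_wpM2l => //; rewrite !mulr_ge0 ?addr_ge0.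
have x2 : A2 * E * P * I1 <= A2 * E * P * (Rm * (S + (K + S))).
  by apply: ler_wpM2l => //; apply: le_trans S1 _; exact: ler_wpM2r.
have x3 : A2 * E * P * I2 <= A2 * E * P * (Rm * (S + (K + S))).
  by apply: ler_wpM2l => //; apply: le_trans S2 _; exact: ler_wpM2r.
have x4 : A2 * E * P * (Rm * (S - s)) <= A2 * E * P * (Rm * S).
  by apply: ler_wpM2l => //; apply: ler_wpM2l => //; lra.
have x5 := ler_wpM2l Q0 hM.
have x6 (z : R) : A2 * E * P * (Rm * z) = A2 * E * Q * z by rewrite -hQ; ring.
have x7 : l * Rm * (A2 * E * P) = A2 * E * Q * l by rewrite -hQ; ring.
rewrite x6 in x2; rewrite x6 in x3; rewrite [A2 * E * P * (Rm * S)]x6 in x4; rewrite x7 in hT.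
lra.
Qed.

(** * Comparison of the pair ([pu], [v]) with the pair ([u], [v']) *)

Section truncation.
(** In units of eta, [A] bounds the state, [B1] the integrated velocity defect, [A2] the
    displacement and [M] the total loss of cost. [eta1] keeps both states below the scale r; [eta2]
    makes the loss at most the gain c * Q. *)
Variables (K A B1 A2 M C Z : R).
Hypotheses (K0 : 0 <= K) (A_def : A = Cgrow G * (1 + (K + T)))
  (B1_def : B1 = L * ((2 * A + 4) * (T + 1) + 1)) (A2_def : A2 = 2 * Cdist G * B1)
  (M_def : M = 2 * L * (A + A2) * (T + 1) + (3 * T + 2 * (K + T) + L) * A2)
  (C1 : 1 <= C).
Local Notation eta := (C `^ (kap - 1)).
Hypotheses (eta1 : (A + A2) * eta <= 1) (eta2 : eta * M <= c).
Variables (t : R) (u : R -> 'rV[R]_m1) (v : R -> 'rV[R]_m2) (y y' : R -> 'rV[R]_n).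
Local Notation lo s := (w1 (u s) <= Z `^ mu).
Local Notation pu := (fun s => if lo s then u s else 0).
Local Notation v' := (fun s => if lo s then v s else 0).
Hypotheses (had : adm G t u v) (had1 : adm G t pu v) (had2 : adm G t u v')
  (hy : traj G t pu v y) (hy' : traj G t u v' y') (yy' : y t = y' t)
  (CZ : C * jap (y t) <= Z) (W2 : integ t T (fun s => w2 (v s)) <= K * Z `^ mu).

(** The two pairs agree where [lo s] holds and are (0, v s) and (u s, 0) elsewhere. [e] is the
    indicator of that exceptional set, [q] the weight of both players on it. Since u has no a priori
    bound there, the scale r is raised until Q <= r ^ mu. [P] is Q converted to the units of the
    state, and [D] will bound the displacement. *)
Let e s : R := if lo s then 0 else 1.
Let q s : R := if lo s then 0 else w1 (u s) + w2 (v s).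
Let Q := integ t T q.
Let EE := integ t T e.
Let r := Num.max Z (Q `^ mu^-1).
Let P := r `^ (1 - mu) * Q.
Let D := A2 * eta * P.

Let tT : 0 <= t <= T. Proof. by case: had. Qed.
Let t_le : t <= T. Proof. by case/andP: tT. Qed.
Let T0 : 0 < T. Proof. exact: horizon_gt0. Qed.
Let L0 : 0 < L. Proof. exact: gL_gt0. Qed.
Let mu1 : 1 <= mu. Proof. exact: gmu_ge1. Qed.
Let mup : 0 < mu. Proof. exact: mu_gt0. Qed.
Let mum : 0 <= mu - 1. Proof. by rewrite subr_ge0. Qed.
Let eta0 : 0 < eta. Proof. exact: eta_gt0. Qed.
Let A1 : 1 <= A.
Proof.
rewrite A_def; have := Cgrow_ge1 G; have k := K0; have t0 := T0.
set X := Cgrow G => X1; rewrite -[leLHS]mulr1; apply: ler_pM => //; lra.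
Qed.
Let B1p : 0 <= B1.
Proof.
rewrite B1_def; have a := A1; have t0 := T0; apply: mulr_ge0; first exact: ltW.
by apply: addr_ge0 => //; apply: mulr_ge0; lra.
Qed.
Let A2p : 0 <= A2.
Proof. by rewrite A2_def; apply: mulr_ge0 => //; apply: mulr_ge0 => //; exact/ltW/Cdist_gt0. Qed.
Let C_le_Z : C <= Z.
Proof.
apply: le_trans CZ; rewrite ler_peMr ?jap_ge1//; exact: le_trans C1.
Qed.
Let Z_le_r : Z <= r. Proof. by rewrite /r le_max lexx. Qed.
Let Z0 : 0 < Z. Proof. by apply: lt_le_trans C_le_Z; exact: lt_le_trans C1. Qed.
Let r0 : 0 < r. Proof. exact: lt_le_trans Z_le_r. Qed.
Let q0 s : 0 <= q s.
Proof. by rewrite /q; case: ifP => // _; apply: addr_ge0; exact: wgt_ge0. Qed.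
Let Q0 : 0 <= Q. Proof. by apply: integ_ge0 => s _; exact: q0. Qed.
Let e0 s : 0 <= e s. Proof. by rewrite /e; case: ifP. Qed.
Let e1 s : e s <= 1. Proof. by rewrite /e; case: ifP. Qed.
Let cu : is_control U1 t T u. Proof. by case: had. Qed.
Let iq : inton t T q.
Proof. by apply: (cut_inton _ _ cu); apply: intonD; case: had. Qed.
Let ie : inton t T e.
Proof. by apply: (cut_inton _ _ cu); exact: inton_cst. Qed.
Let EE0 : 0 <= EE. Proof. by apply: integ_ge0. Qed.
Let EET : EE <= T.
Proof.
apply: le_trans (integ_le_cst t_le ie (fun s _ => e1 s)) _.
by rewrite mul1r; case/andP: tT => ? _; rewrite gerBl.
Qed.
(** Chebyshev: on the exceptional set the weight of u exceeds Z ^ mu. *)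
Let ZE : Z `^ mu * EE <= Q.
Proof.
rewrite -integZ//; apply: integ_le => //; first exact: intonZ.
move=> s _; rewrite /e /q; case: (leP (w1 (u s)) (Z `^ mu)) => [_|/ltW h]; first by rewrite mulr0.
by rewrite mulr1; apply: le_trans h _; rewrite lerDl wgt_ge0.
Qed.
Let P0 : 0 <= P. Proof. by apply: mulr_ge0 => //; exact: powR_ge0. Qed.
Let r_pow : r `^ (1 - mu) * r `^ mu = r.
Proof. by rewrite -powRD_pos// subrK powRr1// ltW. Qed.
Let Q_le : Q <= r `^ mu.
Proof.
apply: le_trans (_ : (Q `^ mu^-1) `^ mu <= _).
  by rewrite -powRrM mulVf ?gt_eqF// powRr1.
apply: powR_mono; [exact: ltW|exact: powR_ge0|].
by rewrite /r le_max lexx orbT.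
Qed.
(** If r = Z this is Chebyshev; otherwise r ^ mu = Q, and the exceptional set has measure at most
    T. *)
Let rE : EE * r `^ mu <= (T + 1) * Q.
Proof.
rewrite /r; case: (leP Z (Q `^ mu^-1)) => _; last first.
  rewrite mulrC; apply: le_trans ZE _; rewrite ler_peMl//.
  by rewrite lerDr ltW.
rewrite -powRrM mulVf ?gt_eqF// powRr1//; apply: ler_wpM2r => //.
by apply: le_trans EET _; rewrite lerDl.
Qed.
Let rEP : r * EE <= (T + 1) * P.
Proof.
rewrite -{1}r_pow -mulrA /P [leRHS]mulrCA; apply: ler_wpM2l; first exact: powR_ge0.
by rewrite mulrC.
Qed.
Let P_le_r : P <= r.
Proof. by rewrite -[leRHS]r_pow /P; apply: ler_wpM2l => //; exact: powR_ge0. Qed.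
Let rPQ : r `^ (mu - 1) * P = Q.
Proof.
rewrite /P mulrA -powRD_pos//.
by rewrite (_ : mu - 1 + (1 - mu) = 0) ?powRr0 ?mul1r//; ring.
Qed.
Let D0 : 0 <= D.
Proof. by apply: mulr_ge0 => //; apply: mulr_ge0 => //; exact: ltW. Qed.
Let D_le : D <= A2 * eta * r.
Proof. by apply: ler_wpM2l => //; apply: mulr_ge0 => //; exact: ltW. Qed.

Let W1pu : integ t T (fun s => w1 (pu s)) <= (K + T) * Z `^ mu.
Proof.
have ip : inton t T (fun s => w1 (pu s)) by case: had1.
apply: le_trans (@integ_le_cst _ _ _ _ (Z `^ mu) t_le ip _) _.
  by move=> s _; case: ifP => // _; rewrite wgt0 ?grho1_gt0// powR_ge0.
rewrite mulrC; apply: ler_wpM2r; first exact: powR_ge0.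
have := T0; have := K0; case/andP: tT => *; lra.
Qed.

Let W2v : integ t T (fun s => w2 (v s)) <= (K + T) * Z `^ mu.
Proof.
apply: le_trans W2 _; apply: ler_wpM2r; first exact: powR_ge0.
by rewrite lerDl ltW.
Qed.

Let jy s : t <= s <= T -> jap (y s) <= A * eta * r.
Proof.
move=> st.
have KT : 0 <= K + T by apply: addr_ge0 => //; exact: ltW.
have := traj_growth had1 hy C1 KT CZ W1pu W2v st.
rewrite -A_def => /le_trans; apply; rewrite -mulrA ler_wpM2l//; first exact: le_trans A1.
by rewrite ler_wpM2l// ltW.
Qed.

(** Envelope of the velocity defect. It vanishes where the pairs agree; elsewhere each velocity is
    bounded separately, the states and constants giving the first term and the control weights the
    second. *)
Let b s := L * eta * ((2 * A + 4) * r * e s + r `^ (1 - mu) * q s).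

Let ib : inton t T b.
Proof. by apply: intonZ; apply: intonD; exact: intonZ. Qed.

Let b0 s : 0 <= b s.
Proof.
apply: mulr_ge0; first by apply: mulr_ge0; exact: ltW.
apply: addr_ge0; apply: mulr_ge0 => //; last exact: powR_ge0.
by apply: mulr_ge0; [have := A1; lra|exact: ltW].
Qed.

Let b_int : integ t T b <= B1 * eta * P.
Proof.
rewrite integZ; last by apply: intonD; exact: intonZ.
rewrite integD; [|exact: intonZ|exact: intonZ].
rewrite !integZ// -/EE -/Q -/P B1_def.
have h : (2 * A + 4) * (r * EE) <= (2 * A + 4) * ((T + 1) * P).
  by apply: ler_wpM2l => //; have := A1; lra.
rewrite (_ : L * _ * eta * P = L * eta * ((2 * A + 4) * ((T + 1) * P) + P)); last by ring.
apply: ler_wpM2l; first by apply: mulr_ge0; exact: ltW.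
by rewrite -mulrA lerD2r.
Qed.

Let b_bound s : t <= s <= T ->
  enorm (f s (y s) (u s) (v' s) - f s (y s) (pu s) (v s)) <= b s.
Proof.
move=> st; have [sT us vs] := adm_dom had st.
have jys := jy st.
have C_r : C <= r := le_trans C_le_Z Z_le_r.
have [_ U10] := ctrl1P G; have [_ U20] := ctrl2P G.
have := b0 s; rewrite /b /e /q; case: ifP => _ bs; first by rewrite subrr enorm0.
apply: le_trans (ler_enormB _ _) _.
have h1 := dyn_growth (y s) sT us U20.
have h2 := dyn_growth (y s) sT U10 vs.
rewrite !wgt0 ?grho1_gt0 ?grho2_gt0// in h1 h2.
have z1 := powR0_le1 (a1_ge0 G); have z2 := powR0_le1 (a2_ge0 G).
have kl := ltW (kap_lt1 G).
have p1 := powR_le_scaled (wgt_ge0 (grho1 G) (u s)) C1 C_r mu1 (a1_ge0 G) (a1_kap G) kl.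
have p2 := powR_le_scaled (wgt_ge0 (grho2 G) (v s)) C1 C_r mu1 (a2_ge0 G) (a2_kap G) kl.
have one := powR_scale G C1 C_r.
apply: le_trans (lerD h1 h2) _; rewrite -mulrDr -mulrA; apply: ler_wpM2l; first exact: ltW.
exact: (arith_dyn jys z1 z2 one p1 p2).
Qed.

Let dist s : t <= s <= T -> enorm (y' s - y s) <= D.
Proof.
move=> st; have := traj_compare had1 had2 hy hy' ib (fun s _ => b0 s) b_bound st.
rewrite yy' subrr enorm0 add0r => /le_trans; apply.
rewrite /D A2_def.
rewrite (_ : _ * B1 * eta * P = Cdist G * (2 * (B1 * eta * P))); last by ring.
by apply: ler_wpM2l; [exact/ltW/Cdist_gt0|apply: ler_wpM2l].
Qed.

Let th := (A + A2) * eta.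
Let th0 : 0 <= th.
Proof. by apply: mulr_ge0; [have := A1; have := A2p; lra|exact: ltW]. Qed.

Let jy_th s : t <= s <= T -> jap (y s) <= th * r.
Proof.
move=> /jy /le_trans; apply; apply: ler_wpM2r; first exact: ltW.
by apply: ler_wpM2r; [exact: ltW|rewrite lerDl].
Qed.

Let jy'_th s : t <= s <= T -> jap (y' s) <= th * r.
Proof.
move=> st; apply: le_trans (jap_le_shift _ (y s)) _.
rewrite /th !mulrDl; apply: lerD; first exact: jy.
exact: le_trans (dist st) D_le.
Qed.

Let th_pow (j : R) : 0 <= j -> j <= th * r -> j `^ mu <= th * r `^ mu.
Proof.
move=> j0 jr; apply: le_trans (_ : (th * r) `^ mu <= _).
  by apply: powR_mono => //; exact: ltW.
rewrite powRM//; last exact: ltW.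
apply: ler_wpM2r; first exact: powR_ge0.
have [->|thn] := eqVneq th 0; first by rewrite powR0// gt_eqF.
rewrite powR_split ?lt_def ?thn//; apply: ler_piMr => //.
by have := powR_mono mum th0 eta1; rewrite powR1.
Qed.

Let jm_pow s : t <= s <= T -> japmax (y' s) (y s) `^ (mu - 1) <= r `^ (mu - 1).
Proof.
move=> st; have thr : th * r <= r by rewrite ler_piMl// ltW.
apply: powR_mono => //; first exact: le_trans (japmax_ge1 _ _).
by apply: japmax_le; [exact: le_trans (jy'_th st) thr|exact: le_trans (jy_th st) thr].
Qed.

Let d := (mu - 1) / mu.

(** On the exceptional set (u, 0) costs at least c * w1 u and (0, v) at most - c * w2 v, up to the
    states, so the difference gains c * q without any comparison of states. Elsewhere the controls
    agree and only the displacement [D] is lost. *)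
Let pointwise s : t <= s <= T ->
  c * q s - 2 * L * th * r `^ mu * e s
    - D * (r `^ (mu - 1) + (w1 (pu s) `^ d + w2 (v s) `^ d)) <=
  g s (y' s) (u s) (v' s) - g s (y s) (pu s) (v s).
Proof.
move=> st; have [sT us vs] := adm_dom had st.
have [_ U10] := ctrl1P G; have [_ U20] := ctrl2P G.
have jm := jm_pow st.
have t1 := th_pow (ltW (jap_gt0 _)) (jy_th st).
have t2 := th_pow (ltW (jap_gt0 _)) (jy'_th st).
have ds := dist st.
have rest : 0 <= D * (r `^ (mu - 1) + (w1 (pu s) `^ d + w2 (v s) `^ d)).
  by apply: mulr_ge0 => //; do ! apply: addr_ge0; exact: powR_ge0.
move: rest; rewrite /q /e; case: ifP => _ rest.
  have := run_lipschitz (y' s) (y s) sT us vs; rewrite -/d.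
  rewrite ler_norml => /andP[h _]; rewrite !mulr0 subrr sub0r.
  apply: le_trans h; rewrite lerN2 [leRHS]mulrC; apply: ler_pM => //.
  - by do ! apply: addr_ge0; exact: powR_ge0.
  - exact: enorm_ge0.
  - by rewrite -addrA lerD2r.
have h1 := run_lower (y' s) sT us U20.
have h2 := run_upper (y s) sT U10 vs.
rewrite (wgt0 _ (grho2_gt0 G)) addr0 in h1.
rewrite (wgt0 _ (grho1_gt0 G)) addr0 in h2.
have k1 := ler_wpM2l (ltW L0) t2.
have k2 := ler_wpM2l (ltW L0) t1.
exact: (arith_cost h1 h2 k1 k2 rest).
Qed.

Lemma truncation_improves_aux : cost G t pu v y <= cost G t u v' y'.
Proof.
have i1 := run_inton had1 hy; have i2 := run_inton had2 hy'.
have dp : 0 <= d by rewrite divr_ge0// ltW.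
have dp1 : d <= 1 by rewrite ler_pdivrMr// mul1r lerBlDr lerDl.
have [_ cpu cv ipu iv] := had1.
have j1 := inton_wgt_pow cpu ipu dp dp1.
have j2 := inton_wgt_pow cv iv dp dp1.
have S1 := integ_dual_le tT cpu ipu Z0 W1pu.
have S2 := integ_dual_le tT cv iv Z0 W2v.
have Zr : Z `^ (mu - 1) <= r `^ (mu - 1) by apply: powR_mono => //; exact: ltW.
have j12 := intonD j1 j2.
have j3 := intonD (inton_cst t T (r `^ (mu - 1))) j12.
have iqe := intonB (intonZ c iq) (intonZ (2 * L * th * r `^ mu) ie).
have main := integ_le (intonB iqe (intonZ D j3)) (intonB i2 i1) pointwise.
have TT : t <= T <= T by rewrite t_le lexx.
have hT : - (L * r `^ (mu - 1) * D) <= h (y' T) - h (y T).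
  have := term_lipschitz G (y' T) (y T); rewrite ler_norml => /andP[+ _].
  apply: le_trans; rewrite lerN2; apply: ler_pM => //.
  - by apply: mulr_ge0; [exact: ltW|exact: powR_ge0].
  - exact: enorm_ge0.
  - by apply: ler_wpM2l; [exact: ltW|exact: jm_pow].
  - exact: dist.
move: main; rewrite integB//; last exact: intonZ.
rewrite (@integB _ _ _ (fun s => c * q s)); [|exact: intonZ|exact: intonZ].
rewrite (integZ D j3) integD//; last exact: inton_cst.
rewrite integ_cst// (integD j1 j2) integZ// integZ// integB// -/Q -/EE.
rewrite /cost; move: S1 S2 hT Zr; rewrite -/d.
generalize (integ t T (fun s => w1 (if lo s then u s else 0) `^ d)) => I1.
generalize (integ t T (fun s => w2 (v s) `^ d)) => I2.
generalize (integ t T (fun s => g s (y' s) (u s) (if lo s then v s else 0))) => J2.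
generalize (integ t T (fun s => g s (y s) (if lo s then u s else 0) (v s))) => J1.
generalize (h (y' T)) (h (y T)) => H2 H1.
have Rm : 0 <= r `^ (mu - 1) by exact: powR_ge0.
rewrite /D /th; move=> S1 S2 hT Zr main.
have eta2' := eta2; rewrite M_def in eta2'; have [tt0 _] := andP tT.
exact: (arith_total K0 (ltW T0) (ltW L0) (le_trans ler01 A1) A2p (ltW eta0) tt0
  P0 Rm rPQ rE eta2' S1 S2 hT Zr main).
Qed.

End truncation.

(* Replacing large values of u by 0 in the argument of the reply, and the reply by 0
   at those instants, cannot decrease the cost: the coercive gain on
   {w1 (u s) > Z `^ mu} dominates the perturbation of the state once Z is a large
   multiple of <x>. *)
Lemma truncation_improves (K : R) : 0 <= K -> exists2 C : R, 1 <= C &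
  forall t u (v : R -> 'rV[R]_m2) y y' (Z : R),
    let pu := fun s => if w1 (u s) <= Z `^ mu then u s else 0 in
    let v' := fun s => if w1 (u s) <= Z `^ mu then v s else 0 in
    adm G t u v -> adm G t pu v -> adm G t u v' ->
    traj G t pu v y -> traj G t u v' y' -> y t = y' t -> C * jap (y t) <= Z ->
    integ t T (fun s => w2 (v s)) <= K * Z `^ mu ->
    cost G t pu v y <= cost G t u v' y'.
Proof.
move=> K0.
pose A := Cgrow G * (1 + (K + T)).
pose B1 := L * ((2 * A + 4) * (T + 1) + 1).
pose A2 := 2 * Cdist G * B1.
pose M := 2 * L * (A + A2) * (T + 1) + (3 * T + 2 * (K + T) + L) * A2.
have T0 := horizon_gt0 G; have L0 := gL_gt0 G; have c0 := gc_gt0 G.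
have A0 : 0 < A.
  by apply: mulr_gt0; [exact: lt_le_trans (Cgrow_ge1 G)|rewrite ltr_wpDr// addr_ge0// ltW].
have B10 : 0 <= B1.
  by apply: mulr_ge0; [exact: ltW|apply: addr_ge0 => //; apply: mulr_ge0; lra].
have A20 : 0 <= A2.
  by apply: mulr_ge0 => //; apply: mulr_ge0 => //; exact/ltW/Cdist_gt0.
have M0 : 0 <= M.
  apply: addr_ge0; first by do 2 (apply: mulr_ge0; last lra); lra.
  by apply: mulr_ge0 => //; lra.
have AA : 0 < A + A2 by rewrite ltr_wpDr.
have M1 : 0 < M + 1 by rewrite ltr_wpDl.
(* The two requirements on eta; M + 1 replaces M so that the quotient is defined and positive. *)
have emin : 0 < Num.min (A + A2)^-1 (c / (M + 1)).
  by rewrite lt_min invr_gt0 AA divr_gt0.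
have [C C1] := eta_small G emin; rewrite le_min => /andP[E1 E2].
exists C => // t u v y y' Z pu v' had had1 had2 hy hy' yy' CZ W2.
apply: (@truncation_improves_aux K A B1 A2 M C Z) => //.
- by rewrite mulrC -ler_pdivlMr// mul1r.
- apply: le_trans (_ : C `^ (kap - 1) * (M + 1) <= c); last by rewrite -ler_pdivlMr.
  by rewrite ler_wpM2l ?powR_ge0// lerDl.
Qed.

End game_truncation.

(** * Regularity of the upper value *)

Section game_values.
Context {R : realType} {n m1 m2 : nat} (G : game R n m1 m2).
Local Notation T := (horizon G).
Local Notation c := (gc G).
Local Notation mu := (gmu G).
Local Notation f := (dyn G).
Local Notation g := (rcost G).
Local Notation h := (tcost G).
Local Notation U1 := (ctrl1 G).
Local Notation U2 := (ctrl2 G).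
Local Notation w1 := (wgt (grho1 G)).
Local Notation w2 := (wgt (grho2 G)).
Local Notation kap := (kap G).
Implicit Types (t s : R) (x z : 'rV[R]_n) (y : R -> 'rV[R]_n).

Local Notation V := (upper_value T U1 U2 f g h).
Local Notation J := (payoff T f g h).
Local Notation W1 t u := (integ t T (fun s => w1 (u s))).
Local Notation W2 t v := (integ t T (fun s => w2 (v s))).

Lemma zero_Loo m (U : set 'rV[R]_m) t : U 0 -> controls_Loo U t T (fun=> 0).
Proof.
move=> U0; split; first split => [//|i]; first exact: measurable_cst.
by exists 0; apply: (@ae_mono _ (fun=> True)) => [s _ _|]; [rewrite enorm0|exact: aeW].
Qed.

Lemma enorm_meas m (U : set 'rV[R]_m) t u : is_control U t T u ->
  measurable_fun `[t, T] (fun s => enorm (u s)).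
Proof.
move=> cu; have := @control_meas _ _ _ _ G m U t u 1 cu.
by apply: eq_measurable_fun => s _; rewrite /wgt powRr1// enorm_ge0.
Qed.

Lemma L1_control_integrable m (U : set 'rV[R]_m) t u :
  controls_L1 U t T u <-> is_control U t T u /\ inton t T (fun s => enorm (u s)).
Proof.
split=> -[cu hu]; split => //.
- apply/integrableP; split; first by apply/measurable_EFinP; exact: enorm_meas cu.
  by move: hu; under [X in (X < _)%E -> _]eq_integral do
    rewrite -[X in X%:E]ger0_norm ?enorm_ge0// -abse_EFin.
- case/integrableP: hu => _.
  by under eq_integral do rewrite /= ger0_norm ?enorm_ge0//.
Qed.

Lemma Loo_L1 m (U : set 'rV[R]_m) t u : U 0 -> controls_Loo U t T u -> controls_L1 U t T u.
Proof.
move=> U0 hu; apply/L1_control_integrable; split; first exact: (proj1 hu).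
apply: inton_eq (Loo_wgt (G := G) U0 ler01 hu) => s _.
by rewrite /wgt powRr1// enorm_ge0.
Qed.

Lemma L1_dominated m (U : set 'rV[R]_m) t u u' : controls_L1 U t T u ->
  is_control U t T u' -> (forall s, enorm (u' s) <= enorm (u s)) -> controls_L1 U t T u'.
Proof.
move=> /L1_control_integrable[cu hu] cu' h; apply/L1_control_integrable; split => //.
apply: inton_le hu; first exact: enorm_meas cu'.
by move=> s _; rewrite ger0_norm ?enorm_ge0.
Qed.

Lemma Loo_dominated m (U : set 'rV[R]_m) t u u' : controls_Loo U t T u ->
  is_control U t T u' -> (forall s, enorm (u' s) <= enorm (u s)) -> controls_Loo U t T u'.
Proof.
move=> [cu [M hM]] cu' h; split => //; exists M.
by apply: ae_mono hM => s hs st; apply: le_trans (h s) (hs st).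
Qed.

(** The test is on [w], the cut on [u]: with both equal it truncates a control, with [w] the
    opponent's control it truncates the reply. *)
Definition cut m m' (rho B : R) (w : R -> 'rV[R]_m') (u : R -> 'rV[R]_m) : R -> 'rV[R]_m :=
  fun s => if wgt rho (w s) <= B then u s else 0.

Lemma cut_enorm m m' (rho B : R) (w : R -> 'rV[R]_m') (u : R -> 'rV[R]_m) s :
  enorm (cut rho B w u s) <= enorm (u s).
Proof. by rewrite /cut; case: ifP => // _; rewrite enorm0 enorm_ge0. Qed.

Lemma zero_strategy t : strategies U1 U2 t T (fun _ => fun=> 0).
Proof.
have [_ U20] := ctrl2P G; split => [w _|w w' th _ _ _ _]; first exact: zero_Loo.
by apply: aeW => s.
Qed.

Lemma strategy_Loo t a u : strategies U1 U2 t T a -> controls_Loo U1 t T u ->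
  controls_Loo U2 t T (a u).
Proof.
have [_ U10] := ctrl1P G.
by move=> [ha _] hu; apply: ha; exact: Loo_L1.
Qed.

Lemma payoff_traj t x u v : 0 <= t <= T -> controls_Loo U1 t T u -> controls_Loo U2 t T v ->
  exists y, [/\ adm G t u v, traj G t u v y, y t = x & J t x u v = cost G t u v y].
Proof.
move=> tT hu hv; exists (trajectory T f t x u v).
have [_ t_le] := andP tT.
have [h1 h2] := trajectory_path t_le (trajectoryP x tT hu hv).
by split => //; [exact: Loo_adm|exact: payoffE].
Qed.

Lemma W_zero m (rho : R) t : 0 < rho -> t <= T ->
  integ t T (fun=> wgt rho (0 : 'rV[R]_m)) = 0.
Proof. by move=> r0 tT; rewrite integ_cst// wgt0// mul0r. Qed.

Lemma payoff_bounds : exists2 C : R, 0 < C & forall t x u v, 0 <= t <= T ->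
  controls_Loo U1 t T u -> controls_Loo U2 t T v ->
  J t x u v <= C * jap x `^ mu + C * W1 t u - c / 2 * W2 t v /\
  c / 2 * W1 t u - C * jap x `^ mu - C * W2 t v <= J t x u v.
Proof.
have [C C0 hC] := cost_bounds G; exists C => // t x u v tT hu hv.
by have [y [had hy <- ->]] := payoff_traj x tT hu hv; exact: hC.
Qed.

Lemma W_ge0 m (rho : R) t (u : R -> 'rV[R]_m) : 0 <= integ t T (fun s => wgt rho (u s)).
Proof. by apply: integ_ge0 => s _; exact: wgt_ge0. Qed.

(** The zero control against any strategy bounds the value above, the zero strategy against any
    control bounds it below; the weight of the player who is not zero has the favourable sign. *)
Lemma value_bounds : exists2 C : R, 0 < C & forall t x, 0 <= t <= T ->
  V t x \is a fin_num /\ `|fine (V t x)| <= C * jap x `^ mu.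
Proof.
have [C C0 hC] := payoff_bounds; exists C => // t x tT.
have [_ U10] := ctrl1P G; have [_ U20] := ctrl2P G; have [_ t_le] := andP tT.
have c0 := gc_gt0 G.
have up : (V t x <= (C * jap x `^ mu)%:E)%E.
  apply: ge_ereal_sup => _ [a ha <-].
  have h0 := zero_Loo t U10.
  apply: le_trans (ereal_inf_lbound _) _; first by exists (fun=> 0).
  rewrite lee_fin; have [+ _] := hC t x _ _ tT h0 (strategy_Loo ha h0).
  move=> /le_trans; apply; rewrite (W_zero _ (grho1_gt0 G) t_le) mulr0 addr0 gerBl.
  by rewrite mulr_ge0 ?W_ge0// divr_ge0// ltW.
have lo : ((- (C * jap x `^ mu))%:E <= V t x)%E.
  apply: le_trans (ereal_sup_ubound _); last by exists (fun _ => fun=> 0) => //; exact: zero_strategy.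
  apply: le_ereal_inf_tmp => _ [u hu <-]; rewrite lee_fin.
  have [_ +] := hC t x _ _ tT hu (zero_Loo t U20).
  apply: le_trans; rewrite (W_zero _ (grho2_gt0 G) t_le) mulr0 subr0 lerBrDr addNr.
  by rewrite mulr_ge0 ?W_ge0// divr_ge0// ltW.
move: up lo; case: (V t x) => [r| |]//=.
rewrite !lee_fin => up lo; split => //.
by rewrite ler_norml lo up.
Qed.

Lemma near_sup t x (e : R) : 0 <= t <= T -> 0 < e ->
  exists2 a, strategies U1 U2 t T a &
  forall u, controls_Loo U1 t T u -> fine (V t x) - e <= J t x u (a u).
Proof.
move=> tT e0; have [C _ /(_ t x tT)[fV _]] := value_bounds.
have [_ [a ha <-] h] := ub_ereal_sup_adherent e0 fV.
exists a => // u hu; rewrite -lee_fin EFinB fineK//; apply: le_trans (ltW h) _.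
by apply: ereal_inf_lbound; exists u.
Qed.

Lemma near_inf t x a (e : R) : 0 <= t <= T -> 0 < e -> strategies U1 U2 t T a ->
  exists2 u, controls_Loo U1 t T u & J t x u (a u) <= fine (V t x) + e.
Proof.
move=> tT e0 ha; have [C _ /(_ t x tT)[fV _]] := value_bounds.
have : (ereal_inf [set (J t x u (a u))%:E | u in controls_Loo U1 t T] <
    (fine (V t x) + e)%:E)%E.
  apply: le_lt_trans (_ : V t x < _)%E; last by rewrite EFinD fineK// lteDl// lte_fin.
  by apply: ereal_sup_ubound; exists a.
move=> /ereal_inf_lt[_ [u hu <-]]; rewrite lte_fin => /ltW h.
by exists u.
Qed.

Lemma near_optimal : exists2 K : R, 0 < K & forall t x (e : R), 0 <= t <= T -> 0 < e -> e <= 1 ->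
  exists a, [/\ strategies U1 U2 t T a,
    forall u, controls_Loo U1 t T u -> W2 t (a u) <= K * jap x `^ mu &
    forall u, controls_Loo U1 t T u -> fine (V t x) - e <= J t x u (a u)].
Proof.
have [C C0 hC] := payoff_bounds; have [C' C'0 hC'] := value_bounds.
have T0 := horizon_gt0 G; have c0 := gc_gt0 G; have mup := mu_gt0 G.
have [_ U10] := ctrl1P G; have [_ U20] := ctrl2P G.
(* Solving the upper payoff bound for W2 of the reply to a truncated control: C for the state, C'
   and 1 for the payoff being at least the value minus e, C * T for W1, which is at most T * B after
   truncation. *)
pose K2 := 2 / c * (C + C' + 1 + C * T).
have S0 : 0 < C + C' + 1 + C * T by have := mulr_gt0 C0 T0; lra.
have K20 : 0 < K2 by rewrite mulr_gt0// divr_gt0.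
(* [C1] depends on [K2] but not conversely: replies are measured against [B], which already contains
   [C1]. *)
have [C1 C11 trunc] := truncation_improves G (ltW K20).
have C10 : 0 < C1 by lra.
exists (K2 * C1 `^ mu); first by rewrite mulr_gt0// powR_gt0.
move=> t x e tT e0 e1; have [t0 t_le] := andP tT.
have [a ha hopt] := near_sup x tT e0.
pose Z := C1 * jap x; pose B := Z `^ mu.
have j1 := jap_ge1 x; have j0 := jap_gt0 x.
have jZ : jap x <= Z by rewrite /Z ler_peMl// ltW.
have Jp1 : 1 <= jap x `^ mu by apply: powR_ge1 => //; exact: ltW.
have JB : jap x `^ mu <= B by apply: powR_mono => //; exact: ltW.
have BE : B = C1 `^ mu * jap x `^ mu by rewrite /B /Z powRM// ltW.
pose p (u : R -> 'rV[R]_m1) := cut (grho1 G) B u u.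
have pc u : is_control U1 t T u -> is_control U1 t T (p u).
  by move=> cu; exact: (cut_control (grho1 G) B U10 cu cu).
have pLoo u : controls_Loo U1 t T u -> controls_Loo U1 t T (p u).
  by move=> hu; apply: (Loo_dominated hu (pc _ (proj1 hu))) => s; exact: cut_enorm.
have pL1 u : controls_L1 U1 t T u -> controls_L1 U1 t T (p u).
  by move=> hu; apply: (L1_dominated hu (pc _ (proj1 hu))) => s; exact: cut_enorm.
pose a' (u : R -> 'rV[R]_m1) := cut (grho1 G) B u (a (p u)).
have a'Loo u : controls_L1 U1 t T u -> controls_Loo U2 t T (a' u).
  move=> hu; have hap := proj1 ha _ (pL1 u hu).
  apply: (Loo_dominated hap); last by move=> s; exact: cut_enorm.
  exact: (cut_control (grho1 G) B U20 (proj1 hap) (proj1 hu)).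
have W2p u : controls_Loo U1 t T u -> W2 t (a (p u)) <= K2 * B.
  move=> hu; have hp := pLoo u hu; have hap := strategy_Loo ha hp.
  have [+ _] := hC t x _ _ tT hp hap.
  have := hopt _ hp; have [_ +] := hC' t x tT; rewrite ler_norml => /andP[v1 _].
  have W1p : W1 t (p u) <= T * B.
    have [_ _ _ ip _] := Loo_adm tT hp hap.
    apply: le_trans (@integ_le_cst _ _ _ _ B t_le ip _) _.
      move=> s _; rewrite /p /cut; have [h|_] := boolP (w1 (u s) <= B); first exact: h.
      by rewrite (wgt0 _ (grho1_gt0 G)); exact: powR_ge0.
    by rewrite mulrC ler_wpM2r ?powR_ge0//; lra.
  move: W1p v1; generalize (W1 t (p u)) (W2 t (a (p u))) (J t x (p u) (a (p u))) (fine (V t x)).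
  move=> w w' j v W1p v1 h1 h2.
  have h3 := ler_wpM2l (ltW C0) W1p.
  have h4 := ler_wpM2l (ltW C0) JB; have h5 := ler_wpM2l (ltW C'0) JB.
  rewrite (_ : w' = 2 / c * (c / 2 * w')); last by field; rewrite gt_eqF.
  rewrite /K2 -[leRHS]mulrA; apply: ler_wpM2l; first by rewrite divr_ge0// ltW.
  move: Jp1 JB h1 h2 h3 h4 h5 v1 e1; generalize (jap x `^ mu) B => q b *; lra.
exists a'; split.
- split; first exact: a'Loo.
  move=> w w' th hw hw' tth ww'.
  have [_ na] := ha.
  (* Cuts are made instant by instant, so controls that agree up to [th] have cuts that agree up to
     [th]. *)
  have pp : {ae @lebesgue_measure R, forall s, t <= s <= th -> p w s = p w' s}.
    by apply: ae_mono ww' => s h st; rewrite /p /cut h.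
  have := na _ _ th (pL1 _ hw) (pL1 _ hw') tth pp => aa.
  by apply: ae_mono (ae_and ww' aa) => s [h1 h2] st; rewrite /a' /cut h1// h2.
- move=> u hu; apply: le_trans (_ : K2 * B <= _); last by rewrite BE mulrA.
  apply: le_trans (W2p u hu).
  have hp := pLoo u hu; have [_ _ _ _ i2] := Loo_adm tT hp (strategy_Loo ha hp).
  have [_ _ _ _ i2'] := Loo_adm tT hu (a'Loo _ (Loo_L1 U10 hu)).
  apply: (integ_le i2' i2) => s _; apply: powR_mono; last exact: cut_enorm.
    exact: ltW (grho2_gt0 G).
  exact: enorm_ge0.
- move=> u hu; have hp := pLoo u hu; have hap := strategy_Loo ha hp.
  have ha'u := a'Loo _ (Loo_L1 U10 hu).
  (* The original strategy is near-optimal against [p u], and passing from the pair (p u, a (p u))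
     to (u, a' u) does not decrease the payoff. *)
  apply: le_trans (hopt _ hp) _.
  have [y [had hy yt ->]] := payoff_traj x tT hp hap.
  have [y' [had' hy' yt' ->]] := payoff_traj x tT hu ha'u.
  apply: (trunc t u (a (p u)) y y' Z _ had had' hy hy').
  + have [_ _ _ i1 _] := had'; have [_ _ cv _ i2] := had.
    by split; [exact: tT|exact: (proj1 hu)|exact: cv|exact: i1|exact: i2].
  + by rewrite yt yt'.
  + by rewrite yt.
  + exact: W2p.
Qed.

(** The scale Z is kept apart from <x> because the strategy may be near-optimal for a different
    initial state. *)
Lemma near_minimal (K : R) : 0 <= K -> exists2 K' : R, 0 < K' &
  forall t x a (Z e : R), 0 <= t <= T -> 0 < e -> e <= 1 -> jap x <= Z ->
    strategies U1 U2 t T a ->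
    (forall u, controls_Loo U1 t T u -> W2 t (a u) <= K * Z `^ mu) ->
  exists u, [/\ controls_Loo U1 t T u, J t x u (a u) <= fine (V t x) + e &
    W1 t u <= K' * Z `^ mu].
Proof.
move=> K0; have [C C0 hC] := payoff_bounds; have [C' C'0 hC'] := value_bounds.
have c0 := gc_gt0 G; have mup := mu_gt0 G.
have S0 : 0 < C' + 1 + C + C * K by have := mulr_ge0 (ltW C0) K0; lra.
exists (2 / c * (C' + 1 + C + C * K)); first by rewrite mulr_gt0// divr_gt0.
move=> t x a Z e tT e0 e1 jZ ha hW.
have [u hu hJ] := near_inf x tT e0 ha; exists u; split => //.
have hau := strategy_Loo ha hu.
have [_ +] := hC t x _ _ tT hu hau; have := hW u hu.
have [_ +] := hC' t x tT; rewrite ler_norml => /andP[_ v1].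
have j1 := jap_ge1 x; have j0 := jap_gt0 x.
have Jp1 : 1 <= jap x `^ mu by apply: powR_ge1 => //; exact: ltW.
have JB : jap x `^ mu <= Z `^ mu by apply: powR_mono => //; exact: ltW.
move: v1 hJ; generalize (W1 t u) (W2 t (a u)) (J t x u (a u)) (fine (V t x)).
move=> w w' j v v1 hJ h1 h2.
have h3 := ler_wpM2l (ltW C0) h1.
have h4 := ler_wpM2l (ltW C0) JB; have h5 := ler_wpM2l (ltW C'0) JB.
rewrite (_ : w = 2 / c * (c / 2 * w)); last by field; rewrite gt_eqF.
rewrite -[leRHS]mulrA; apply: ler_wpM2l; first by rewrite divr_ge0// ltW.
move: Jp1 JB h1 h2 h3 h4 h5 v1 e1 hJ; generalize (jap x `^ mu) (Z `^ mu) => q b *; lra.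
Qed.

(** The strategy is near-optimal at one point, its almost minimizing answer is taken at the other;
    the same pair of controls then runs from both points, with weights bounded at the common scale
    [japmax]. *)
Lemma value_lipschitz : exists2 C : R, 0 < C & forall t x z, 0 <= t <= T ->
  `|fine (V t x) - fine (V t z)| <= C * japmax x z `^ (mu - 1) * enorm (x - z).
Proof.
have [K K0 hopt] := near_optimal; have [K' K'0 hmin] := near_minimal (ltW K0).
have KK0 : 0 <= K + K' by lra.
have [C C0 hC] := cost_lipschitz G KK0; have mup := mu_gt0 G.
exists C => // t x z tT.
have one x' z' : fine (V t x') - fine (V t z') <= C * japmax x' z' `^ (mu - 1) * enorm (x' - z').
  set D := C * _ * _; apply/ler_addgt0Pr => e e0.
  (* Halved because the strategy and the control each lose [e'], capped at 1 as both choices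
     require. *)
  pose e' := Num.min (e / 2) 1.
  have e'0 : 0 < e' by rewrite /e' lt_min ltr01 andbT divr_gt0.
  have e'1 : e' <= 1 by rewrite ge_min lexx orbT.
  have e'e : e' <= e / 2 by rewrite ge_min lexx.
  pose Z := japmax x' z'.
  have xZ : jap x' <= Z by rewrite le_max lexx.
  have zZ : jap z' <= Z by rewrite le_max lexx orbT.
  have JB : jap x' `^ mu <= Z `^ mu by apply: powR_mono => //; [exact: ltW|exact/ltW/jap_gt0].
  have Zp : 0 <= Z `^ mu by exact: powR_ge0.
  have [a [ha aW aJ]] := hopt t x' e' tT e'0 e'1.
  have aW' u : controls_Loo U1 t T u -> W2 t (a u) <= K * Z `^ mu.
    by move=> /aW /le_trans; apply; rewrite ler_wpM2l// ltW.
  have [u [hu uJ uW]] := hmin t z' a Z e' tT e'0 e'1 zZ ha aW'.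
  have hau := strategy_Loo ha hu.
  have := aJ u hu; move: uJ.
  have [y [had hy yt ->]] := payoff_traj x' tT hu hau.
  have [y' [had' hy' yt' ->]] := payoff_traj z' tT hu hau.
  have := hC t u (a u) y y' Z had hy hy'; rewrite yt yt' => /(_ xZ zZ) H.
  have {H} : `|cost G t u (a u) y - cost G t u (a u) y'| <= D.
    apply: H; first by apply: le_trans uW _; rewrite ler_wpM2r// lerDr ltW.
    by apply: le_trans (aW' u hu) _; rewrite ler_wpM2r// lerDl ltW.
  rewrite ler_norml => /andP[_].
  generalize (cost G t u (a u) y) (cost G t u (a u) y') (fine (V t x')) (fine (V t z')) D.
  move=> *; lra.
rewrite ler_norml one andbT lerNl opprB.
by have := one z x; rewrite /japmax maxC enorm_distC.
Qed.

End game_values.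

(** * Hoelder regularity in time *)

Section game_time.
Context {R : realType} {n m1 m2 : nat} (G : game R n m1 m2).
Local Notation T := (horizon G).
Local Notation L := (gL G).
Local Notation mu := (gmu G).
Local Notation f := (dyn G).
Local Notation g := (rcost G).
Local Notation h := (tcost G).
Local Notation U1 := (ctrl1 G).
Local Notation U2 := (ctrl2 G).
Local Notation w1 := (wgt (grho1 G)).
Local Notation w2 := (wgt (grho2 G)).
Local Notation a1 := (gsig1 G / grho1 G).
Local Notation a2 := (gsig2 G / grho2 G).
Local Notation kap := (kap G).
Implicit Types (t s : R) (x z : 'rV[R]_n) (y : R -> 'rV[R]_n).

Local Notation V := (upper_value T U1 U2 f g h).
Local Notation W1 t u := (integ t T (fun s => w1 (u s))).
Local Notation W2 t v := (integ t T (fun s => w2 (v s))).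

Definition gexp : R :=
  Num.min ((grho1 G - gsig1 G) / grho1 G) ((grho2 G - gsig2 G) / grho2 G).

Lemma gexp_le1 : gexp <= 1 - a1.
Proof. by rewrite /gexp ge_min mulrBl mulfV ?lexx// gt_eqF// grho1_gt0. Qed.

Lemma gexp_le2 : gexp <= 1 - a2.
Proof.
rewrite /gexp ge_min; apply/orP; right.
by rewrite mulrBl mulfV ?lexx// gt_eqF// grho2_gt0.
Qed.

Lemma gexp_gt0 : 0 < gexp.
Proof.
rewrite /gexp !mulrBl !mulfV ?gt_eqF ?grho1_gt0 ?grho2_gt0//.
by rewrite lt_min !subr_gt0 a1_lt1 a2_lt1.
Qed.

Lemma gexp_lt1 : gexp <= 1.
Proof. by apply: le_trans gexp_le1 _; rewrite gerBl a1_ge0. Qed.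

(** Reduces the different rates to the smallest exponent: the excess power lies in [0, 1] and d <=
    T, so it costs at most 1 + T. *)
Lemma powR_gexp (d b : R) : 0 < d -> d <= T -> gexp <= b -> b <= 1 ->
  d `^ b <= (1 + T) * d `^ gexp.
Proof.
move=> d0 dT gb b1; have T0 := horizon_gt0 G.
rewrite -(subrK gexp b) powRD_pos//; apply: ler_wpM2r; first exact: powR_ge0.
have bg : 0 <= b - gexp by rewrite subr_ge0.
have bg1 : b - gexp <= 1 by have := gexp_gt0; lra.
apply: le_trans (_ : (1 + T) `^ (b - gexp) <= _).
  by apply: powR_mono => //; [exact: ltW|lra].
rewrite -[leRHS]powRr1; last lra.
by apply: ler_powR => //; lra.
Qed.

(** Controls extended by 0 vanish on [t, t') only; the right end is a null set. *)
Lemma integ_le_co (a b : R) (p q : R -> R) : inton a b p -> inton a b q ->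
  (forall s, a <= s < b -> p s <= q s) -> integ a b p <= integ a b q.
Proof.
move=> hp hq pq; apply: integ_le_ae => //.
exists [set b]; split => //; first exact: lebesgue_measure_set1.
move=> s /= nh; apply: contrapT => sb; apply: nh => /andP[as_ sb'].
apply: pq; rewrite as_/= lt_def sb' andbT eq_sym; exact/eqP.
Qed.

(** Hoelder's bound: in [powR_le_affine] the scale B / d, the largest possible mean of the weight
    over [t, t'], makes both terms equal to B ^ a * d ^ (1 - a) at most. *)
Lemma integ_early m (U : set 'rV[R]_m) t t' (u : R -> 'rV[R]_m) (rho a B : R) :
  is_control U t T u -> inton t T (fun s => wgt rho (u s)) -> 0 <= a -> a <= 1 ->
  t < t' -> t' <= T -> 1 <= B -> integ t T (fun s => wgt rho (u s)) <= B ->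
  integ t t' (fun s => wgt rho (u s) `^ a) <= 2 * B * (t' - t) `^ (1 - a).
Proof.
move=> cu hw a0 a1 tt' t'T B1 WB; set d := t' - t.
have d0 : 0 < d by rewrite subr_gt0.
have B0 : 0 < B by exact: lt_le_trans B1.
have d1 : 0 < d `^ (- 1) by exact: powR_gt0.
have Y0 : 0 < B * d `^ (- 1) by exact: mulr_gt0.
have hw' : inton t t' (fun s => wgt rho (u s)) by apply: inton_sub hw.
apply: le_trans (_ : integ t t' (fun s => (B * d `^ (- 1)) `^ a +
    (B * d `^ (- 1)) `^ (a - 1) * wgt rho (u s)) <= _).
  apply: integ_le.
  - by apply: inton_sub (inton_wgt_pow cu hw a0 a1).
  - by apply: intonD; [exact: inton_cst|exact: intonZ].
  - by move=> s _; apply: powR_le_affine; rewrite ?wgt_ge0.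
rewrite integD; [|exact: inton_cst|exact: intonZ].
rewrite integ_cst ?(ltW tt')// integZ// -/d !powRM ?(ltW B0) ?(ltW d1)// -!powRrM.
have Wp : integ t t' (fun s => wgt rho (u s)) <= B.
  by apply: le_trans WB; apply: integ_mono => // s _; exact: wgt_ge0.
have Bt : B `^ a <= B by rewrite -[leRHS]powRr1 ?(ltW B0)//; exact: ler_powR.
have e1 : d `^ (- 1 * a) * d = d `^ (1 - a).
  by rewrite -[X in _ * X]powRr1 ?(ltW d0)// -powRD_pos//; congr (_ `^ _); ring.
have e2 : B `^ (a - 1) * B = B `^ a.
  by rewrite -[X in _ * X]powRr1 ?(ltW B0)// -powRD_pos// subrK.
have e3 : - 1 * (a - 1) = 1 - a by ring.
rewrite -mulrA e1 e3.
have dp : 0 <= d `^ (1 - a) by exact: powR_ge0.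
have s1 : B `^ a * d `^ (1 - a) <= B * d `^ (1 - a) by exact: ler_wpM2r.
have s2 : B `^ (a - 1) * d `^ (1 - a) * integ t t' (fun s => wgt rho (u s)) <= B * d `^ (1 - a).
  apply: le_trans s1; rewrite -e2 [leLHS]mulrAC; apply: ler_wpM2r => //.
  by apply: ler_wpM2l => //; exact: powR_ge0.
move: s1 s2; generalize (B `^ (a - 1) * d `^ (1 - a) * integ t t' (fun s => wgt rho (u s))).
by generalize (B `^ a * d `^ (1 - a)) (d `^ (1 - a)) => *; lra.
Qed.

Section shift.
Variables (K : R) (K0 : 0 <= K).

Let Ag := Cgrow G * (1 + K).
Let Ag1 : 1 <= Ag.
Proof. by rewrite -[leLHS]mulr1; apply: ler_pM; rewrite ?Cgrow_ge1// lerDl. Qed.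

Lemma growth1 t u v y (Z : R) : adm G t u v -> traj G t u v y -> jap (y t) <= Z ->
  W1 t u <= K * Z `^ mu -> W2 t v <= K * Z `^ mu ->
  forall s, t <= s <= T -> jap (y s) <= Ag * Z.
Proof.
move=> had hy jZ w1' w2' s st.
have := @traj_growth _ _ _ _ _ t u v y 1 K Z had hy (lexx 1) K0.
rewrite mul1r => /(_ jZ w1' w2' s st); rewrite [1 `^ _](_ : _ = 1) ?mul1r//.
by rewrite powR1.
Qed.

(** The control integrals of [integ_early] dictate the exponent; the drift is of order t' - t, a
    rate at least as good. *)
Lemma start_dist : exists2 C : R, 0 < C & forall t t' u v y (Z : R),
  adm G t u v -> traj G t u v y -> jap (y t) <= Z ->
  W1 t u <= K * Z `^ mu -> W2 t v <= K * Z `^ mu -> t < t' -> t' <= T ->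
  enorm (y t' - y t) <= C * Z `^ mu * (t' - t) `^ gexp.
Proof.
have T0 := horizon_gt0 G; have L0 := gL_gt0 G; have mu1 := gmu_ge1 G; have ag := Ag1.
have k0 := K0.
exists (L * (1 + T) * (Ag + 4 * (K + 1))).
  by apply: mulr_gt0; [apply: mulr_gt0; lra|lra].
move=> t t' u v y Z had hy jZ w1' w2' tt' t'T.
have [/andP[t0 t_le] cu cv hu hv] := had.
have Z1 : 1 <= Z by exact: le_trans (jap_ge1 _) jZ.
have ZZ : Z <= Z `^ mu.
  by rewrite -[leLHS]powRr1; [exact: ler_powR|lra].
have Zm1 : 1 <= Z `^ mu by lra.
pose B := (K + 1) * Z `^ mu.
have B1 : 1 <= B by rewrite -[leLHS]mulr1; apply: ler_pM => //; lra.
have KB : K * Z `^ mu <= B by rewrite /B mulrDl mul1r lerDl; lra.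
have dT : t' - t <= T by lra.
have d0 : 0 < t' - t by rewrite subr_gt0.
have jy := growth1 had hy jZ w1' w2'.
have i1 := inton_wgt_pow cu hu (a1_ge0 G) (ltW (a1_lt1 G)).
have i2 := inton_wgt_pow cv hv (a2_ge0 G) (ltW (a2_lt1 G)).
have i12 := intonD i1 i2.
have ig := intonZ L (intonD (inton_cst t T (Ag * Z)) i12).
have tt'T : t <= t' <= T by rewrite (ltW tt') t'T.
apply: le_trans (path_dist hy ig _ tt'T) _.
  move=> s st; have [sT us vs] := adm_dom had st.
  apply: le_trans (dyn_growth (y s) sT us vs) _; apply: ler_wpM2l; first exact: ltW.
  by rewrite -addrA; apply: lerD => //; exact: jy.
have sub (p : R -> R) : inton t T p -> inton t t' p by move=> hp; apply: inton_sub hp.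
rewrite integZ; last exact: (sub _ (intonD (inton_cst t T (Ag * Z)) i12)).
rewrite integD; [|exact: inton_cst|exact: (sub _ i12)].
rewrite integ_cst ?(ltW tt')// integD; [|exact: sub|exact: sub].
have E1 := integ_early cu hu (a1_ge0 G) (ltW (a1_lt1 G)) tt' t'T B1 (le_trans w1' KB).
have E2 := integ_early cv hv (a2_ge0 G) (ltW (a2_lt1 G)) tt' t'T B1 (le_trans w2' KB).
have b1 : 1 - a1 <= 1 by rewrite gerBl a1_ge0.
have b2 : 1 - a2 <= 1 by rewrite gerBl a2_ge0.
have P1 := powR_gexp d0 dT gexp_le1 b1.
have P2 := powR_gexp d0 dT gexp_le2 b2.
have P3 := powR_gexp d0 dT gexp_lt1 (lexx 1).
rewrite powRr1 ?(ltW d0)// in P3.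
have B0 : 0 <= 2 * B by apply: mulr_ge0 => //; exact: le_trans ler01 B1.
have ag0 : 0 <= Ag := le_trans ler01 ag.
have Z0 : 0 <= Z := le_trans ler01 Z1.
have {E1 P1} E1 := le_trans E1 (ler_wpM2l B0 P1).
have {E2 P2} E2 := le_trans E2 (ler_wpM2l B0 P2).
have AZ : Ag * Z <= Ag * Z `^ mu by exact: ler_wpM2l.
have AZ0 : 0 <= Ag * Z by exact: mulr_ge0.
have gp : 0 <= (t' - t) `^ gexp by exact: powR_ge0.
have E3 : Ag * Z * (t' - t) <= Ag * Z `^ mu * ((1 + T) * (t' - t) `^ gexp).
  by apply: ler_pM => //; exact: ltW.
rewrite -[X in _ <= X]mulrA -[X in _ <= X]mulrA -[X in _ <= X]mulrA.
apply: ler_wpM2l; first exact: ltW.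
move: E1 E2 E3; rewrite /B.
generalize (integ t t' (fun s => w1 (u s) `^ a1)) (integ t t' (fun s => w2 (v s) `^ a2)).
generalize ((t' - t) `^ gexp) (Z `^ mu) (Ag * Z * (t' - t)) Ag => *; lra.
Qed.

Lemma powR_double (Z : R) : 1 <= Z -> Z `^ mu * Z `^ mu = Z `^ (2 * mu).
Proof.
move=> Z1; rewrite -powRD_pos; last exact: lt_le_trans Z1.
by congr (_ `^ _); ring.
Qed.

(** After t' both trajectories use the same controls and differ only in their initial points, y t'
    and y t. The Lipschitz bound contributes Z ^ (mu - 1), the displacement Z ^ mu, whence the power
    2 * mu. *)
Lemma cost_shift : exists2 C : R, 0 < C & forall t t' u v y (z : R -> 'rV[R]_n) (Z : R),
  adm G t u v -> traj G t u v y -> traj G t' u v z -> z t' = y t -> jap (y t) <= Z ->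
  W1 t u <= K * Z `^ mu -> W2 t v <= K * Z `^ mu -> t < t' -> t' <= T ->
  `|cost G t' u v y - cost G t' u v z| <= C * Z `^ (2 * mu) * (t' - t) `^ gexp.
Proof.
have mu1 := gmu_ge1 G; have mup := mu_gt0 G; have ag := Ag1.
have [C1 C10 h1] := start_dist; have [C2 C20 h2] := cost_lipschitz G K0.
have A0 : 0 < Ag `^ (mu - 1) by apply: powR_gt0; lra.
exists (C2 * Ag `^ (mu - 1) * C1); first by do 2 (apply: mulr_gt0 => //).
move=> t t' u v y z Z had hy hz zy jZ w1' w2' tt' t'T.
have [/andP[t0 t_le] cu cv hu hv] := had.
have Z1 : 1 <= Z by exact: le_trans (jap_ge1 _) jZ.
have Z0 : 0 < Z by lra.
have tt'T : t <= t' <= T by rewrite (ltW tt') t'T.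
have jy := growth1 had hy jZ w1' w2' tt'T.
have ZA : Z <= Ag * Z by rewrite ler_peMl// ltW.
have had' := adm_sub had tt'T.
have hy' : traj G t' u v y by exact: path_sub hy.
have Kr : K * Z `^ mu <= K * (Ag * Z) `^ mu.
  by apply: ler_wpM2l => //; apply: powR_mono => //; exact: ltW.
have m1' : W1 t' u <= W1 t u.
  by apply: integ_mono => //; [exact: ltW|move=> s _; exact: wgt_ge0].
have m2' : W2 t' v <= W2 t v.
  by apply: integ_mono => //; [exact: ltW|move=> s _; exact: wgt_ge0].
have jz : jap (z t') <= Ag * Z by rewrite zy; exact: le_trans jZ ZA.
have := h2 t' u v y z (Ag * Z) had' hy' hz jy jz
  (le_trans m1' (le_trans w1' Kr)) (le_trans m2' (le_trans w2' Kr)).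
move=> /le_trans; apply; rewrite zy.
have D := h1 t t' u v y Z had hy jZ w1' w2' tt' t'T.
rewrite powRM; [|lra|exact: ltW].
have Zm : Z `^ (mu - 1) <= Z `^ mu by apply: ler_powR => //; lra.
have Zm0 : 0 <= Z `^ (mu - 1) by exact: powR_ge0.
rewrite -powR_double//.
apply: le_trans (_ : C2 * (Ag `^ (mu - 1) * Z `^ mu) * (C1 * Z `^ mu * (t' - t) `^ gexp) <= _).
  apply: ler_pM D; [|exact: enorm_ge0|].
    by apply: mulr_ge0; [exact: ltW|apply: mulr_ge0 => //; exact: ltW].
  by apply: ler_wpM2l; [exact: ltW|apply: ler_wpM2l => //; exact: ltW].
by rewrite le_eqVlt; apply/orP; left; apply/eqP; ring.
Qed.

(** One-sided on purpose: once the unfavourable weight vanishes, the remaining one has the right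
    sign. Its integral over [t, t'] is bounded but need not be small, so the opposite inequality
    would have no rate. *)
Lemma early_cost : exists2 C : R, 0 < C & forall t t' u v y (Z : R),
  adm G t u v -> traj G t u v y -> jap (y t) <= Z ->
  W1 t u <= K * Z `^ mu -> W2 t v <= K * Z `^ mu -> t < t' -> t' <= T ->
  let gy := fun s => g s (y s) (u s) (v s) in
  ((forall s, t <= s < t' -> u s = 0) ->
    integ t t' gy <= C * Z `^ (2 * mu) * (t' - t) `^ gexp) /\
  ((forall s, t <= s < t' -> v s = 0) ->
    - (C * Z `^ (2 * mu) * (t' - t) `^ gexp) <= integ t t' gy).
Proof.
have T0 := horizon_gt0 G; have L0 := gL_gt0 G; have mu1 := gmu_ge1 G; have ag := Ag1.
have mup := mu_gt0 G; have c0 := gc_gt0 G.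
have A0 : 0 < Ag `^ mu by apply: powR_gt0; lra.
exists (L * Ag `^ mu * (1 + T)); first by apply: mulr_gt0; [exact: mulr_gt0|lra].
move=> t t' u v y Z had hy jZ w1' w2' tt' t'T gy.
have [/andP[t0 t_le] cu cv hu hv] := had.
have Z1 : 1 <= Z by exact: le_trans (jap_ge1 _) jZ.
have Z0 : 0 < Z by lra.
have dT : t' - t <= T by lra.
have d0 : 0 < t' - t by rewrite subr_gt0.
have jy := growth1 had hy jZ w1' w2'.
have P3 := powR_gexp d0 dT gexp_lt1 (lexx 1).
rewrite powRr1 ?(ltW d0)// in P3.
have Zm : Z `^ mu <= Z `^ (2 * mu) by apply: ler_powR => //; lra.
pose X := L * (Ag `^ mu * Z `^ mu).
have Xp : 0 <= X.
  by apply: mulr_ge0; [exact: ltW|apply: mulr_ge0; exact: powR_ge0].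
have XB : X * (t' - t) <= L * Ag `^ mu * (1 + T) * Z `^ (2 * mu) * (t' - t) `^ gexp.
  rewrite (_ : _ * (t' - t) `^ gexp =
    L * (Ag `^ mu * Z `^ (2 * mu)) * ((1 + T) * (t' - t) `^ gexp)); last by ring.
  apply: ler_pM => //; first exact: ltW.
  by apply: ler_wpM2l; [exact: ltW|apply: ler_wpM2l => //; exact: ltW].
have jX s : t <= s <= T -> L * jap (y s) `^ mu <= X.
  move=> st; apply: ler_wpM2l; first exact: ltW.
  rewrite -powRM; [|lra|exact: ltW].
  by apply: powR_mono; [exact: ltW|exact/ltW/jap_gt0|exact: jy].
have ig : inton t t' gy by apply: inton_sub (run_inton had hy).
have dom s : t <= s < t' -> t <= s <= T.
  by move=> /andP[-> st']; rewrite (le_trans (ltW st') t'T).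
split => z0.
- apply: le_trans XB; rewrite -integ_cst ?(ltW tt')//; apply: integ_le_co => //.
    exact: inton_cst.
  move=> s st; have [sT us vs] := adm_dom had (dom _ st).
  apply: le_trans (run_upper (y s) sT us vs) _.
  rewrite (z0 _ st) wgt0 ?grho1_gt0// addr0; apply: le_trans (jX _ (dom _ st)).
  by rewrite gerBl; apply: mulr_ge0; [exact: ltW|exact: wgt_ge0].
- apply: le_trans (_ : - (X * (t' - t)) <= _); first by rewrite lerN2.
  rewrite -mulNr -integ_cst ?(ltW tt')//; apply: integ_le_co => //.
    exact: inton_cst.
  move=> s st; have [sT us vs] := adm_dom had (dom _ st).
  apply: le_trans (run_lower (y s) sT us vs).
  rewrite (z0 _ st) wgt0 ?grho2_gt0// addr0.
  apply: le_trans (_ : - (L * jap (y s) `^ mu) <= _); first by rewrite lerN2; exact: (jX _ (dom _ st)).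
  by rewrite lerDr; apply: mulr_ge0; [exact: ltW|exact: wgt_ge0].
Qed.

End shift.

Definition pad m t' (u : R -> 'rV[R]_m) : R -> 'rV[R]_m := fun s => if s < t' then 0 else u s.

Lemma pad_early m t' (u : R -> 'rV[R]_m) s : s < t' -> pad t' u s = 0.
Proof. by rewrite /pad => ->. Qed.

Lemma pad_late m t' (u : R -> 'rV[R]_m) s : t' <= s -> pad t' u s = u s.
Proof. by rewrite /pad ltNge => ->. Qed.

Lemma pad_control m (U : set 'rV[R]_m) t t' u : U 0 -> is_control U t' T u ->
  is_control U t T (pad t' u).
Proof.
move=> U0 [uU mu_]; split => [s /andP[ts sT]|i].
  by rewrite /pad; case: ltP => // t's; apply: uU; rewrite t's.
rewrite (_ : (fun s => _) = (fun s => if s < t' then 0 else u s 0 i)); last first.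
  by apply/funext => s; rewrite /pad; case: ifP => // _; rewrite mxE.
apply: measurable_fun_if => //.
- by apply: measurable_fun_ltr; [exact: measurable_id|exact: measurable_cst].
- apply: measurable_funS (mu_ i) => // s [] /=; rewrite !in_itv/= => /andP[_ ->].
  by rewrite andbT => /negbT; rewrite -leNgt.
Qed.

Lemma pad_inton (t t' : R) (p q : R -> R) : inton t' T p -> (forall s, s < t' -> q s = 0) ->
  (forall s, t' <= s -> q s = p s) -> inton t T q.
Proof.
move=> hp q0 qp.
move: hp; rewrite /inton => /(iffLR (@integrable_mkcond _ _ _ (@lebesgue_measure R) `[t', T]
  (fun s => (p s)%:E) (measurable_itv _))).
move=> /(@integrableS _ _ _ (@lebesgue_measure R) _ `[t, T] _ measurableT (measurable_itv _)).
move=> /(_ (@subsetT _ _)); apply: eq_integrable => // s; rewrite inE/= in_itv/= => /andP[ts sT].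
rewrite patchE mem_setE in_itv/= sT andbT; case: leP => h /=.
  by rewrite qp.
by rewrite q0.
Qed.

Lemma pad_L1 m (U : set 'rV[R]_m) t t' u : U 0 -> controls_L1 U t' T u ->
  controls_L1 U t T (pad t' u).
Proof.
move=> U0 /(@L1_control_integrable _ _ _ _ G)[cu hu].
apply/(@L1_control_integrable _ _ _ _ G); split; first exact: pad_control.
apply: (pad_inton t hu) => s h; first by rewrite pad_early// enorm0.
by rewrite pad_late.
Qed.

Lemma pad_Loo m (U : set 'rV[R]_m) t t' u : U 0 -> controls_Loo U t' T u ->
  controls_Loo U t T (pad t' u).
Proof.
move=> U0 [cu [M hM]]; split; first exact: pad_control.
exists `|M|; apply: ae_mono hM => s hs /andP[ts sT]; rewrite /pad.
case: ltP => [_|t's]; first by rewrite enorm0.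
by apply: le_trans (ler_norm M); apply: hs; rewrite t's.
Qed.

Lemma Loo_sub m (U : set 'rV[R]_m) t t' u : t <= t' -> controls_Loo U t T u ->
  controls_Loo U t' T u.
Proof.
move=> tt' [cu [M hM]]; split; first exact: (control_sub tt' cu).
exists M; apply: ae_mono hM => s hs /andP[t's sT]; apply: hs.
by rewrite (le_trans tt' t's).
Qed.

Lemma L1_sub m (U : set 'rV[R]_m) t t' u : t <= t' -> controls_L1 U t T u ->
  controls_L1 U t' T u.
Proof.
move=> tt' /(@L1_control_integrable _ _ _ _ G)[cu hu].
apply/(@L1_control_integrable _ _ _ _ G); split; first exact: (control_sub tt' cu).
exact: inton_sub hu.
Qed.

Lemma strategy_restrict t t' a : t <= t' -> strategies U1 U2 t T a ->
  strategies U1 U2 t' T (fun w => a (pad t' w)).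
Proof.
have [_ U10] := ctrl1P G; move=> tt' [ha na]; split => [w hw|w w' th hw hw' /andP[t'th thT] ww'].
  by apply: (Loo_sub tt'); apply: ha; exact: pad_L1.
have pp : {ae @lebesgue_measure R, forall s, t <= s <= th -> pad t' w s = pad t' w' s}.
  apply: ae_mono ww' => s hs /andP[ts sth]; rewrite /pad; case: ltP => // t's.
  by apply: hs; rewrite t's.
have tth : t <= th <= T by rewrite (le_trans tt' t'th).
have := na _ _ th (pad_L1 t U10 hw) (pad_L1 t U10 hw') tth pp.
by apply: ae_mono => s hs /andP[t's sth]; apply: hs; rewrite (le_trans tt' t's).
Qed.

Lemma strategy_extend t t' a : t <= t' -> strategies U1 U2 t' T a ->
  strategies U1 U2 t T (fun w => pad t' (a w)).
Proof.
have [_ U20] := ctrl2P G; move=> tt' [ha na]; split => [w hw|w w' th hw hw' /andP[tth thT] ww'].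
  by apply: pad_Loo => //; apply: ha; exact: (L1_sub tt').
have [tht'|t'th] := ltP th t'.
  apply: aeW => s /andP[_ sth]; rewrite !pad_early//; exact: le_lt_trans tht'.
have ww2 : {ae @lebesgue_measure R, forall s, t' <= s <= th -> w s = w' s}.
  by apply: ae_mono ww' => s hs /andP[t's sth]; apply: hs; rewrite (le_trans tt' t's).
have t'thT : t' <= th <= T by rewrite t'th.
have := na _ _ th (L1_sub tt' hw) (L1_sub tt' hw') t'thT ww2.
apply: ae_mono => s hs /andP[ts sth]; rewrite /pad; case: ltP => // t's.
by apply: hs; rewrite t's.
Qed.

Lemma traj_ext t u v u' v' y : (forall s, t <= s -> u s = u' s) ->
  (forall s, t <= s -> v s = v' s) -> traj G t u v y -> traj G t u' v' y.
Proof.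
move=> uu' vv' hy i; have [h1 h2] := hy i; split.
  by apply: inton_eq h1 => s /andP[ts _]; rewrite uu'// vv'.
move=> s st; rewrite (h2 s st); congr (_ + _).
by apply: eq_integ => r /andP[tr _]; rewrite uu'// vv'.
Qed.

Lemma cost_ext t u v u' v' y : (forall s, t <= s -> u s = u' s) ->
  (forall s, t <= s -> v s = v' s) -> cost G t u v y = cost G t u' v' y.
Proof.
move=> uu' vv'; congr (_ + _); apply: eq_integ => s /andP[ts _].
by rewrite uu'// vv'.
Qed.

Lemma cost_split t t' u v y : adm G t u v -> traj G t u v y -> t <= t' <= T ->
  cost G t u v y = integ t t' (fun s => g s (y s) (u s) (v s)) + cost G t' u v y.
Proof.
move=> had hy tt'; rewrite /cost addrA; congr (_ + _).
by apply: integ_split => //; exact: run_inton.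
Qed.

Lemma W_pad m (rho : R) t t' (u : R -> 'rV[R]_m) : 0 < rho -> t <= t' <= T ->
  inton t T (fun s => wgt rho (pad t' u s)) ->
  integ t T (fun s => wgt rho (pad t' u s)) <= integ t' T (fun s => wgt rho (u s)).
Proof.
move=> r0 tt'T hi; have [tt' t'T] := andP tt'T.
rewrite (integ_split tt'T hi).
have -> : integ t' T (fun s => wgt rho (pad t' u s)) = integ t' T (fun s => wgt rho (u s)).
  by apply: eq_integ => s /andP[t's _]; rewrite pad_late.
rewrite gerDr; apply: le_trans (_ : integ t t' (fun=> 0) <= _).
  apply: integ_le_co; [by apply: inton_sub hi|exact: inton_cst|].
  by move=> s /andP[_ st']; rewrite pad_early// wgt0.
by rewrite integ_cst// mul0r.
Qed.

Lemma value_holder : exists2 C : R, 0 < C & forall t t' x, 0 <= t -> t < t' -> t' <= T ->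
  `|fine (V t x) - fine (V t' x)| <= C * jap x `^ (2 * mu) * (t' - t) `^ gexp.
Proof.
have [K K0 hopt] := near_optimal G; have [K' K'0 hmin] := near_minimal G (ltW K0).
have KK0 : 0 <= K + K' by lra.
have [C1 C10 shift] := cost_shift KK0; have [C2 C20 early] := early_cost KK0.
have [_ U10] := ctrl1P G; have [_ U20] := ctrl2P G.
exists (C1 + C2); first by rewrite addr_gt0.
move=> t t' x t0 tt' t'T.
have t_le : t <= t' := ltW tt'.
have tT : 0 <= t <= T by rewrite t0 (le_trans t_le).
have t'T2 : 0 <= t' <= T by rewrite (le_trans t0 t_le).
have tt'T : t <= t' <= T by rewrite t_le.
pose B := jap x `^ mu.
have B0 : 0 <= B by exact: powR_ge0.
have KB : K * B <= (K + K') * B by rewrite ler_wpM2r// lerDl ltW.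
have K'B : K' * B <= (K + K') * B by rewrite ler_wpM2r// lerDr ltW.
rewrite -mulrA mulrDl !mulrA.
set D1 := C1 * _ * _; set D2 := C2 * _ * _.
rewrite ler_norml lerNl opprB; apply/andP; split; apply/ler_addgt0Pr => e e0.
all: pose e' := Num.min (e / 2) 1.
all: have e'0 : 0 < e' by rewrite /e' lt_min ltr01 andbT divr_gt0.
all: have e'1 : e' <= 1 by rewrite ge_min lexx orbT.
all: have e'e : e' <= e / 2 by rewrite ge_min lexx.
(* V t' x exceeds V t x by little: the strategy is chosen at t' and extended, so its reply is zero
   before t' and the early cost is bounded below. *)
- have [a [ha aW aJ]] := hopt t' x e' t'T2 e'0 e'1.
  have hax := strategy_extend t_le ha.
  have W2x u : controls_Loo U1 t T u -> W2 t (pad t' (a u)) <= K * B.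
    move=> hu; have hu' := Loo_sub t_le hu.
    apply: le_trans (aW u hu').
    have [_ _ _ _ i2] := Loo_adm tT hu (strategy_Loo hax hu).
    exact: (W_pad (grho2_gt0 G) tt'T i2).
  have [u [hu uJ uW]] := hmin t x _ (jap x) e' tT e'0 e'1 (lexx _) hax W2x.
  have hu' := Loo_sub t_le hu.
  have := aJ u hu'; move: uJ.
  have [y [had hy yt ->]] := payoff_traj x tT hu (strategy_Loo hax hu).
  have [z [_ hz zt ->]] := payoff_traj x t'T2 hu' (strategy_Loo ha hu').
  have ve s : t' <= s -> a u s = pad t' (a u) s by move=> t's; rewrite pad_late.
  have hz' := traj_ext (fun s _ => erefl (u s)) ve hz.
  rewrite (cost_ext z (fun s _ => erefl (u s)) ve).
  rewrite (cost_split had hy tt'T).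
  have w1' := le_trans uW K'B; have w2' := le_trans (W2x u hu) KB.
  have jx : jap (y t) <= jap x by rewrite yt.
  have zy : z t' = y t by rewrite zt yt.
  have := shift t t' _ _ y z (jap x) had hy hz' zy jx w1' w2' tt' t'T.
  rewrite -/D1 ler_norml => /andP[sh _].
  have [_ er] := early t t' _ _ y (jap x) had hy jx w1' w2' tt' t'T.
  have {er} := er (fun s h => pad_early _ (proj2 (andP h))).
  rewrite -/D2; move: sh.
  generalize (integ t t' (fun s => g s (y s) (u s) (pad t' (a u) s))).
  generalize (cost G t' u (pad t' (a u)) y) (cost G t' u (pad t' (a u)) z).
  by generalize (fine (V t x)) (fine (V t' x)) D1 D2 => *; lra.
(* The converse: the strategy is chosen at t, the control at t' and padded, so u vanishes before t'
   and the early cost is bounded above. *)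
- have [a [ha aW aJ]] := hopt t x e' tT e'0 e'1.
  have har := strategy_restrict t_le ha.
  have W2r u : controls_Loo U1 t' T u -> W2 t' (a (pad t' u)) <= K * B.
    move=> hu; have hu' := pad_Loo t U10 hu.
    apply: le_trans (aW _ hu').
    have [_ _ _ _ i2] := Loo_adm tT hu' (strategy_Loo ha hu').
    by apply: integ_mono => // s _; exact: wgt_ge0.
  have [u [hu uJ uW]] := hmin t' x _ (jap x) e' t'T2 e'0 e'1 (lexx _) har W2r.
  have hu' := pad_Loo t U10 hu.
  have := aJ _ hu'; move: uJ.
  have hau := strategy_Loo ha hu'.
  have [y [had hy yt ->]] := payoff_traj x tT hu' hau.
  have [z [_ hz zt ->]] := payoff_traj x t'T2 hu (strategy_Loo har hu).
  have ue s : t' <= s -> u s = pad t' u s by move=> t's; rewrite pad_late.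
  have hz' := traj_ext ue (fun s _ => erefl (a (pad t' u) s)) hz.
  rewrite (cost_ext z ue (fun s _ => erefl (a (pad t' u) s))).
  rewrite (cost_split had hy tt'T).
  have [_ _ _ i1 _] := had.
  have w1' := le_trans (W_pad (grho1_gt0 G) tt'T i1) (le_trans uW K'B).
  have w2' := le_trans (aW _ hu') KB.
  have jx : jap (y t) <= jap x by rewrite yt.
  have zy : z t' = y t by rewrite zt yt.
  have := shift t t' _ _ y z (jap x) had hy hz' zy jx w1' w2' tt' t'T.
  rewrite -/D1 ler_norml => /andP[_ sh].
  have [er _] := early t t' _ _ y (jap x) had hy jx w1' w2' tt' t'T.
  have {er} := er (fun s h => pad_early _ (proj2 (andP h))).
  rewrite -/D2; move: sh.
  generalize (integ t t' (fun s => g s (y s) (pad t' u s) (a (pad t' u) s))).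
  generalize (cost G t' (pad t' u) (a (pad t' u)) y) (cost G t' (pad t' u) (a (pad t' u)) z).
  by generalize (fine (V t x)) (fine (V t' x)) D1 D2 => *; lra.
Qed.

End game_time.

(** * Exchange of the players *)

Lemma within_swap_controls (R : realType) (n m1 m2 : nat) (T : R) (U1 : set 'rV[R]_m1)
    (U2 : set 'rV[R]_m2) (S : topologicalType)
    (F : R * 'rV[R]_n * 'rV[R]_m1 * 'rV[R]_m2 -> S) :
  {within game_domain T U1 U2, continuous F} ->
  {within game_domain T U2 U1, continuous
     (fun p : R * 'rV[R]_n * 'rV[R]_m2 * 'rV[R]_m1 => F (p.1.1, p.2, p.1.2))}.
Proof.
move=> cF; apply/subspace_continuousP => p [h1 h2 h3].
have Dp : game_domain T U1 U2 (p.1.1, p.2, p.1.2) by split.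
move/subspace_continuousP/(_ _ Dp) : cF => cF.
apply: (@cvg_comp _ _ _ (fun p : R * 'rV[R]_n * 'rV[R]_m2 * 'rV[R]_m1 => (p.1.1, p.2, p.1.2))
  F _ _ _ _ cF) => A hA.
have c11 : continuous (fun q : R * 'rV[R]_n * 'rV[R]_m2 * 'rV[R]_m1 => q.1.1).
  by move=> q; apply: (@cvg_comp _ _ _ fst fst); exact: cvg_fst.
have c12 : continuous (fun q : R * 'rV[R]_n * 'rV[R]_m2 * 'rV[R]_m1 => q.1.2).
  by move=> q; apply: (@cvg_comp _ _ _ fst snd); [exact: cvg_fst|exact: cvg_snd].
have c2 : continuous (fun q : R * 'rV[R]_n * 'rV[R]_m2 * 'rV[R]_m1 => q.2).
  by move=> q; exact: cvg_snd.
have hc : continuous (fun q : R * 'rV[R]_n * 'rV[R]_m2 * 'rV[R]_m1 => (q.1.1, q.2, q.1.2)).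
  by move=> q; exact: (cvg_pair (cvg_pair (c11 q) (c2 q)) (c12 q)).
have := hc p _ hA; rewrite /= !nbhs_simpl /within /= => hA'.
by apply: filterS hA' => q hq [k1 k2 k3]; apply: hq; split.
Qed.

Lemma dynamics_cond_swap (R : realType) (n m1 m2 : nat) (T L s1 s2 c0 c1 c2 : R)
    (U1 : set 'rV[R]_m1) (U2 : set 'rV[R]_m2) f :
  @dynamics_cond R n m1 m2 T L s1 s2 c0 c1 c2 U1 U2 f ->
  dynamics_cond T L s2 s1 c0 c2 c1 U2 U1 (fun t x u v => f t x v u).
Proof.
move=> [cf hf]; split; first exact: (within_swap_controls cf).
move=> t x y u v tT hu hv; have [h1 h2 h3] := hf t x y v u tT hv hu.
split; last exact: h3.
- by apply: (le_trans h1); rewrite addrAC; exact: lexx.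
- by apply: (le_trans h2); rewrite addrAC; exact: lexx.
Qed.

Lemma running_cost_cond_swap (R : realType) (n m1 m2 : nat) (T L c r1 r2 mu : R)
    (U1 : set 'rV[R]_m1) (U2 : set 'rV[R]_m2) g :
  @running_cost_cond R n m1 m2 T L c r1 r2 mu U1 U2 g ->
  running_cost_cond T L c r2 r1 mu U2 U1 (fun t x u v => - g t x v u).
Proof.
move=> [cg hg]; split.
  apply/subspace_continuousP => p Dp; apply: cvgN.
  by move/subspace_continuousP/(_ p Dp): (within_swap_controls cg).
move=> t x y u v tT hu hv; have [h1 h2 h3] := hg t x y v u tT hv hu; split.
- by rewrite lerNr opprB; exact: h2.
- by rewrite lerNl opprB; exact: h1.
- by rewrite -opprD normrN; apply: (le_trans h3); rewrite addrAC; exact: lexx.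
Qed.

Lemma terminal_cost_cond_opp (R : realType) (n : nat) (L mu : R) (h : 'rV[R]_n -> R) :
  terminal_cost_cond L mu h -> terminal_cost_cond L mu (fun x => - h x).
Proof.
move=> [ch hl h0]; split; first by move=> x; exact: (cvgN (ch x)).
- by move=> x y; rewrite -opprD normrN.
- by rewrite normrN.
Qed.

Definition swap_game (R : realType) (n m1 m2 : nat) (G : game R n m1 m2) : game R n m2 m1 :=
  @Game R n m2 m1 (horizon G) (gL G) (gc G) (grho2 G) (grho1 G) (gsig2 G) (gsig1 G)
    (gmu G) (gmu0 G) (gmu2 G) (gmu1 G) (ctrl2 G) (ctrl1 G)
    (fun t x u v => dyn G t x v u) (fun t x u v => - rcost G t x v u) (fun x => - tcost G x)
    (horizon_gt0 G) (gL_gt0 G) (gc_gt0 G) (grho2_gt0 G) (grho1_gt0 G) (gsig2_ge0 G)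
    (gsig1_ge0 G) (gmu_ge1 G) (ctrl2P G) (ctrl1P G) (dynamics_cond_swap (dynP G))
    (running_cost_cond_swap (rcostP G)) (terminal_cost_cond_opp (tcostP G))
    (gsig2_mu G) (gsig1_mu G).

Section duality.
Context {R : realType} {n m1 m2 : nat} (G : game R n m1 m2).
Local Notation T := (horizon G).
Local Notation G' := (swap_game G).

Lemma payoff_swap t x u v : 0 <= t <= T -> controls_Loo (ctrl1 G) t T u ->
  controls_Loo (ctrl2 G) t T v ->
  payoff T (dyn G') (rcost G') (tcost G') t x v u =
  - payoff T (dyn G) (rcost G) (tcost G) t x u v.
Proof.
move=> tT hu hv; have [_ t_le] := andP tT.
have [had hy] : adm G t u v /\ traj G t u v (trajectory T (dyn G) t x u v).
  split; first exact: Loo_adm.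
  by have [] := trajectory_path t_le (trajectoryP x tT hu hv).
have ig := run_inton had hy.
(* Both games select the same trajectory, since the predicates under [get] are convertible; only the
   sign of the integral remains. *)
rewrite /payoff opprD; congr (_ + _).
rewrite -!integE -mulN1r -integZ//; apply: eq_integ => s _.
by rewrite mulN1r.
Qed.

Lemma lower_value_swap t x : 0 <= t <= T ->
  lower_value T (ctrl1 G) (ctrl2 G) (dyn G) (rcost G) (tcost G) t x =
  (- upper_value T (ctrl1 G') (ctrl2 G') (dyn G') (rcost G') (tcost G') t x)%E.
Proof.
move=> tT; rewrite /lower_value /upper_value -ereal_infN; congr ereal_inf.
rewrite image_comp; apply: eq_imagel => a ha /=.
rewrite -ereal_supN; congr ereal_sup.
rewrite image_comp; apply: eq_imagel => v hv /=.
have hav := @strategy_Loo _ _ _ _ G' t a v ha hv.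
by have /= -> := payoff_swap x tT hav hv; rewrite opprK.
Qed.

End duality.

(** * Joint continuity and the final assembly *)

Lemma within_value_continuous (R : realType) (n : nat) (T : R) (W : R -> 'rV[R]_n -> R)
    (C p gam : R) (N : 'rV[R]_n -> R) : 0 <= C -> 0 <= p -> 0 < gam -> (forall x, 0 <= N x) ->
  (forall t x z, 0 <= t <= T ->
     `|W t x - W t z| <= C * japmax x z `^ p * enorm (x - z)) ->
  (forall t s x, 0 <= t <= T -> 0 <= s <= T ->
     `|W t x - W s x| <= N x * `|t - s| `^ gam) ->
  {within [set q : R * 'rV[R]_n | 0 <= q.1 <= T], continuous (fun q => W q.1 q.2)}.
Proof.
move=> C0 p0 g0 N0 hx ht; apply/subspace_continuousP => -[t x] /= tT.
apply/cvgrPdist_lt => e e0; rewrite /from_subspace near_withinE.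
(* Spatial Lipschitz constant for points within max-distance 1 of x, hence within Euclidean distance
   n. *)
pose M := C * (jap x + n%:R) `^ p.
have M0 : 0 <= M by rewrite mulr_ge0 ?powR_ge0.
have Nx1 : 0 < N x + 1 by rewrite ltr_wpDl.
have Mn : 0 < M * n%:R + 1 by rewrite ltr_wpDl// mulr_ge0.
(* [d1] inverts the Hoelder modulus in time at the fixed point x, [d2] the Lipschitz modulus in
   space; the increments of 1 keep the denominators positive. *)
pose d1 := (e / 2 / (N x + 1)) `^ gam^-1.
pose d2 := e / 2 / (M * n%:R + 1).
have e2 : 0 < e / 2 by rewrite divr_gt0.
have d10 : 0 < d1 by rewrite powR_gt0// divr_gt0.
have d20 : 0 < d2 by rewrite divr_gt0.
pose d := Num.min 1 (Num.min d1 d2).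
have d0 : 0 < d by rewrite !lt_min ltr01 d10 d20.
have dd1 : d <= d1 by rewrite !ge_min lexx !orbT.
have dd2 : d <= d2 by rewrite !ge_min lexx !orbT.
have dle1 : d <= 1 by rewrite !ge_min lexx.
apply/nbhs_ballP; exists d => // -[s z] [/= bs [_ bz]] sT.
have exz : enorm (x - z) <= n%:R * d.
  apply: enorm_le_bound; first exact: ltW.
  by move=> i; rewrite !mxE; apply/ltW/bz.
have H1 : `|W t x - W s x| <= e / 2 * (N x / (N x + 1)).
  apply: le_trans (ht t s x tT sT) _.
  rewrite mulrC [leRHS]mulrCA [leRHS]mulrC; apply: ler_wpM2r => //.
  apply: le_trans (_ : d1 `^ gam <= _).
    by apply: powR_mono; [exact: ltW|exact: normr_ge0|exact: le_trans (ltW bs) dd1].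
  by rewrite /d1 -powRrM mulVf ?gt_eqF// powRr1// divr_ge0// ltW.
have H2 : `|W s x - W s z| <= M * (n%:R * d2).
  apply: le_trans (hx s x z sT) _; apply: ler_pM.
  - by rewrite mulr_ge0 ?powR_ge0.
  - exact: enorm_ge0.
  - apply: ler_wpM2l => //; apply: powR_mono => //; first exact: le_trans (japmax_ge1 _ _).
    apply: japmax_le; first by rewrite lerDl.
    apply: le_trans (jap_le_shift z x) _; rewrite lerD2l enorm_distC.
    by apply: le_trans exz _; rewrite ler_piMr.
  - by apply: le_trans exz _; rewrite ler_wpM2l.
have H3 : M * (n%:R * d2) < e / 2.
  rewrite (_ : M * (n%:R * d2) = e / 2 * (M * n%:R / (M * n%:R + 1))); last by rewrite /d2; ring.
  by rewrite -[ltRHS]mulr1 ltr_pM2l// ltr_pdivrMr// mul1r ltrDl.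
have H4 : e / 2 * (N x / (N x + 1)) <= e / 2.
  by rewrite -[leRHS]mulr1 ler_pM2l// ler_pdivrMr// mul1r lerDl.
rewrite (_ : W t x - W s z = (W t x - W s x) + (W s x - W s z)); last by ring.
apply: le_lt_trans (ler_normD _ _) _; lra.
Qed.

Lemma upper_value_regular (R : realType) (n m1 m2 : nat) (G : game R n m1 m2) :
  let V := upper_value (horizon G) (ctrl1 G) (ctrl2 G) (dyn G) (rcost G) (tcost G) in
  exists C : R, [/\ 0 < C,
    forall t x, 0 <= t <= horizon G -> V t x \is a fin_num,
    forall t x z, 0 <= t <= horizon G ->
      `|fine (V t x) - fine (V t z)| <= C * japmax x z `^ (gmu G - 1) * enorm (x - z) &
    forall t s x, 0 <= t <= horizon G -> 0 <= s <= horizon G ->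
      `|fine (V t x) - fine (V s x)| <= C * jap x `^ (2 * gmu G) * `|t - s| `^ gexp G].
Proof.
move=> V; have [C1 C10 h1] := value_lipschitz G; have [C2 C20 h2] := value_holder G.
have [C3 _ h3] := value_bounds G.
exists (C1 + C2); split.
- exact: addr_gt0.
- by move=> t x /(h3 t x)[].
- move=> t x z tT; apply: le_trans (h1 t x z tT) _.
  apply: ler_wpM2r; first exact: enorm_ge0.
  by apply: ler_wpM2r; [exact: powR_ge0|rewrite lerDl ltW].
- have H t s x : 0 <= t -> t < s -> s <= horizon G ->
      `|fine (V t x) - fine (V s x)| <= (C1 + C2) * jap x `^ (2 * gmu G) * `|t - s| `^ gexp G.
    move=> t0 ts sT; apply: le_trans (h2 t s x t0 ts sT) _.
    rewrite [`|t - s|]distrC [`|s - t|]ger0_norm ?subr_ge0 ?(ltW ts)//.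
    apply: ler_wpM2r; first exact: powR_ge0.
    by apply: ler_wpM2r; [exact: powR_ge0|rewrite lerDr ltW].
  move=> t s x /andP[t0 tT] /andP[s0 sT]; have [ts|st|->] := ltgtP t s.
  + exact: H.
  + by rewrite distrC [`|t - s|]distrC; exact: H.
  + rewrite !subrr normr0; apply: mulr_ge0; last exact: powR_ge0.
    by apply: mulr_ge0; [rewrite addr_ge0// ltW|exact: powR_ge0].
Qed.

Theorem theorem5p6 (R : realType) (n m1 m2 : nat)
    (T L c rho1 rho2 sigma1 sigma2 mu mu0 mu1 mu2 : R)
    (U1 : set 'rV[R]_m1) (U2 : set 'rV[R]_m2)
    (f : R -> 'rV[R]_n -> 'rV[R]_m1 -> 'rV[R]_m2 -> 'rV[R]_n)
    (g : R -> 'rV[R]_n -> 'rV[R]_m1 -> 'rV[R]_m2 -> R)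
    (h : 'rV[R]_n -> R)
    (hT : 0 < T) (hL : 0 < L) (hc : 0 < c)
    (hrho1 : 0 < rho1) (hrho2 : 0 < rho2)
    (hsigma1 : 0 <= sigma1) (hsigma2 : 0 <= sigma2) (hmu : 1 <= mu)
    (hU1 : control_set_cond U1) (hU2 : control_set_cond U2)
    (hf : dynamics_cond T L sigma1 sigma2 mu0 mu1 mu2 U1 U2 f)
    (hg : running_cost_cond T L c rho1 rho2 mu U1 U2 g)
    (hh : terminal_cost_cond L mu h)
    (he1 : sigma1 * mu < rho1) (he2 : sigma2 * mu < rho2) :
  (forall V : R -> 'rV[R]_n -> \bar R,
     V = upper_value T U1 U2 f g h \/ V = lower_value T U1 U2 f g h ->
     (forall (t : R) (x : 'rV[R]_n), 0 <= t <= T -> V t x \is a fin_num) /\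
     {within [set p : R * 'rV[R]_n | 0 <= p.1 <= T],
       continuous (fun p : R * 'rV[R]_n => fine (V p.1 p.2))}) /\
  exists (C : R) (N : R -> R),
    [/\ 0 < C,
        (forall r : R, 0 <= r -> 0 <= N r),
        (forall r s : R, 0 <= r -> r <= s -> N r <= N s),
        {within [set r : R | 0 <= r], continuous N}
      & forall V : R -> 'rV[R]_n -> \bar R,
          V = upper_value T U1 U2 f g h \/ V = lower_value T U1 U2 f g h ->
          (forall (t : R) (x xb : 'rV[R]_n), 0 <= t <= T ->
             `|fine (V t x) - fine (V t xb)|
               <= C * japmax x xb `^ (mu - 1) * enorm (x - xb)) /\
          (forall (t tb : R) (x : 'rV[R]_n), 0 <= t <= T -> 0 <= tb <= T ->
             `|fine (V t x) - fine (V tb x)|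
               <= N (enorm x) *
                  `|t - tb| `^ Num.min ((rho1 - sigma1) / rho1)
                                       ((rho2 - sigma2) / rho2))].
Proof.
pose G := @Game R n m1 m2 T L c rho1 rho2 sigma1 sigma2 mu mu0 mu1 mu2 U1 U2 f g h hT hL hc
  hrho1 hrho2 hsigma1 hsigma2 hmu hU1 hU2 hf hg hh he1 he2.
pose gam := Num.min ((rho1 - sigma1) / rho1) ((rho2 - sigma2) / rho2).
have gam0 : 0 < gam by exact: (gexp_gt0 G).
have [C1 [C10 f1 x1 t1]] := upper_value_regular G.
have [C2 [C20 f2 x2 t2]] := upper_value_regular (swap_game G).
have gamE : gexp (swap_game G) = gam by rewrite /gam minC.
rewrite gamE in t2.
pose C := C1 + C2.
have C0 : 0 < C by exact: addr_gt0.
have reg V : V = upper_value T U1 U2 f g h \/ V = lower_value T U1 U2 f g h ->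
  [/\ forall t x, 0 <= t <= T -> V t x \is a fin_num,
    forall t x z, 0 <= t <= T ->
      `|fine (V t x) - fine (V t z)| <= C * japmax x z `^ (mu - 1) * enorm (x - z) &
    forall t s x, 0 <= t <= T -> 0 <= s <= T ->
      `|fine (V t x) - fine (V s x)| <= C * jap x `^ (2 * mu) * `|t - s| `^ gam].
  have lowE t x : 0 <= t <= T -> lower_value T U1 U2 f g h t x =
      (- upper_value T (ctrl1 (swap_game G)) (ctrl2 (swap_game G)) (dyn (swap_game G))
        (rcost (swap_game G)) (tcost (swap_game G)) t x)%E := @lower_value_swap R n m1 m2 G t x.
  case=> ->; split.
  - exact: f1.
  - move=> t x z tT; apply: le_trans (x1 t x z tT) _.
    apply: ler_wpM2r; first exact: enorm_ge0.
    by apply: ler_wpM2r; [exact: powR_ge0|rewrite lerDl ltW].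
  - move=> t s x tT sT; apply: le_trans (t1 t s x tT sT) _.
    apply: ler_wpM2r; first exact: powR_ge0.
    by apply: ler_wpM2r; [exact: powR_ge0|rewrite lerDl ltW].
  - by move=> t x tT; rewrite lowE// fin_numN; exact: f2.
  - move=> t x z tT; rewrite !lowE// !fineN -opprD normrN.
    apply: le_trans (x2 t x z tT) _.
    apply: ler_wpM2r; first exact: enorm_ge0.
    by apply: ler_wpM2r; [exact: powR_ge0|rewrite lerDr ltW].
  - move=> t s x tT sT; rewrite !lowE//.
    rewrite !fineN -opprD normrN.
    apply: le_trans (t2 t s x tT sT) _.
    apply: ler_wpM2r; first exact: powR_ge0.
    by apply: ler_wpM2r; [exact: powR_ge0|rewrite lerDr ltW].
split.
  move=> V hV; have [fV xV tV] := reg V hV; split => //.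
  apply: (@within_value_continuous R n T (fun t x => fine (V t x)) C (mu - 1) gam
    (fun x => C * jap x `^ (2 * mu))) => //; first exact: ltW.
  - by rewrite subr_ge0.
  - by move=> x; rewrite mulr_ge0 ?powR_ge0// ltW.
(* An integer exponent above 2 * mu gives N r = C * (1 + r) ^ k, which is visibly continuous and
   nondecreasing and dominates C * <x> ^ (2 * mu) at r = |x|. *)
pose k := Num.bound (2 * mu).
have mu20 : 0 <= 2 * mu by apply: mulr_ge0; [exact: ler0n|exact: le_trans (gmu_ge1 G)].
have N0 r : 0 <= r -> 0 <= C * (1 + r) ^+ k.
  by move=> r0; apply: mulr_ge0; [exact: ltW|rewrite exprn_ge0// addr_ge0].
exists C, (fun r => C * (1 + r) ^+ k); split => //.
- move=> r s r0 rs; apply: ler_wpM2l; first exact: ltW.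
  by apply: lerXn2r; rewrite ?nnegrE ?addr_ge0 ?lerD2l// (le_trans r0).
- apply: continuous_subspaceT => r; apply: cvgM; first exact: cvg_cst.
  apply: (@cvg_comp _ _ _ (fun r : R => 1 + r) (fun s : R => s ^+ k) _ (nbhs (1 + r))); last first.
    exact: exprn_continuous.
  by apply: cvgD; [exact: cvg_cst|exact: cvg_id].
- move=> V hV; have [_ xV tV] := reg V hV; split => // t s x tT sT.
  apply: le_trans (tV t s x tT sT) _; apply: ler_wpM2r; first exact: powR_ge0.
  apply: ler_wpM2l; first exact: ltW.
  have j1 := jap_ge1 x.
  apply: le_trans (_ : jap x `^ k%:R <= _).
    by apply: ler_powR => //; apply/ltW; exact: archi_boundP.
  rewrite powR_mulrn; last exact: le_trans j1.
  apply: lerXn2r; rewrite ?nnegrE ?addr_ge0 ?enorm_ge0//; first exact: le_trans j1.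
  exact: jap_le_enorm.
Qed.
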